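(* Consider the two-group model without factors described in the context, with nonnull probability $\pi_1\in(0,1)$ not depending on $m$, and $\pi_0=1-\pi_1$. Suppose that $(\varepsilon_{m1},\dots,\varepsilon_{mm})$ has a block diagonal correlation matrix $\Gamma^{(m)}$ with blocks of fixed size $s_B$ in which all off-diagonal correlations equal $\rho_B$ (with $m$ a multiple of $s_B$). Let $\tau_*$ be the unique $t\in(0,1)$ satisfying $t/q=\pi_0t+\pi_1\bar\Phi(\bar\Phi^{-1}(t)-\mu_A)$. Then, as $m\to\infty$, $$\sqrt m\,(\mathrm{FDP}_m-\pi_0q)\xrightarrow{d}\mathcal N\Big(0,\ \frac{\pi_0^2q^2}{\tau_*^2}\Big(\frac{\tau_*}{\pi_0}-\tau_*^2+(s_B-1)\,\tilde\rho(\tau_*,\tau_*,\rho_B)\Big)\Big).$$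
   Context: Notation: $\Phi$ is the standard normal CDF, $\bar\Phi=1-\Phi$. Fix $q\in(0,1)$ and $\mu_A>0$. Model (no factor component). For each $m$: $H_{m1},\dots,H_{mm}$ are i.i.d. Bernoulli$(\pi_1)$ ($H_{mi}=1$ iff hypothesis $i$ is nonnull), independent of $(\varepsilon_{m1},\dots,\varepsilon_{mm})\sim\mathcal N(0,\Gamma^{(m)})$, where $\Gamma^{(m)}$ is an $m\times m$ correlation matrix (unit diagonal). The $p$-values are $P_{mi}=\bar\Phi(\mu_AH_{mi}+\varepsilon_{mi})$. Benjamini-Hochberg at level $q$: with sorted $p$-values $P_{m(1)}\le\dots\le P_{m(m)}$ and $P_{m(0)}=0$, let $R_m=\max\{j\in\{0,\dots,m\}:P_{m(j)}\le jq/m\}$, $\tau_{\mathrm{BH},m}=P_{m(R_m)}$, $V_m=\sum_{i=1}^mI\{P_{mi}\le\tau_{\mathrm{BH},m},H_{mi}=0\}$, $\mathrm{FDP}_m=V_m/\max\{R_m,1\}$. Blocks consist of $s_B$ consecutive indices; correlations between different blocks are $0$. For $t,s\in[0,1]$ and $|\rho|\le1$, $\tilde\rho(t,s,\rho)=\Pr(Z_1\ge\bar\Phi^{-1}(t),Z_2\ge\bar\Phi^{-1}(s))-ts$, where $(Z_1,Z_2)$ is centered bivariate normal with unit variances and correlation $\rho$. *)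

(* Defs.v *)
From HB Require Import structures.
From mathcomp Require Import all_boot all_order all_algebra.
From mathcomp Require Import all_classical all_reals all_analysis.
Set Implicit Arguments.
Unset Strict Implicit.
Unset Printing Implicit Defensive.
Import Order.TTheory GRing.Theory Num.Theory.
Import numFieldNormedType.Exports.
Local Open Scope classical_set_scope.
Local Open Scope ring_scope.

Section normal_laws.
Context {R : realType}.
Implicit Types t s x rho v : R.

Definition Phi x : R := fine (normal_prob (0 : R) 1 `]-oo, x]).

Definition Phibar x : R := 1 - Phi x.

(* The inverse of the decreasing bijection Phibar : R -> ]0, 1[, extended by
   +oo at t = 0 and by -oo at t = 1. *)
Definition Phibar_inv t : \bar R := ereal_sup [set x%:E | x in [set x | t <= Phibar x]].

(* N(0, v), parametrized by the variance. The case v = 0 is separate because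
   normal_prob with a null standard deviation is a uniform law. *)
Definition centered_normal v (A : set R) : \bar R :=
  if v == 0 then \d_(0 : R) A else normal_prob 0 (Num.sqrt v) A.

(* Law of (X, rho X + sqrt (1 - rho^2) Y) for independent standard normal
   X and Y, i.e. the centered normal law on R^2 with unit variances and
   correlation rho; meaningful for `|rho| <= 1. *)
Definition bivariate_normal rho : set (R * R) -> \bar R :=
  pushforward (normal_prob (0 : R) 1 \x normal_prob (0 : R) 1)%E
    (fun z => (z.1, rho * z.1 + Num.sqrt (1 - rho ^+ 2) * z.2)).

Definition rho_tilde t s rho : R :=
  fine (bivariate_normal rho
    [set z | (Phibar_inv t <= z.1%:E)%E /\ (Phibar_inv s <= z.2%:E)%E]) - t * s.

End normal_laws.

Section random_vectors.
Context {d} {T : measurableType d} {R : realType} (P : probability T R).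

Definition mutually_independent {d'} {T' : measurableType d'} n
    (X : 'I_n -> {RV P >-> T'}) : Prop :=
  forall (J : {set 'I_n}) (A : 'I_n -> set T'), (forall i, measurable (A i)) ->
    P (\bigcap_(i in [set` J]) (X i @^-1` A i)) =
    (\prod_(i in J) P (X i @^-1` A i))%E.

Definition independent_vectors {d1 d2} {T1 : measurableType d1}
    {T2 : measurableType d2} n m
    (X : 'I_n -> {RV P >-> T1}) (Y : 'I_m -> {RV P >-> T2}) : Prop :=
  forall A B, g_sigma_preimage (fun i => X i : T -> T1) A ->
    g_sigma_preimage (fun i => Y i : T -> T2) B ->
    P (A `&` B) = (P A * P B)%E.

Definition correlation_matrix n (G : 'M[R]_n) : Prop :=
  [/\ G^T = G, forall i, G i i = 1 &
      forall a : 'rV[R]_n, 0 <= (a *m G *m a^T) 0 0].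

(* X ~ N(0, G): every linear combination of the coordinates is normal, with the
   variance prescribed by G. This allows singular G. *)
Definition gaussian_vector n (G : 'M[R]_n) (X : 'I_n -> {RV P >-> R}) : Prop :=
  forall (a : 'rV[R]_n) (A : set R), measurable A ->
    P [set w | A (\sum_i a 0 i * X i w)] =
    centered_normal ((a *m G *m a^T) 0 0) A.

Definition two_group_model n (pi1 : R) (G : 'M[R]_n)
    (H : 'I_n -> {RV P >-> bool}) (eps : 'I_n -> {RV P >-> R}) : Prop :=
  [/\ forall i, distribution P (H i) = bernoulli_prob pi1,
      mutually_independent H,
      correlation_matrix G,
      gaussian_vector G eps &
      independent_vectors H eps].

End random_vectors.

Definition block_correlation {R : realType} (m sB : nat) (rho : R) : 'M[R]_m :=
  \matrix_(i, j) if i == j then 1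
                 else if (i %/ sB == j %/ sB)%N then rho else 0.

Definition pvalue {R : realType} (mu : R) (h : bool) (e : R) : R :=
  Phibar (mu * h%:R + e).

Section benjamini_hochberg.
Context {R : realType} (q : R) {m : nat} (p : 'I_m -> R) (h : 'I_m -> bool).

(* The j-th smallest p-value for 1 <= j <= m, and 0 for j = 0. *)
Definition sorted_pvalue (j : nat) : R :=
  nth 0 (0 :: sort <=%R [seq p i | i <- enum 'I_m]) j.

Definition BH_rejections : nat :=
  (\max_(j < m.+1 | (sorted_pvalue j <= j%:R * q / m%:R)%R) j)%N.

Definition BH_threshold : R := sorted_pvalue BH_rejections.

Definition false_rejections : nat :=
  #|[set i | (p i <= BH_threshold) && ~~ h i]|.

Definition FDP : R := false_rejections%:R / (maxn BH_rejections 1)%:R.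

End benjamini_hochberg.

Definition BH_crossing {R : realType} (q mu pi1 : R) (t : R) : Prop :=
  0 < t < 1 /\
  t / q = (1 - pi1) * t + pi1 * Phibar (fine (Phibar_inv t) - mu).

(* The variables may live on different probability spaces; F is the filter
   along which the index goes to its limit. *)
Definition cvg_in_distribution {R : realType} (F : set_system nat)
    (d : nat -> measure_display) (T : forall m, measurableType (d m))
    (P : forall m, probability (T m) R) (X : forall m, T m -> R)
    (nu : set R -> \bar R) : Prop :=
  (forall m, measurable_fun [set: T m] (X m)) /\
  forall x : R, {for x, continuous (fun y : R => nu `]-oo, y]%classic)} ->
    (fun m => P m [set w | X m w <= x]) @ F --> nu `]-oo, x]%classic.

(* Main.v *)
Require Import Defs.
From HB Require Import structures.
From mathcomp Require Import all_boot all_order all_algebra.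
From mathcomp Require Import all_classical all_reals all_analysis.
From mathcomp Require Import measurable_realfun ring lra.
Set Implicit Arguments.
Unset Strict Implicit.
Unset Printing Implicit Defensive.
Import Order.TTheory GRing.Theory Num.Theory.
Import numFieldNormedType.Exports.
Local Open Scope classical_set_scope.
Local Open Scope ring_scope.

(* Let N(t) count the p-values below t and V(t) those of true nulls. The
   rejection set is {P_i <= T} with T = R q / m, so that N(T) = m T / q and
   sqrt m (FDP - pi0 q) = (q / T) W(T), where W(t) = (V(t) - m pi0 t) / sqrt m.
   The likelihood ratio of the two groups is monotone in the observation, so the
   rejection probability crosses t / q transversally at tau. Since blocks are independent,
   centered sums have variance O(m); a union bound over a grid then puts T within
   delta ~ m^(-1/3) of tau, and a finer grid together with the monotonicity of V
   shows that W(T) - W(tau) tends to 0 in probability. Finally W(tau) is a normalized sum of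
   independent bounded block sums, and its characteristic function
   E cos(a W(tau) + b) converges to the normal one. Independence of the blocks
   and the bivariate normal law of a pair within a block are only given
   through linear combinations; a Cramer-Wold argument with trigonometric
   polynomials recovers the probabilities of orthants from these. *)

(** * Expectations of bounded random variables *)

(** Chebyshev's inequality is the only concentration bound in use, and it fixes the scales. A grid
    point at distance at least delta from tau fails with probability O(1 / (m delta^2)), and O(1 /
    delta) such points are needed above tau, so m delta^3 has to be of constant order. Below tau one
    point suffices, because the procedure takes the last crossing: a single t with N(t) >= m t / q
    already forces T >= t. The fine grid is affordable because an increment of W over [s, t] has
    variance O(t - s). All randomness is confined to one bad event of small probability; off it the
    comparison of FDP with W(tau) is deterministic. Real cosines with an arbitrary phase b stand for
    complex exponentials: b = 0 and b = - pi / 2 give the real and imaginary parts, and the cosine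
    of a sum still expands into products of such cosines. Since the probability space changes with
    m, every estimate holds from a rank M that depends on the parameters alone, uniformly over all
    models. Tightness enters the continuity theorem as a hypothesis, supplied by Chebyshev's
    inequality again. *)

Section bounded_expectation.
Context {d} {T : measurableType d} {R : realType} (P : probability T R).
Implicit Types u v : T -> R.

(** On a probability space boundedness gives integrability and, unlike integrability, passes to
    products; every argument of [Ex] below is built from indicators and cosines. *)
Definition bounded_measurable u :=
  measurable_fun [set: T] u /\ exists M : R, forall w, `|u w| <= M.

Definition Ex u : R := \int[P]_w u w.

Lemma bm_integrable u : bounded_measurable u -> P.-integrable setT (EFin \o u).
Proof.
move=> [mu [M uM]]; apply: measurable_bounded_integrable => //.
  by rewrite [ltLHS]probability_setT ltry.
exists M; split; first exact: num_real.
by move=> N MN x _ /=; rewrite (le_trans (uM x))// ltW.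
Qed.

Lemma bm_cst (c : R) : bounded_measurable (fun=> c).
Proof. by split; [exact: measurable_cst|exists `|c|]. Qed.

Lemma bmD u v : bounded_measurable u -> bounded_measurable v ->
  bounded_measurable (fun w => u w + v w).
Proof.
move=> [mu [M uM]] [mv [N vN]]; split; first exact: measurable_funD.
by exists (M + N) => w; rewrite (le_trans (ler_normD _ _))// lerD.
Qed.

Lemma bmM u v : bounded_measurable u -> bounded_measurable v ->
  bounded_measurable (fun w => u w * v w).
Proof.
move=> [mu [M uM]] [mv [N vN]]; split; first exact: measurable_funM.
by exists (M * N) => w; rewrite normrM ler_pM.
Qed.

Lemma bmZ (c : R) u : bounded_measurable u -> bounded_measurable (fun w => c * u w).
Proof. by move=> bu; apply: bmM => //; exact: bm_cst. Qed.

Lemma bmN u : bounded_measurable u -> bounded_measurable (fun w => - u w).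
Proof.
by move=> bu; under eq_fun do rewrite -mulN1r; exact: bmZ.
Qed.

Lemma bmB u v : bounded_measurable u -> bounded_measurable v ->
  bounded_measurable (fun w => u w - v w).
Proof. by move=> bu bv; apply: bmD => //; exact: bmN. Qed.

Lemma bmX (n : nat) u : bounded_measurable u -> bounded_measurable (fun w => u w ^+ n).
Proof.
move=> bu; elim: n => [|n IH].
  by under eq_fun do rewrite expr0; exact: bm_cst.
by under eq_fun do rewrite exprS; exact: bmM.
Qed.

Lemma bm_sum (I : Type) (r : seq I) (Q : pred I) (u : I -> T -> R) :
  (forall i, bounded_measurable (u i)) ->
  bounded_measurable (fun w => \sum_(i <- r | Q i) u i w).
Proof.
move=> bu; elim: r => [|i r IH].
  by under eq_fun do rewrite big_nil; exact: bm_cst.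
under eq_fun do rewrite big_cons.
by case: (Q i) => //; exact: bmD.
Qed.

Lemma bm_prod (I : Type) (r : seq I) (Q : pred I) (u : I -> T -> R) :
  (forall i, bounded_measurable (u i)) ->
  bounded_measurable (fun w => \prod_(i <- r | Q i) u i w).
Proof.
move=> bu; elim: r => [|i r IH].
  by under eq_fun do rewrite big_nil; exact: bm_cst.
under eq_fun do rewrite big_cons.
by case: (Q i) => //; exact: bmM.
Qed.

Lemma bm_indic (A : set T) : measurable A -> bounded_measurable (\1_A : T -> R).
Proof.
move=> mA; split; first exact: measurable_indic.
by exists 1 => w; rewrite indicE; case: (_ \in _); rewrite ?normr1 ?normr0.
Qed.

Lemma bm_cos u : measurable_fun setT u -> bounded_measurable (fun w => cos (u w)).
Proof.
move=> mu; split.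
  by apply: measurableT_comp => //; apply: continuous_measurable_fun; exact: continuous_cos.
by exists 1 => w; rewrite ler_norml cos_geN1 cos_le1.
Qed.

Lemma Ex_cst (c : R) : Ex (fun=> c) = c.
Proof. by rewrite /Ex Rintegral_cst// [X in fine X]probability_setT mulr1. Qed.

Lemma ExD u v : bounded_measurable u -> bounded_measurable v ->
  Ex (fun w => u w + v w) = Ex u + Ex v.
Proof. by move=> bu bv; rewrite /Ex RintegralD//; exact: bm_integrable. Qed.

Lemma ExZ (c : R) u : bounded_measurable u -> Ex (fun w => c * u w) = c * Ex u.
Proof. by move=> bu; rewrite /Ex RintegralZl//; exact: bm_integrable. Qed.

Lemma ExN u : bounded_measurable u -> Ex (fun w => - u w) = - Ex u.
Proof.
move=> bu; rewrite -mulN1r -ExZ//.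
by congr Ex; apply/funext => w; rewrite mulN1r.
Qed.

Lemma ExB u v : bounded_measurable u -> bounded_measurable v ->
  Ex (fun w => u w - v w) = Ex u - Ex v.
Proof. by move=> bu bv; rewrite ExD ?ExN//; exact: bmN. Qed.

Lemma Ex_sum (I : Type) (r : seq I) (Q : pred I) (u : I -> T -> R) :
  (forall i, bounded_measurable (u i)) ->
  Ex (fun w => \sum_(i <- r | Q i) u i w) = \sum_(i <- r | Q i) Ex (u i).
Proof.
move=> bu; elim: r => [|i r IH].
  by under [in LHS]eq_fun do rewrite big_nil; rewrite Ex_cst big_nil.
under [in LHS]eq_fun do rewrite big_cons.
rewrite big_cons; case: (Q i) => //.
by rewrite ExD ?IH//; exact: bm_sum.
Qed.

Lemma le_Ex u v : bounded_measurable u -> bounded_measurable v ->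
  (forall w, u w <= v w) -> Ex u <= Ex v.
Proof. by move=> bu bv uv; rewrite /Ex le_Rintegral//; exact: bm_integrable. Qed.

Lemma Ex_ge0 u : (forall w, 0 <= u w) -> 0 <= Ex u.
Proof. by move=> u0; exact: Rintegral_ge0. Qed.

Lemma bm_norm u : bounded_measurable u -> bounded_measurable (fun w => `|u w|).
Proof.
move=> [mu [M uM]]; split; first exact: measurableT_comp.
by exists M => w; rewrite normr_id.
Qed.

Lemma normr_Ex u : bounded_measurable u -> `|Ex u| <= Ex (fun w => `|u w|).
Proof. by move=> bu; rewrite /Ex le_normr_Rintegral//; exact: bm_integrable. Qed.

Lemma normr_Ex_le u (M : R) : bounded_measurable u -> (forall w, `|u w| <= M) -> `|Ex u| <= M.
Proof.
move=> bu uM; rewrite (le_trans (normr_Ex bu))// -[leRHS]Ex_cst le_Ex//.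
- exact: bm_norm.
- exact: bm_cst.
Qed.

Definition Pr (A : set T) : R := fine (P A).

Lemma PrE (A : set T) : measurable A -> (Pr A)%:E = P A.
Proof. by move=> mA; rewrite /Pr fineK// fin_num_measure. Qed.

Lemma Ex_indic (A : set T) : measurable A -> Ex (\1_A) = Pr A.
Proof. by move=> mA; rewrite /Ex /Pr /Rintegral integral_indic// setIT. Qed.

Lemma Pr_ge0 (A : set T) : 0 <= Pr A.
Proof. exact: fine_ge0. Qed.

Lemma Pr_le1 (A : set T) : measurable A -> Pr A <= 1.
Proof. by move=> mA; rewrite -lee_fin PrE// probability_le1. Qed.

Lemma le_Pr (A B : set T) : measurable A -> measurable B -> A `<=` B -> Pr A <= Pr B.
Proof. by move=> mA mB AB; rewrite -lee_fin !PrE// le_measure ?inE. Qed.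

Lemma Pr_setC (A : set T) : measurable A -> Pr (~` A) = 1 - Pr A.
Proof.
move=> mA; apply/EFin_inj; rewrite PrE; last exact: measurableC.
by rewrite probability_setC// EFinB PrE.
Qed.

Lemma PrU (A B : set T) : measurable A -> measurable B -> Pr (A `|` B) <= Pr A + Pr B.
Proof.
move=> mA mB; rewrite -lee_fin EFinD !PrE//; last exact: measurableU.
exact: measureU2.
Qed.

Lemma Pr_bigcup (I : Type) (r : seq I) (A : I -> set T) :
  (forall i, measurable (A i)) ->
  Pr (\big[setU/set0]_(i <- r) A i) <= \sum_(i <- r) Pr (A i).
Proof.
move=> mA; elim: r => [|i r IH]; first by rewrite !big_nil /Pr measure0.
rewrite !big_cons (le_trans (PrU _ _))//; first exact: bigsetU_measurable.
by rewrite lerD2l.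
Qed.

Lemma measurable_ge u (c : R) : measurable_fun setT u -> measurable [set w | c <= u w].
Proof.
move=> mu; rewrite [X in measurable X](_ : _ = u @^-1` `[c, +oo[%classic).
  by rewrite -[X in measurable X]setTI; exact: mu.
by apply/seteqP; split => w /=; rewrite in_itv/= andbT.
Qed.

Lemma measurable_le u (c : R) : measurable_fun setT u -> measurable [set w | u w <= c].
Proof.
move=> mu; rewrite [X in measurable X](_ : _ = u @^-1` `]-oo, c]%classic).
  by rewrite -[X in measurable X]setTI; exact: mu.
by apply/seteqP; split => w /=; rewrite in_itv/=.
Qed.

(** Chebyshev's inequality: e^2 times the indicator of the event is at most u^2. *)
Lemma Pr_sqr u (e : R) : bounded_measurable u -> 0 < e ->
  Pr [set w | e <= `|u w|] <= Ex (fun w => u w ^+ 2) / e ^+ 2.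
Proof.
move=> bu e0.
have mA : measurable [set w | e <= `|u w|].
  by apply: (@measurable_ge (fun w => `|u w|)); have [] := bm_norm bu.
rewrite ler_pdivlMr ?exprn_gt0// mulrC -Ex_indic// -ExZ; last exact: bm_indic.
apply: le_Ex; [exact/bmZ/bm_indic|exact: bmX|move=> w].
rewrite indicE; have [/set_mem/= h|_] := boolP (w \in _).
  by rewrite mulr1 -[leRHS]real_normK ?num_real// ler_sqr ?nnegrE// ltW.
by rewrite mulr0 sqr_ge0.
Qed.

(** Bounded convergence, with the constant [M] as dominating function. *)
Lemma Ex_cvg (u_ : (T -> R)^nat) u (M : R) :
  (forall n, measurable_fun setT (u_ n)) -> (forall n w, `|u_ n w| <= M) ->
  (forall w, u_ n w @[n --> \oo] --> u w) ->
  Ex (u_ n) @[n --> \oo] --> Ex u.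
Proof.
move=> mu bu cu.
have mlim : measurable_fun setT u.
  by apply: (measurable_fun_cvg mu) => w _; exact: cu.
have uM w : `|u w| <= M.
  have : `|u_ n w| @[n --> \oo] --> `|u w| by exact: cvg_norm.
  move=> h; rewrite -(cvg_lim _ h)//; apply: limr_le; first by apply/cvg_ex; eexists; exact: h.
  by apply: nearW => n.
have intP v : measurable_fun setT v -> (forall w, `|v w| <= M) -> P.-integrable setT (EFin \o v).
  by move=> mv vM; apply: bm_integrable; split => //; exists M.
apply: fine_cvg; rewrite fineK; last first.
  by apply: integrable_fin_num => //; exact: intP.
have [] // := @dominated_convergence _ _ _ P _ measurableT
   (fun n w => (u_ n w)%:E) (fun w => (u w)%:E) (fun=> M%:E).
- by move=> n; apply/measurable_EFinP.
- exact/measurable_EFinP.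
- apply: aeW => w _; apply: cvg_EFin; first exact: nearW.
  exact: cu.
- exact: (bm_integrable (bm_cst M)).
- by apply: aeW => w n _; rewrite lee_fin.
Qed.

End bounded_expectation.

(** * Characteristic functions of centered normal laws *)

Section gaussian_characteristic_function.
Context {R : realType}.
Notation mu := (@lebesgue_measure R).
Implicit Types a b s x : R.

(** The Radon-Nikodym derivative of the normal law agrees with [normal_pdf] almost everywhere, since
    both have the same integral over every measurable set. *)
Lemma Ex_normal s (f : R -> R) : s != 0 -> bounded_measurable (f : measurableTypeR R -> R) ->
  Ex (normal_prob 0 s) f = \int[mu]_x (f x * normal_pdf 0 s x).
Proof.
move=> s0 bf; rewrite /Ex /Rintegral; congr fine.
have intf := bm_integrable (normal_prob 0 s) bf.
rewrite -(Radon_Nikodym_change_of_variables (normal_prob_dominates 0 s))//=.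
apply: ae_eq_integral => //.
- apply: emeasurable_funM => //; first by have [mf _] := bf; exact/measurable_EFinP.
  apply: (measurable_int mu).
  by apply: Radon_Nikodym_integrable; exact: normal_prob_dominates.
- apply/measurable_EFinP; apply: measurable_funM; first by have [] := bf.
  exact: measurable_normal_pdf.
- under [X in ae_eq _ _ _ X]eq_fun do rewrite EFinM.
  apply: ae_eqe_mul2l => /=.
  rewrite Radon_NikodymE//=; first exact: normal_prob_dominates.
  move=> dom; case: cid => /= h [h1 h2 h3].
  apply: integral_ae_eq => //=.
  + by apply/measurable_EFinP; exact: measurable_normal_pdf.
  + by move=> E E01 mE; rewrite -h3.
Qed.

Lemma normal_fun0E s x : normal_fun 0 s x = expR (- (2 * s ^+ 2)^-1 * x ^+ 2).
Proof.
by rewrite /normal_fun subr0; congr expR; rewrite -mulr_natl mulrC mulNr mulrN.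
Qed.

Lemma is_derive_normal_pdf s x : s != 0 ->
  is_derive x 1 (normal_pdf 0 s) (- (x / s ^+ 2) * normal_pdf 0 s x).
Proof.
move=> s0; rewrite normal_pdfE//.
have -> : (fun y => normal_peak s * normal_fun 0 s y) =
   (fun y => normal_peak s * expR ((- (2 * s ^+ 2)^-1) * y ^+ 2)).
  by apply/funext => y; rewrite normal_fun0E.
have h1 : is_derive x 1 (fun y : R => y ^+ 2) (2 * x).
  have := @is_deriveM R R id id x 1 1 1 (is_derive_id _ _) (is_derive_id _ _).
  have -> : (id * id : R -> R) = (fun y => y ^+ 2) by apply/funext => y; rewrite expr2.
  move=> h; apply: (is_derive_eq h).
  by rewrite /GRing.scale/= mulr1 mulrDl mul1r.
have h2 : is_derive x 1 (fun y => - (2 * s ^+ 2)^-1 * y ^+ 2) (- (2 * s ^+ 2)^-1 * (2 * x)).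
  exact: (@is_deriveZ _ _ _ _ (- (2 * s ^+ 2)^-1) x 1 _ h1).
have h3 := @is_derive1_comp R expR _ x _ _ (is_derive_expR _) h2.
have h4 := @is_deriveZ _ _ _ _ (normal_peak s) x 1 _ h3.
apply: (is_derive_eq h4); rewrite /GRing.scale/=.
by rewrite normal_fun0E; field.
Qed.

Lemma is_derive_affine a b x : is_derive x 1 (fun y : R => a * y + b) a.
Proof.
have h1 := @is_deriveZ _ _ _ id a x 1 _ (is_derive_id _ _).
have h2 := @is_deriveD _ _ _ _ _ x 1 _ _ h1 (is_derive_cst b x 1).
by apply: (is_derive_eq h2); rewrite addr0 /GRing.scale/= mulr1.
Qed.

Lemma is_derive_sin_affine a b x :
  is_derive x 1 (fun y : R => sin (a * y + b)) (a * cos (a * x + b)).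
Proof.
have h := @is_derive1_comp R sin _ x _ _ (is_derive_sin _) (is_derive_affine a b x).
by apply: (is_derive_eq h); rewrite mulrC.
Qed.

Lemma is_derive_cos_affine a b x :
  is_derive x 1 (fun y : R => cos (a * y + b)) (- (a * sin (a * x + b))).
Proof.
have h := @is_derive1_comp R cos _ x _ _ (is_derive_cos _) (is_derive_affine a b x).
by apply: (is_derive_eq h); rewrite mulrC mulrN.
Qed.

(** The derivative in x of sin (a x + b) times the normal density. That its integral vanishes is
    Gaussian integration by parts. *)
Definition gauss_ibp a b s x := (a * cos (a * x + b) - x / s ^+ 2 * sin (a * x + b)) * normal_pdf 0 s x.

Let is_derive_sin_pdf a b s x : s != 0 ->
  is_derive x 1 (fun y => sin (a * y + b) * normal_pdf 0 s y) (gauss_ibp a b s x).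
Proof.
move=> s0.
have h := @is_deriveM _ _ _ _ x 1 _ _ (is_derive_sin_affine a b x) (is_derive_normal_pdf x s0).
apply: (is_derive_eq h); rewrite /GRing.scale/= /gauss_ibp; ring.
Qed.

Lemma continuous_affine a b : continuous (fun x : R => a * x + b).
Proof.
move=> x; apply: differentiable_continuous; apply/derivable1_diffP.
by case: (is_derive_affine a b x).
Qed.

Lemma continuous_cos_affine a b : continuous (fun x : R => cos (a * x + b)).
Proof.
move=> x; apply: differentiable_continuous; apply/derivable1_diffP.
by case: (is_derive_cos_affine a b x).
Qed.

Lemma continuous_sin_affine a b : continuous (fun x : R => sin (a * x + b)).
Proof.
move=> x; apply: differentiable_continuous; apply/derivable1_diffP.
by case: (is_derive_sin_affine a b x).
Qed.

Let continuous_gauss_ibp a b s : s != 0 -> continuous (gauss_ibp a b s).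
Proof.
move=> s0 x; apply: (@continuousM R R (fun x => a * cos (a * x + b) - x / s ^+ 2 * sin (a * x + b)) (normal_pdf 0 s)); last exact: continuous_normal_pdf.
apply: (@continuousB R R R).
  apply: (@continuousM R R (fun=> a)); first exact: cvg_cst.
  exact: continuous_cos_affine.
apply: (@continuousM R R (fun x => x / s ^+ 2)); last exact: continuous_sin_affine.
apply: (@continuousM R R id (fun=> (s ^+ 2)^-1)); first exact: cvg_id.
exact: cvg_cst.
Qed.

(** Doubling the variance absorbs the factor |x|: with y = |x / s|, one has y <= 1 + y^2 / 4 <= exp
    (y^2 / 4). This provides the dominating function for the integrands of first order in x. *)
Lemma normal_pdf_moment s : s != 0 ->
  exists K : R, forall x, `|x| * normal_pdf 0 s x <= K * normal_pdf 0 (Num.sqrt 2 * s) x.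
Proof.
move=> s0; have s20 : Num.sqrt 2 * s != 0 by rewrite mulf_neq0// sqrtr_eq0 -ltNge.
exists (`|s| * normal_peak s / normal_peak (Num.sqrt 2 * s)) => x.
rewrite !normal_pdfE// !normal_fun0E.
set p := normal_peak _; set p' := normal_peak _.
have p'0 : p' != 0 by rewrite gt_eqF ?normal_peak_gt0.
set E1 := expR _; set E2 := expR _.
have -> : `|s| * p / p' * (p' * E2) = p * (`|s| * E2) by field.
rewrite mulrCA ler_wpM2l ?normal_peak_ge0// /E1 /E2 exprMn sqr_sqrtr//.
have -> : - (2 * s ^+ 2)^-1 * x ^+ 2 = - ((x / s) ^+ 2 / 4) + (- (2 * (2 * s ^+ 2))^-1 * x ^+ 2).
  by field.
rewrite expRD; set e := expR (- (2 * _)^-1 * _); rewrite mulrA ler_wpM2r ?expR_ge0// expRN ler_pdivrMr ?expR_gt0//.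
have sx : `|x| = `|s| * `|x / s| by rewrite normf_div mulrCA mulfV ?mulr1// normr_eq0.
rewrite sx ler_wpM2l//.
apply: le_trans (expR_ge1Dx _).
have -> : (x / s) ^+ 2 = `|x / s| ^+ 2 by rewrite real_normK ?num_real.
move: `|x / s| => y; have : 0 <= (1 - y / 2) ^+ 2 by rewrite sqr_ge0.
by nra.
Qed.

Lemma integrable_normal_moment s : s != 0 ->
  mu.-integrable setT (EFin \o (fun x => `|x| * normal_pdf 0 s x)).
Proof.
move=> s0; have [K hK] := normal_pdf_moment s0.
apply: (@le_integrable _ _ _ mu setT measurableT _ (EFin \o (fun x => K * normal_pdf 0 (Num.sqrt 2 * s) x))).
- apply/measurable_EFinP; apply: measurable_funM; last exact: measurable_normal_pdf.
  exact: normr_measurable.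
- move=> x _ /=; rewrite lee_fin (le_trans _ (ler_norm _))// ger0_norm ?hK//.
  by rewrite mulr_ge0// normal_pdf_ge0.
- under [X in _.-integrable _ X]eq_fun do rewrite /= EFinM.
  by apply: integrableZl => //; exact: integrable_normal_pdf.
Qed.

Let integrable_gauss_ibp a b s : s != 0 -> mu.-integrable setT (EFin \o gauss_ibp a b s).
Proof.
move=> s0; apply: (@le_integrable _ _ _ mu setT measurableT _
   (EFin \o (fun x => `|a| * normal_pdf 0 s x + (s ^+ 2)^-1 * (`|x| * normal_pdf 0 s x)))).
- by apply/measurable_EFinP; apply: continuous_measurable_fun; exact: continuous_gauss_ibp.
- move=> x _ /=; rewrite lee_fin (le_trans _ (ler_norm _))//.
  rewrite /gauss_ibp normrM (ger0_norm (normal_pdf_ge0 _ _ _)) mulrA -mulrDl.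
  rewrite ler_wpM2r ?normal_pdf_ge0// (le_trans (ler_normB _ _))// lerD//.
    by rewrite normrM ler_piMr// ler_norml cos_geN1 cos_le1.
  rewrite normrM mulrC [leRHS]mulrC normrM.
  rewrite (@ger0_norm _ (s ^+ 2)^-1) ?invr_ge0 ?sqr_ge0//.
  by rewrite ler_piMl// ?mulr_ge0 ?invr_ge0 ?sqr_ge0// ler_norml sin_geN1 sin_le1.
- under [X in _.-integrable _ X]eq_fun do rewrite /= EFinD !EFinM.
  apply: integrableD => //; apply: integrableZl => //.
    exact: integrable_normal_pdf.
  by have := integrable_normal_moment s0; apply: eq_integrable.
Qed.

Let integral_gauss_ibp_itv a b s (n : nat) : s != 0 ->
  \int[mu]_(x in `[- n.+1%:R, n.+1%:R]) gauss_ibp a b s x =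
  sin (a * n.+1%:R + b) * normal_pdf 0 s n.+1%:R - sin (a * - n.+1%:R + b) * normal_pdf 0 s (- n.+1%:R).
Proof.
move=> s0; rewrite /Rintegral (@continuous_FTC2 R (gauss_ibp a b s) (fun y => sin (a * y + b) * normal_pdf 0 s y))//.
- by rewrite (@lt_trans _ _ 0)// ?oppr_lt0.
- by apply: continuous_subspaceT; exact: continuous_gauss_ibp.
- have c : continuous (fun y => sin (a * y + b) * normal_pdf 0 s y).
    move=> y; apply: differentiable_continuous; apply/derivable1_diffP.
    by case: (is_derive_sin_pdf a b y s0).
  split.
  + by move=> x _; case: (is_derive_sin_pdf a b x s0).
  + by apply: cvg_at_right_filter; exact: c.
  + by apply: cvg_at_left_filter; exact: c.
- move=> x _; rewrite derive1E; by have [_ ->] := is_derive_sin_pdf a b x s0.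
Qed.

Lemma normal_pdf_cvg0 s : s != 0 -> normal_pdf 0 s n.+1%:R @[n --> \oo] --> (0 : R).
Proof.
move=> s0.
have -> : (fun n => normal_pdf 0 s n.+1%:R) = (fun n => normal_peak s * expR (- ((2 * s ^+ 2)^-1 * n.+1%:R ^+ 2))).
  by apply/funext => n; rewrite normal_pdfE// normal_fun0E mulNr.
rewrite -[X in _ --> X](mulr0 (normal_peak s)); apply: cvgMr.
have ps : 0 < (2 * s ^+ 2)^-1 by rewrite invr_gt0 mulr_gt0// exprn_even_gt0.
apply: (@squeeze_cvgr _ _ _ _ (fun=> 0) (fun n : nat => (2 * s ^+ 2) / n.+1%:R)).
- apply: nearW => n; rewrite expR_ge0/= expRN.
  set c := (2 * s ^+ 2)^-1; have -> : 2 * s ^+ 2 / n.+1%:R = (c * n.+1%:R)^-1.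
    by rewrite /c invfM invrK.
  rewrite lef_pV2 ?posrE ?expR_gt0// ?mulr_gt0//.
  apply: le_trans (expR_ge1Dx _); rewrite (@le_trans _ _ (c * n.+1%:R ^+ 2)) ?lerDr//.
  by rewrite ler_pM2l// ler_eXnr// ler1n.
- exact: cvg_cst.
- rewrite -[X in _ --> X](mulr0 (2 * s ^+ 2)); apply: cvgMr; exact: cvg_harmonic.
Qed.

(** Over growing symmetric intervals the integral is a boundary term that tends to 0; dominated
    convergence identifies the limit with the integral over the line. *)
Lemma gaussian_ibp a b s : s != 0 -> \int[mu]_x gauss_ibp a b s x = 0.
Proof.
move=> s0.
have h1 : \int[mu]_(x in `[- n.+1%:R, n.+1%:R]) gauss_ibp a b s x @[n --> \oo] --> \int[mu]_x gauss_ibp a b s x.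
  under eq_fun do rewrite Rintegral_mkcond.
  apply: fine_cvg; rewrite fineK; last by apply: integrable_fin_num => //; exact: integrable_gauss_ibp.
  have [] // := @dominated_convergence _ _ _ mu _ measurableT
    (fun n : nat => EFin \o (gauss_ibp a b s \_ `[- n.+1%:R, n.+1%:R]))
    (EFin \o gauss_ibp a b s) (abse \o (EFin \o gauss_ibp a b s)).
  + move=> n; apply/measurable_EFinP; apply/measurable_restrict => //.
    by rewrite setTI; apply: measurable_funTS; apply: continuous_measurable_fun; exact: continuous_gauss_ibp.
  + by apply/measurable_EFinP; apply: continuous_measurable_fun; exact: continuous_gauss_ibp.
  + apply: aeW => x _ /=; apply: cvg_EFin; first exact: nearW.
    apply: cvg_near_cst; near=> n; rewrite /= patchE mem_set//= in_itv/= -ler_norml.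
    rewrite ltW// (@lt_le_trans _ _ n%:R) ?ler_nat//.
    by near: n; exact: nbhs_infty_gtr.
  + by apply: integrable_abse; exact: integrable_gauss_ibp.
  + apply: aeW => x n _ /=; rewrite lee_fin patchE; case: ifP => // _.
    by rewrite normr0.
have h2 : \int[mu]_(x in `[- n.+1%:R, n.+1%:R]) gauss_ibp a b s x @[n --> \oo] --> (0 : R).
  under eq_fun do rewrite integral_gauss_ibp_itv//.
  apply/norm_cvg0P.
  apply: (@squeeze_cvgr _ _ _ _ (fun=> 0) (fun n : nat => 2 * normal_pdf 0 s n.+1%:R)).
  + apply: nearW => n; rewrite normr_ge0/= (le_trans (ler_normB _ _))// mulrDl mul1r.
    have -> : normal_pdf 0 s (- n.+1%:R) = normal_pdf 0 s n.+1%:R.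
      by rewrite !normal_pdfE// !normal_fun0E sqrrN.
    by rewrite lerD// normrM (ger0_norm (normal_pdf_ge0 _ _ _)) ler_piMl// ?normal_pdf_ge0// ler_norml sin_geN1 sin_le1.
  + exact: cvg_cst.
  + by rewrite -[X in _ --> X](mulr0 2); apply: cvgMr; exact: normal_pdf_cvg0.
exact: (cvg_unique _ h1 h2).
Unshelve. all: by end_near. Qed.

Let phi_int a b s := \int[mu]_x (cos (a * x + b) * normal_pdf 0 s x).

Let integrable_cos a b s : s != 0 ->
  mu.-integrable setT (EFin \o (fun x => cos (a * x + b) * normal_pdf 0 s x)).
Proof.
move=> s0; apply: (@le_integrable _ _ _ mu setT measurableT _ (EFin \o normal_pdf 0 s)).
- apply/measurable_EFinP; apply: measurable_funM; last exact: measurable_normal_pdf.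
  by apply: continuous_measurable_fun; exact: continuous_cos_affine.
- move=> x _ /=; rewrite lee_fin normrM ler_piMl// ler_norml.
  by rewrite cos_geN1 cos_le1.
- exact: integrable_normal_pdf.
Qed.

Let integrable_xsin a b s : s != 0 ->
  mu.-integrable setT (EFin \o (fun x => x * sin (a * x + b) * normal_pdf 0 s x)).
Proof.
move=> s0; apply: (@le_integrable _ _ _ mu setT measurableT _ (EFin \o (fun x => `|x| * normal_pdf 0 s x))).
- apply/measurable_EFinP; apply: measurable_funM; last exact: measurable_normal_pdf.
  apply: measurable_funM; first exact: measurable_id.
  by apply: continuous_measurable_fun; exact: continuous_sin_affine.
- move=> x _ /=; rewrite lee_fin !normrM normr_id ler_wpM2r// ler_piMr// ler_norml.
  by rewrite sin_geN1 sin_le1.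
- exact: integrable_normal_moment.
Qed.

Let is_derive_cos_pdf a b s x :
  is_derive a 1 (fun a => cos (a * x + b) * normal_pdf 0 s x) (- (x * sin (a * x + b) * normal_pdf 0 s x)).
Proof.
have h := @is_deriveM _ _ _ _ a 1 _ _ (is_derive_cos_affine x b a) (is_derive_cst (normal_pdf 0 s x) a 1).
under eq_fun do rewrite (mulrC _ x).
by apply: (is_derive_eq h); rewrite /GRing.scale/=; rewrite (mulrC x a); ring.
Qed.

(** Differentiation under the integral produces - x sin (a x + b), which integration by parts turns
    into - s^2 a cos (a x + b): a linear differential equation in [a]. *)
Let is_derive_phi_int a b s : s != 0 ->
  is_derive a 1 (fun a => phi_int a b s) (- (s ^+ 2 * a) * phi_int a b s).
Proof.
move=> s0.
have Ia : `]a - 1, a + 1[%classic a by rewrite /= in_itv/= ltrDl ltr01 ltrBlDr ltrDl ltr01.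
have der y x : derivable (fun a => cos (a * x + b) * normal_pdf 0 s x) y 1.
  by case: (is_derive_cos_pdf y b s x).
have d1 y x : partial1of2 (fun a x => cos (a * x + b) * normal_pdf 0 s x) y x =
    - (x * sin (y * x + b) * normal_pdf 0 s x).
  by rewrite partial1of2E; have [_ ->] := is_derive_cos_pdf y b s x.
have bnd y x : `|partial1of2 (fun a x => cos (a * x + b) * normal_pdf 0 s x) y x| <= `|x| * normal_pdf 0 s x.
  rewrite d1 normrN !normrM (ger0_norm (normal_pdf_ge0 _ _ _)) ler_wpM2r ?normal_pdf_ge0//.
  by rewrite ler_piMr// ler_norml sin_geN1 sin_le1.
have pos x : 0 <= `|x| * normal_pdf 0 s x by rewrite mulr_ge0// normal_pdf_ge0.
have hd := @derivable_under_integral R _ _ mu (fun a x => cos (a * x + b) * normal_pdf 0 s x) setT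
  measurableT a (a - 1) (a + 1) Ia (fun y _ => integrable_cos y b s0) (fun y x _ _ => der y x)
  (fun x => `|x| * normal_pdf 0 s x) pos (integrable_normal_moment s0) (fun y x _ _ => bnd y x).
have hv := @differentiation_under_integral R _ _ mu (fun a x => cos (a * x + b) * normal_pdf 0 s x) setT
  measurableT a (a - 1) (a + 1) Ia (fun y _ => integrable_cos y b s0) (fun y x _ _ => der y x)
  (fun x => `|x| * normal_pdf 0 s x) pos (integrable_normal_moment s0) (fun y x _ _ => bnd y x).
apply: DeriveDef; first exact: hd.
rewrite -derive1E hv.
transitivity (- \int[mu]_x (x * sin (a * x + b) * normal_pdf 0 s x)).
  rewrite -mulN1r -RintegralZl//; last exact: integrable_xsin.
  by apply: eq_Rintegral => x _; rewrite d1 mulN1r.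
have := gaussian_ibp a b s0.
have -> : \int[mu]_x gauss_ibp a b s x = \int[mu]_x (a * (cos (a * x + b) * normal_pdf 0 s x)
     - (s ^+ 2)^-1 * (x * sin (a * x + b) * normal_pdf 0 s x)).
  by apply: eq_Rintegral => x _; rewrite /gauss_ibp; ring.
rewrite RintegralB//; last 2 first.
  have := @integrableZl _ _ _ mu setT measurableT a _ (integrable_cos a b s0).
  by apply: eq_integrable.
  have := @integrableZl _ _ _ mu setT measurableT (s ^+ 2)^-1 _ (integrable_xsin a b s0).
  by apply: eq_integrable.
rewrite RintegralZl ?RintegralZl//; last 2 first.
  exact: integrable_xsin.
  exact: integrable_cos.
rewrite -/(phi_int a b s); set y := (\int[mu]_x _) => /eqP; rewrite subr_eq0 => /eqP h.
have -> : y = s ^+ 2 * (a * phi_int a b s) by rewrite h mulrA mulfV ?mul1r// expf_neq0.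
by rewrite mulNr mulrA.
Qed.

Lemma normal_cos s a b : s != 0 ->
  Ex (normal_prob 0 s) (fun x => cos (a * x + b)) = expR (- (a ^+ 2 * s ^+ 2 / 2)) * cos b.
Proof.
move=> s0; rewrite Ex_normal//; last first.
  by apply: bm_cos; apply: continuous_measurable_fun; exact: continuous_affine.
rewrite -/(phi_int a b s).
(* The exponential is the integrating factor of this equation, so [h] is constant, with value cos b
   at 0. *)
pose h a := expR (s ^+ 2 / 2 * a ^+ 2) * phi_int a b s.
have hconst : h a = h 0.
  apply: is_derive_0_is_cst => {}a.
  have e1 : is_derive a 1 (fun y : R => y ^+ 2) (2 * a).
    have := @is_deriveM R R id id a 1 1 1 (is_derive_id _ _) (is_derive_id _ _).
    have -> : (id * id : R -> R) = (fun y => y ^+ 2) by apply/funext => y; rewrite expr2.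
    by move=> k; apply: (is_derive_eq k); rewrite /GRing.scale/= mulr1 mulrDl mul1r.
  have e2 := @is_derive1_comp R expR _ a _ _ (is_derive_expR _) (@is_deriveZ _ _ _ _ (s ^+ 2 / 2) a 1 _ e1).
  have e3 := @is_deriveM _ _ _ _ a 1 _ _ e2 (is_derive_phi_int a b s0).
  by apply: (is_derive_eq e3); rewrite /GRing.scale/=; field.
have h0 : h 0 = cos b.
  rewrite /h expr0n/= mulr0 expR0 mul1r /phi_int.
  under eq_Rintegral do rewrite mul0r add0r.
  rewrite RintegralZl//; last exact: integrable_normal_pdf.
  by rewrite /Rintegral integral_normal_pdf mulr1.
rewrite -h0 -hconst /h mulrA -expRD.
have -> : - (a ^+ 2 * s ^+ 2 / 2) + s ^+ 2 / 2 * a ^+ 2 = 0 by field.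
by rewrite expR0 mul1r.
Qed.

(** Covers the Dirac mass at v = 0 and the normal law at v > 0 by one cosine formula, so that
    degenerate variances need no separate argument later. *)
Lemma centered_normal_prob (v : R) : 0 <= v ->
  exists Q : probability (measurableTypeR R) R,
    (forall A, measurable A -> centered_normal v A = Q A) /\
    (forall a b, Ex Q (fun x => cos (a * x + b)) = expR (- (a ^+ 2 * v / 2)) * cos b).
Proof.
move=> v0; have [v00|vn0] := eqVneq v 0.
  exists (dirac (0 : measurableTypeR R) : probability (measurableTypeR R) R); split; first by move=> A mA; rewrite /centered_normal v00 eqxx.
  move=> a b; rewrite v00 mulr0 mul0r oppr0 expR0 mul1r.
  rewrite /Ex /Rintegral integral_dirac//; last first.
    apply/measurable_EFinP; apply: continuous_measurable_fun; exact: continuous_cos_affine.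
  by rewrite diracT mul1e/= mulr0 add0r.
exists (normal_prob 0 (Num.sqrt v)); split.
  by move=> A mA; rewrite /centered_normal (negbTE vn0).
move=> a b; rewrite normal_cos ?sqr_sqrtr//.
by rewrite gt_eqF// sqrtr_gt0 lt_neqAle eq_sym vn0.
Qed.

End gaussian_characteristic_function.

(** * Trigonometric polynomials and the Cramer-Wold device *)

Section trigonometric_polynomials.
Context {R : realType} {I : finType}.

(** The phases [b] supply the sines, so this span of cosines is closed under products. Two laws that
    agree on the generators therefore agree on a whole algebra of functions. *)
Inductive trig_poly : ((I -> R) -> R) -> Prop :=
| trig_cos (a : I -> R) (b : R) : trig_poly (fun x => cos (\sum_i a i * x i + b))
| trig_add f g : trig_poly f -> trig_poly g -> trig_poly (fun x => f x + g x)
| trig_scale (c : R) f : trig_poly f -> trig_poly (fun x => c * f x).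

Lemma trig_cst (c : R) : trig_poly (fun=> c).
Proof.
have := trig_scale c (trig_cos (fun=> 0) 0).
by under eq_fun do (rewrite big1 ?add0r ?cos0 ?mulr1; last by move=> i _; rewrite mul0r).
Qed.

Lemma trig_cos_mul (a a' : I -> R) (b b' : R) :
  trig_poly (fun x => cos (\sum_i a i * x i + b) * cos (\sum_i a' i * x i + b')).
Proof.
have := trig_scale 2^-1 (trig_add (trig_cos (fun i => a i + a' i) (b + b')) (trig_cos (fun i => a i - a' i) (b - b'))).
congr trig_poly; apply/funext => x.
have -> : \sum_i (a i + a' i) * x i + (b + b') = (\sum_i a i * x i + b) + (\sum_i a' i * x i + b').
  by under eq_bigr do rewrite mulrDl; rewrite big_split/=; ring.
have -> : \sum_i (a i - a' i) * x i + (b - b') = (\sum_i a i * x i + b) - (\sum_i a' i * x i + b').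
  by under eq_bigr do rewrite mulrBl; rewrite sumrB/=; ring.
by rewrite cosD cosB; field.
Qed.

Lemma trig_mul f g : trig_poly f -> trig_poly g -> trig_poly (fun x => f x * g x).
Proof.
move=> hf; elim: hf g => [a b|f1 f2 _ ih1 _ ih2|c f1 _ ih] g hg.
- elim: hg => [a' b'|g1 g2 _ ih1 _ ih2|c g1 _ ih]; first exact: trig_cos_mul.
  + by under eq_fun do rewrite mulrDr; exact: trig_add.
  + by under eq_fun do rewrite mulrCA; exact: trig_scale.
- by under eq_fun do rewrite mulrDl; apply: trig_add; [exact: ih1|exact: ih2].
- by under eq_fun do rewrite -mulrA; apply: trig_scale; exact: ih.
Qed.

Lemma trig_exp n f : trig_poly f -> trig_poly (fun x => f x ^+ n).
Proof.
move=> hf; elim: n => [|n ih].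
  by under eq_fun do rewrite expr0; exact: trig_cst.
by under eq_fun do rewrite exprS; exact: trig_mul.
Qed.

Lemma trig_one_sub f : trig_poly f -> trig_poly (fun x => 1 - f x).
Proof.
move=> hf; apply: trig_add; first exact: trig_cst.
by under eq_fun do rewrite -mulN1r; exact: trig_scale.
Qed.

Lemma trig_prod (r : seq I) (Q : pred I) (f : I -> (I -> R) -> R) :
  (forall i, trig_poly (f i)) -> trig_poly (fun x => \prod_(i <- r | Q i) f i x).
Proof.
move=> hf; elim: r => [|i r ih].
  by under eq_fun do rewrite big_nil; exact: trig_cst.
under eq_fun do rewrite big_cons.
by case: (Q i) => //; exact: trig_mul.
Qed.

End trigonometric_polynomials.

(** * Trigonometric approximation of step functions *)

Section step_approximation.
Context {R : realType}.
Implicit Types u x y c : R.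

Lemma bernoulli_ineq x n : 0 <= x <= 1 -> 1 - n%:R * x <= (1 - x) ^+ n.
Proof.
move=> /andP[x0 x1]; elim: n => [|n ih]; first by rewrite mul0r subr0 expr0.
rewrite exprS; apply: (@le_trans _ _ ((1 - x) * (1 - n%:R * x))).
  have : 0 <= n%:R * x ^+ 2 by rewrite mulr_ge0// sqr_ge0.
  by rewrite -natr1; nra.
by rewrite ler_wpM2l ?subr_ge0.
Qed.

(* The polynomials of the classical proof of the Stone-Weierstrass theorem:
   [0, 1]-valued on [0, 1] and converging to the indicator of u > 1/2. *)
Definition step_poly n u : R := 1 - (1 - u ^+ n) ^+ (2 ^ n).

Lemma step_poly01 n u : 0 <= u <= 1 -> 0 <= step_poly n u <= 1.
Proof.
move=> /andP[u0 u1]; have un : u ^+ n <= 1 by rewrite exprn_ile1.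
have un0 : 0 <= u ^+ n by rewrite exprn_ge0.
by rewrite /step_poly subr_ge0 exprn_ile1 ?subr_ge0//= ?lerBlDr ?lerDl// exprn_ge0 ?subr_ge0.
Qed.

(** Bernoulli's inequality applied to (1 - u^n)^(2^n). *)
Lemma step_poly_low n u : 0 <= u <= 1 -> step_poly n u <= (2 * u) ^+ n.
Proof.
move=> /andP[u0 u1]; rewrite /step_poly lerBlDr -lerBlDl.
have := @bernoulli_ineq (u ^+ n) (2 ^ n); rewrite exprn_ge0// exprn_ile1//= => /(_ isT).
by rewrite exprMn natrX.
Qed.

(** With x = u^n and N = 2^n, the product (1 - x)^N (1 + x)^N is at most 1, while (1 + x)^N >= N
    x. *)
Lemma step_poly_high n u : 0 < u <= 1 -> 1 - step_poly n u <= ((2 * u) ^+ n)^-1.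
Proof.
move=> /andP[u0 u1]; rewrite /step_poly opprB addrCA subrr addr0.
set x := u ^+ n; have x0 : 0 < x by rewrite exprn_gt0.
have x1 : x <= 1 by rewrite exprn_ile1// ltW.
have N0 : 0 < (2 ^ n)%N%:R * x :> R by rewrite mulr_gt0// ltr0n expn_gt0.
rewrite exprMn -natrX -/x -[leRHS]mul1r ler_pdivlMr//.
apply: (@le_trans _ _ ((1 - x) ^+ (2 ^ n) * (1 + x) ^+ (2 ^ n))).
  rewrite ler_wpM2l ?exprn_ge0 ?subr_ge0//.
  have : forall k, k%:R * x <= (1 + x) ^+ k => [k|]; last exact.
  suff : 1 + k%:R * x <= (1 + x) ^+ k by apply: le_trans; rewrite lerDr.
  elim: k => [|k ih]; first by rewrite mul0r addr0 expr0.
  rewrite exprS; apply: (@le_trans _ _ ((1 + x) * (1 + k%:R * x))).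
    have : 0 <= k%:R * x ^+ 2 by rewrite mulr_ge0// sqr_ge0.
    by rewrite -natr1; nra.
  by rewrite ler_wpM2l ?addr_ge0// ltW.
rewrite -exprMn exprn_ile1//; first by rewrite mulr_ge0 ?subr_ge0 ?addr_ge0 ?(ltW x0).
by have := sqr_ge0 x; nra.
Qed.

Lemma sin_le : {in `[- (pi / 2), pi / 2] &, forall x y, x <= y -> sin x <= sin y}.
Proof. by move=> x y xI yI; rewrite !leNgt; apply: contra; rewrite ltr_sin. Qed.

(** The step polynomial is composed with u = (1 + sin (th (y - c))) / 2, which passes 1/2 exactly at
    y = c on [-L, L]. The bounds 0 and 1 hold on the whole line, so the values outside [-L, L] cost
    only a tail probability. One [p] serves every finite index type. *)
Lemma exists_step_trig L c (eta e : R) : 0 < eta -> 0 < e ->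
  exists p : R -> R, [/\
    forall (I : finType) (i : I), trig_poly (fun x : I -> R => p (x i)),
    forall y, 0 <= p y <= 1,
    forall y, `|y| <= L -> y <= c - eta -> p y <= e &
    forall y, `|y| <= L -> c + eta <= y -> 1 - e <= p y].
Proof.
move=> eta0 e0.
(* This scale keeps th (y - c) in [-1, 1] for |y| <= L, where the sine increases. *)
pose th : R := (`|L| + `|c| + 1)^-1.
have th0 : 0 < th by rewrite invr_gt0 ltr_wpDl ?addr_ge0.
have thle y : `|y| <= L -> `|th * (y - c)| <= 1.
  move=> yL; rewrite normrM gtr0_norm// /th mulrC ler_pdivrMr ?mul1r ?ltr_wpDl ?addr_ge0//.
  rewrite (le_trans (ler_normB _ _))// (@le_trans _ _ (`|L| + `|c|)) ?lerDl//.
  by rewrite lerD2r (le_trans yL)// ler_norm.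
have pih : 1 <= pi / 2 :> R := pihalf_ge1 R.
have inI t : `|t| <= 1 -> t \in `[- (pi / 2), (pi / 2) : R].
  by rewrite in_itv/= -ler_norml => /le_trans; exact.
(* If th eta > 1, no y with |y| <= L reaches c + eta, and the zero function will do. *)
have [big|small] := ltP 1 (th * eta).
  exists (fun=> 0); split.
  - by move=> I i; exact: trig_cst.
  - by move=> y; rewrite lexx ler01.
  - by move=> *; exact: ltW.
  - move=> y /thle + cy; rewrite ler_norml => /andP[_ h].
    have : th * eta <= 1 by rewrite (le_trans _ h)// ler_pM2l// lerBrDl.
    by rewrite leNgt big.
pose s0 := sin (th * eta).
have te0 : 0 < th * eta by rewrite mulr_gt0.
have s00 : 0 < s0.
  rewrite sin_gt0_pi// te0/= (le_lt_trans small)//.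
  by rewrite (lt_le_trans _ (pi_ge2 R))// ltr1n.
have s01 : s0 <= 1 by exact: sin_le1.
have s1 : 0 < 1 + s0 by rewrite addr_gt0.
(* Since 2 u <= 1 - s0 on the low side and 2 u >= 1 + s0 on the high side, this inequality lets one
   exponent [n] serve both. *)
have s1V : 1 - s0 <= (1 + s0)^-1.
  by rewrite -[leRHS]mul1r ler_pdivlMr//; have := sqr_ge0 s0; nra.
have [n hn] : exists n, (1 + s0)^-1 ^+ n <= e.
  have : (1 + s0)^-1 ^+ n @[n --> \oo] --> (0 : R).
    by apply: cvg_expr; rewrite ger0_norm ?invr_ge0 ?(ltW s1)// invf_lt1// ltrDl.
  move/cvgrPdist_le => /(_ _ e0)[n _ /(_ n (leqnn n))] /= h; exists n.
  by move: h; rewrite sub0r normrN => /(le_trans (ler_norm _)).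
pose u y := (1 + sin (th * (y - c))) / 2.
have u01 y : 0 <= u y <= 1.
  have := sin_geN1 (th * (y - c)); have := sin_le1 (th * (y - c)).
  by rewrite /u; lra.
have u2 y : 2 * u y = 1 + sin (th * (y - c)) by rewrite /u mulrC divfK.
exists (fun y => step_poly n (u y)); split.
- move=> I i; apply: trig_one_sub; apply: trig_exp; apply: trig_one_sub; apply: trig_exp.
  rewrite /u; under eq_fun do rewrite mulrC; apply: trig_scale.
  apply: trig_add; first exact: trig_cst.
  have := @trig_cos R I (fun j => if j == i then th else 0) (- (th * c) - pi / 2).
  congr trig_poly; apply/funext => x; rewrite addrA cosBpihalf; congr sin.
  rewrite (bigD1 i)//= eqxx big1 ?addr0 ?mulrBr// => j /negbTE ->.
  by rewrite mul0r.
- by move=> y; exact: step_poly01.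
- move=> y yL yc; rewrite (le_trans (step_poly_low _ (u01 y)))// (le_trans _ hn)//.
  rewrite lerXn2r ?nnegrE ?invr_ge0 ?(ltW s1)//; first by rewrite mulr_ge0//; case/andP: (u01 y).
  rewrite u2 (le_trans _ s1V)// lerD2l -sinN sin_le ?inI ?normrN ?thle// ?(gtr0_norm te0)//.
  by rewrite -mulrN ler_pM2l//; lra.
- move=> y yL cy.
  have s0u : s0 <= sin (th * (y - c)).
    rewrite sin_le ?inI ?thle// ?(gtr0_norm te0)//.
    by rewrite ler_pM2l//; lra.
  have uy0 : 0 < u y by rewrite /u; lra.
  rewrite lerBlDl -lerBlDr (le_trans (step_poly_high n _))//.
    by rewrite uy0; case/andP: (u01 y).
  have y2 : 1 + s0 <= 2 * u y by rewrite u2 lerD2l.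
  have y20 : 0 < 2 * u y by exact: lt_le_trans y2.
  apply: le_trans hn; rewrite exprVn lef_pV2 ?posrE ?exprn_gt0//.
  by rewrite lerXn2r ?nnegrE ?(ltW s1) ?(ltW y20).
Qed.

End step_approximation.

(** * The Cramer-Wold device for orthants *)

Section cramer_wold.
Context {R : realType} {I : finType}.
Context {d} {T : measurableType d} (P : probability T R) (X : I -> T -> R).
Context {d'} {T' : measurableType d'} (P' : probability T' R) (Y : I -> T' -> R).
Hypothesis mX : forall i, measurable_fun setT (X i).
Hypothesis mY : forall i, measurable_fun setT (Y i).
Hypothesis XY : forall (a : I -> R) (b : R),
  Ex P (fun w => cos (\sum_i a i * X i w + b)) = Ex P' (fun w => cos (\sum_i a i * Y i w + b)).

Lemma measurable_lin {d0} {T0 : measurableType d0} (Z : I -> T0 -> R) (a : I -> R) (b : R) :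
  (forall i, measurable_fun setT (Z i)) -> measurable_fun setT (fun w => \sum_i a i * Z i w + b).
Proof.
move=> mZ; apply: measurable_funD => //; apply: measurable_sum => i.
by apply: measurable_funM.
Qed.

Lemma bm_trig {d0} {T0 : measurableType d0} (Z : I -> T0 -> R) f :
  (forall i, measurable_fun setT (Z i)) -> trig_poly f ->
  bounded_measurable (fun w => f (fun i => Z i w)).
Proof.
move=> mZ; elim=> [a b|f1 f2 _ h1 _ h2|c f1 _ h].
- by apply: bm_cos; exact: measurable_lin.
- exact: bmD.
- exact: bmZ.
Qed.

Lemma Ex_trig_eq f : trig_poly f ->
  Ex P (fun w => f (fun i => X i w)) = Ex P' (fun w => f (fun i => Y i w)).
Proof.
elim=> [a b|f1 f2 h1 e1 h2 e2|c f1 h1 e1]; first exact: XY.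
- by rewrite !ExD ?e1 ?e2//; exact: bm_trig.
- by rewrite !ExZ ?e1//; exact: bm_trig.
Qed.

(** Products over the coordinates of trigonometric steps are trigonometric polynomials, so their
    expectations agree; they converge boundedly to the indicator of the orthant. *)
Lemma cramer_wold (J : pred I) (c : I -> R) :
  Ex P (fun w => \prod_(i | J i) (c i <= X i w)%R%:R) = Ex P' (fun w => \prod_(i | J i) (c i <= Y i w)%R%:R).
Proof.
pose e k : R := k.+1%:R^-1.
have e0 k : 0 < e k by rewrite invr_gt0.
(* The k-th step is centred at c - e(k) with half-width e(k), so that y = c already lies on the high
   side: the orthant is closed. *)
have /choice[p hp] : forall ki : nat * I, exists p : R -> R, [/\
    forall (J : finType) (j : J), trig_poly (fun x : J -> R => p (x j)),
    forall y, 0 <= p y <= 1,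
    forall y, `|y| <= ki.1%:R -> y <= (c ki.2 - e ki.1) - e ki.1 -> p y <= e ki.1 &
    forall y, `|y| <= ki.1%:R -> (c ki.2 - e ki.1) + e ki.1 <= y -> 1 - e ki.1 <= p y].
  by move=> ki; exact: exists_step_trig.
pose f k (x : I -> R) := \prod_(i | J i) p (k, i) (x i).
have tf k : trig_poly (f k) by apply: trig_prod => i; have [h _ _ _] := hp (k, i); exact: h.
have pc i y : p (k, i) y @[k --> \oo] --> ((c i <= y)%R%:R : R).
  apply/cvgrPdist_le => r r0; near=> k.
  have yk : `|y| <= k%:R.
    by near: k; exact: nbhs_infty_ger.
  have ek : e k <= r.
    rewrite invf_ple ?posrE// (@le_trans _ _ k%:R) ?ler_nat//.
    by near: k; exact: nbhs_infty_ger.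
  have [_ p01 pl ph] := hp (k, i).
  have /andP[p0 p1] := p01 y.
  have [cy|yc] := leP (c i) y.
    have := ph _ yk; rewrite /= subrK => /(_ cy) h.
    by rewrite ger0_norm ?subr_ge0//=; lra.
  have := pl _ yk; rewrite /= => h; rewrite /= sub0r normrN ger0_norm//.
  apply: le_trans ek; apply: h.
  have : e k <= (c i - y) / 2.
    rewrite /e -[leRHS]invrK lef_pV2 ?posrE ?invr_gt0 ?divr_gt0 ?subr_gt0//.
    rewrite (@le_trans _ _ k%:R) ?ler_nat//.
    by near: k; exact: nbhs_infty_ger.
  lra.
have bnd k x : `|f k x| <= 1.
  rewrite /f normr_prod prodr_ile1// => i _; rewrite normr_ge0/=.
  by have [_ p01 _ _] := hp (k, i); have /andP[p0 p1] := p01 (x i); rewrite ger0_norm.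
have lim d0 (T0 : measurableType d0) (P0 : probability T0 R) (Z : I -> T0 -> R) :
  (forall i, measurable_fun setT (Z i)) ->
  Ex P0 (fun w => f k (fun i => Z i w)) @[k --> \oo] -->
  Ex P0 (fun w => \prod_(i | J i) (c i <= Z i w)%R%:R).
  move=> mZ; apply: (@Ex_cvg _ _ _ P0 (fun k w => f k (fun i => Z i w)) _ 1).
  - by move=> k; have [] := bm_trig mZ (tf k).
  - by move=> k w; exact: bnd.
  - move=> w; rewrite /f; elim: (index_enum I) => [|i r ih].
      by rewrite big_nil; under eq_fun do rewrite big_nil; exact: cvg_cst.
    rewrite big_cons; under eq_fun do rewrite big_cons.
    by case: (J i) => //; apply: cvgM; first exact: pc.
have l1 := lim _ _ P _ mX; have l2 := lim _ _ P' _ mY.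
have E : (fun k => Ex P (fun w => f k (fun i => X i w))) = (fun k => Ex P' (fun w => f k (fun i => Y i w))).
  by apply/funext => k; exact: (Ex_trig_eq (tf k)).
rewrite E in l1; exact: (cvg_unique _ l1 l2).
Unshelve. all: by end_near. Qed.

End cramer_wold.

(** * Continuity theorem along a filter *)

Lemma bm_bool {R : realType} {d} {T : measurableType d} (b : T -> bool) :
  measurable [set w | b w] -> bounded_measurable (fun w => (b w)%:R : R).
Proof.
move=> mb; have := @bm_indic _ _ R _ mb; congr bounded_measurable.
apply/funext => w; rewrite indicE; congr ((nat_of_bool _)%:R).
by apply/idP/idP => [/set_mem|h]; [|exact/mem_set].
Qed.

Lemma Ex_bool {R : realType} {d} {T : measurableType d} (P : probability T R) (b : T -> bool) :
  measurable [set w | b w] -> Ex P (fun w => (b w)%:R) = Pr P [set w | b w].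
Proof.
move=> mb; rewrite -Ex_indic//; congr Ex.
apply/funext => w; rewrite indicE; congr ((nat_of_bool _)%:R).
by apply/idP/idP => [h|/set_mem]; [exact/mem_set|].
Qed.

Section levy.
Context {R : realType}.

Lemma step_upper_pt (y e : R) (b t : bool) : 0 <= e -> 0 <= y -> y <= 1 ->
  (b -> ~~ t -> y <= e) -> b%:R <= 1 - y + e + t%:R.
Proof.
move=> e0 y0 y1; case: b; case: t => /= h; [lra|have {}h := h isT isT; lra|lra|lra].
Qed.

Lemma step_lower_pt (y e : R) (b t : bool) : 0 <= e -> 0 <= y -> y <= 1 ->
  (~~ b -> ~~ t -> 1 - e <= y) -> 1 - y <= b%:R + e + t%:R.
Proof.
move=> e0 y0 y1; case: b; case: t => /= h; [lra|lra|lra|have {}h := h isT isT; lra].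
Qed.

Lemma measurable_lt {d} {T : measurableType d} (u : T -> R) (c : R) :
  measurable_fun setT u -> measurable [set w | c < u w].
Proof.
move=> mu; rewrite [X in measurable X](_ : _ = u @^-1` `]c, +oo[%classic).
  by rewrite -[X in measurable X]setTI; exact: mu.
by apply/seteqP; split => w /=; rewrite in_itv/= andbT.
Qed.

Lemma tail_small {d} {T : measurableType d} (P : probability T R) (u : T -> R) (e : R) :
  measurable_fun setT u -> 0 < e -> exists L : R, Pr P [set w | L < `|u w|] <= e.
Proof.
move=> mu e0.
have mt (k : nat) : measurable [set w | k%:R < `|u w|].
  by apply: (@measurable_lt _ _ (fun w => `|u w|)); exact: measurableT_comp.
have : Ex P (fun w => (k%:R < `|u w|)%R%:R) @[k --> \oo] --> Ex P (fun=> 0).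
  apply: (@Ex_cvg _ _ _ P (fun (k : nat) w => (k%:R < `|u w|)%R%:R) _ 1).
  - by move=> k; have [] := @bm_bool R _ _ _ (mt k).
  - by move=> k w; case: (_ < _); rewrite ?normr1 ?normr0.
  - move=> w; apply: cvg_near_cst; near=> k.
    rewrite ltNge (_ : `|u w| <= k%:R)//.
    by near: k; exact: nbhs_infty_ger.
rewrite Ex_cst => /cvgrPdist_le/(_ _ e0)[k _ /(_ k (leqnn k))] /=.
rewrite sub0r normrN Ex_bool// => h; exists k%:R.
exact: le_trans (ler_norm _) h.
Unshelve. all: by end_near. Qed.

(** * Distribution functions enclosed between trigonometric steps *)

Section sandwich.
Context {d} {T : measurableType d} (P : probability T R) (Z : T -> R).
Hypothesis mZ : measurable_fun setT Z.
Variables (L c eta e : R) (p : R -> R).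
Hypothesis p01 : forall y, 0 <= p y <= 1.
Hypothesis e0 : 0 <= e.
Hypothesis plow : forall y, `|y| <= L -> y <= c - eta -> p y <= e.
Hypothesis phigh : forall y, `|y| <= L -> c + eta <= y -> 1 - e <= p y.
Hypothesis bp : bounded_measurable (fun w => p (Z w)).

Let mtail : measurable [set w | L < `|Z w|].
Proof. by apply: (@measurable_lt _ _ (fun w => `|Z w|)); exact: measurableT_comp. Qed.

Lemma step_upper : Pr P [set w | Z w <= c - eta] <=
  Ex P (fun w => 1 - p (Z w)) + e + Pr P [set w | L < `|Z w|].
Proof.
have bZ := @bm_bool R _ _ _ (measurable_le (c - eta) mZ).
have bt := @bm_bool R _ _ _ mtail.
have b1 := bmB (bm_cst 1) bp.
rewrite -(Ex_bool P (measurable_le (c - eta) mZ)) -(Ex_bool P mtail).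
rewrite -[e in leRHS](Ex_cst P e) -!ExD//; last 2 first.
  by apply: bmD => //; exact: bm_cst.
  exact: bm_cst.
apply: le_Ex => //; first by apply: bmD => //; apply: bmD => //; exact: bm_cst.
move=> w; have /andP[q0 q1] := p01 (Z w).
apply: step_upper_pt => // h; rewrite -leNgt => h'; exact: plow.
Qed.

Lemma step_lower : Ex P (fun w => 1 - p (Z w)) <=
  Pr P [set w | Z w <= c + eta] + e + Pr P [set w | L < `|Z w|].
Proof.
have bZ := @bm_bool R _ _ _ (measurable_le (c + eta) mZ).
have bt := @bm_bool R _ _ _ mtail.
have b1 := bmB (bm_cst 1) bp.
rewrite -(Ex_bool P (measurable_le (c + eta) mZ)) -(Ex_bool P mtail).
rewrite -[e in leRHS](Ex_cst P e) -!ExD//; last 2 first.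
  by apply: bmD => //; exact: bm_cst.
  exact: bm_cst.
apply: le_Ex => //; first by apply: bmD => //; apply: bmD => //; exact: bm_cst.
move=> w; have /andP[q0 q1] := p01 (Z w).
apply: step_lower_pt => //; rewrite -ltNge => /ltW h; rewrite -leNgt => h'; exact: phigh.
Qed.

End sandwich.

Context (F : set_system nat) {FF : Filter F}.
Context (d : nat -> measure_display) (T : forall m, measurableType (d m))
        (P : forall m, probability (T m) R) (X : forall m, T m -> R).
Hypothesis mX : forall m, measurable_fun setT (@X m).
Variable v : R.
Hypothesis v0 : 0 <= v.
Hypothesis cosX : forall a b : R,
  Ex (P m) (fun w => cos (a * X w + b)) @[m --> F] --> expR (- (a ^+ 2 * v / 2)) * cos b.
Hypothesis tight : forall e : R, 0 < e ->
  exists L : R, \forall m \near F, Pr (P m) [set w | L < `|X w|] <= e.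

(** Convergence of the cosine expectations extends linearly to trigonometric steps, which enclose
    the distribution function up to tails. Tightness controls the tails because a step is accurate
    only on [-L, L]. *)
Lemma levy_continuity x :
  {for x, continuous (fun y : R => centered_normal v `]-oo, y]%classic)} ->
  (fun m => P m [set w | X w <= x]) @ F --> centered_normal v `]-oo, x]%classic.
Proof.
have [Q [Qv cosQ]] := centered_normal_prob v0.
have mid : measurable_fun [set: measurableTypeR R] (id : measurableTypeR R -> R) by exact: measurable_id.
pose G y := Pr Q [set z | z <= y].
have GE y : centered_normal v `]-oo, y]%classic = (G y)%:E.
  have E : `]-oo, y]%classic = [set z | z <= y] by apply/seteqP; split => z /=; rewrite in_itv.
  by rewrite Qv// E PrE//; apply: (@measurable_le _ (measurableTypeR R) R id).
under [X in {for x, continuous X}]eq_fun do rewrite GE.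
move=> cG; rewrite GE.
have trigcvg (f : ('I_1 -> R) -> R) : trig_poly f ->
    Ex (P m) (fun w => f (fun=> X w)) @[m --> F] --> Ex Q (fun z => f (fun=> z)).
  have bmf d0 (T0 : measurableType d0) (Z : T0 -> R) g : measurable_fun setT Z -> trig_poly g ->
      bounded_measurable (fun w => g (fun _ : 'I_1 => Z w)).
    by move=> mZ tg; apply: (@bm_trig R 'I_1 _ _ (fun _ => Z)).
  elim=> [a b|f1 f2 t1 h1 t2 h2|c f1 t1 h1].
  - rewrite (_ : Ex Q _ = Ex Q (fun z => cos (a ord0 * z + b))); last first.
      by congr Ex; apply/funext => z; rewrite big_ord1.
    rewrite (_ : (fun m => _) = fun m => Ex (P m) (fun w => cos (a ord0 * X w + b))); last first.
      by apply/funext => m; congr Ex; apply/funext => z; rewrite big_ord1.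
    by rewrite cosQ; exact: cosX.
  - rewrite (_ : (fun m => _) = fun m => Ex (P m) (fun w => f1 (fun=> X w)) + Ex (P m) (fun w => f2 (fun=> X w))); last first.
      by apply/funext => m; rewrite ExD//; exact: bmf.
    by rewrite ExD; [exact: cvgD|exact: bmf|exact: bmf].
  - rewrite (_ : (fun m => _) = fun m => c * Ex (P m) (fun w => f1 (fun=> X w))); last first.
      by apply/funext => m; rewrite ExZ//; exact: bmf.
    by rewrite ExZ; [exact: cvgMr|exact: bmf].
have pcvg (p : R -> R) : (forall (I : finType) (i : I), trig_poly (fun x : I -> R => p (x i))) ->
   Ex (P m) (fun w => 1 - p (X w)) @[m --> F] --> Ex Q (fun z => 1 - p z).
  by move=> tp; exact: (trigcvg _ (trig_one_sub (tp 'I_1 ord0))).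
have bmp d0 (T0 : measurableType d0) (Z : T0 -> R) (p : R -> R) : measurable_fun setT Z ->
   (forall (I : finType) (i : I), trig_poly (fun x : I -> R => p (x i))) ->
      bounded_measurable (fun w => p (Z w)).
  by move=> mZ tp; exact: (@bm_trig R 'I_1 _ _ (fun _ => Z) _ (fun _ => mZ) (tp _ ord0)).
suff : Pr (P m) [set w | X w <= x] @[m --> F] --> G x.
  move=> h; apply: cvg_EFin; last exact: h.
  by apply: nearW => m; rewrite fin_num_measure//; exact: measurable_le.
apply/cvgrPdist_le => r r0.
(* On each side six errors of size at most [e] add up: two step approximations, two tails, the
   convergence of expectations and the continuity of [G]. *)
pose e := r / 7; have e0 : 0 < e by rewrite divr_gt0.
have cG' : {for x, continuous G} by exact: fine_cvg cG.
have [del del0 hdel] : exists2 del, 0 < del & forall y, `|x - y| <= del -> `|G x - G y| <= e.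
  move/cvgrPdist_le : cG' => /(_ _ e0)/nbhs_ballP[del /= del0 h].
  exists (del / 2); first by rewrite divr_gt0.
  move=> y hy; apply: h => /=; rewrite /ball/=.
  by rewrite (le_lt_trans hy)// ltr_pdivrMr// ltr_pMr// ltr1n.
have [L1 hL1] := tail_small Q mid e0.
have [L2 hL2] := tight e0.
pose L := Num.max L1 L2.
have tail_le d0 (T0 : measurableType d0) (P0 : probability T0 R) (Z : T0 -> R) (M : R) :
    measurable_fun setT Z -> M <= L -> Pr P0 [set w | L < `|Z w|] <= Pr P0 [set w | M < `|Z w|].
  move=> mZ ML; apply: le_Pr.
  - by apply: (@measurable_lt _ _ (fun w => `|Z w|)); exact: measurableT_comp.
  - by apply: (@measurable_lt _ _ (fun w => `|Z w|)); exact: measurableT_comp.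
  - by move=> w /=; exact: le_lt_trans.
have tQ : Pr Q [set w | L < `|w|] <= e.
  by apply: le_trans hL1; apply: (tail_le _ _ Q id) => //; rewrite le_max lexx.
pose eta := del / 2.
have eta0 : 0 < eta by rewrite divr_gt0.
(* The transition zones of [p] and [p'] fill [x, x + del] and [x - del, x]. *)
have [p [tp p01 pl ph]] := exists_step_trig L (x + eta) eta0 e0.
have [p' [tp' p'01 pl' ph']] := exists_step_trig L (x - eta) eta0 e0.
have c1 : \forall m \near F, `|Ex Q (fun z => 1 - p z) - Ex (P m) (fun w => 1 - p (X w))| <= e.
  by move/cvgrPdist_le : (pcvg _ tp); exact.
have c2 : \forall m \near F, `|Ex Q (fun z => 1 - p' z) - Ex (P m) (fun w => 1 - p' (X w))| <= e.
  by move/cvgrPdist_le : (pcvg _ tp'); exact.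
have e0' := ltW e0.
have Q1 := step_lower Q mid p01 e0' ph (bmp _ _ id _ mid tp).
have Q2 := step_upper Q mid p'01 e0' pl' (bmp _ _ id _ mid tp').
have G1 := hdel (x + del); have G2 := hdel (x - del).
near=> m.
have tm : Pr (P m) [set w | L < `|X w|] <= e.
  have h : Pr (P m) [set w | L2 < `|X w|] <= e by near: m.
  by apply: le_trans h; apply: tail_le => //; rewrite le_max lexx orbT.
have U := step_upper (P m) (@mX m) p01 e0' pl (bmp _ _ (@X m) _ (@mX m) tp).
have D := step_lower (P m) (@mX m) p'01 e0' ph' (bmp _ _ (@X m) _ (@mX m) tp').
have d1 : `|Ex Q (fun z => 1 - p z) - Ex (P m) (fun w => 1 - p (X w))| <= e by near: m.
have d2 : `|Ex Q (fun z => 1 - p' z) - Ex (P m) (fun w => 1 - p' (X w))| <= e by near: m.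
move: U D Q1 Q2 G1 G2 d1 d2 tm tQ; rewrite /= addrK subrK.
have -> : x + eta + eta = x + del by rewrite /eta; field.
have -> : x - eta - eta = x - del by rewrite /eta; field.
rewrite -/(G (x + del)) -/(G (x - del)).
have -> : x - (x + del) = - del by ring.
have -> : x - (x - del) = del by ring.
rewrite normrN (gtr0_norm del0).
rewrite !ler_norml => U D Q1 Q2 /(_ (lexx _))/andP[G11 G12] /(_ (lexx _))/andP[G21 G22].
move=> /andP[d11 d12] /andP[d21 d22] tm tQ.
have re : r = e *+ 7 by rewrite /e -mulr_natr divfK.
by rewrite re; apply/andP; split; lra.
Unshelve. all: by end_near. Qed.

End levy.

(** * Rejection probability and the crossing point *)

Section standard_normal.
Context {R : realType}.
Notation lmu := (@lebesgue_measure R).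
Implicit Types x y c t : R.
Notation phi := (normal_pdf (0 : R) 1).

Lemma is_derive_Phi x : is_derive x 1 (@Phi R) (phi x).
Proof.
have i : lmu.-integrable [set` Interval -oo%O (BRight (x + 1))] (EFin \o phi).
  by apply: (integrableS measurableT) => //; exact: integrable_normal_pdf.
have h1 : x < x + 1 by rewrite ltrDl.
have h2 : (-oo < x%:E)%E by rewrite ltNyr.
have h3 : {for x, continuous phi} by exact: (@continuous_normal_pdf R 0 1 (oner_neq0 _)).
have [d1 d2] := continuous_FTC1 h1 i h2 h3.
by apply: DeriveDef; [exact: d1|rewrite -derive1E; exact: d2].
Qed.

Lemma continuous_Phi : continuous (@Phi R).
Proof.
move=> x; apply: differentiable_continuous; apply/derivable1_diffP.
by case: (is_derive_Phi x).
Qed.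

Lemma phi_gt0 x : 0 < phi x.
Proof. by rewrite normal_pdfE ?oner_neq0// mulr_gt0 ?normal_peak_gt0 ?oner_neq0// expR_gt0. Qed.

Lemma MVT_real (f f' : R -> R) x y : x < y -> (forall z : R, is_derive z 1 f (f' z)) ->
  exists c, [/\ x <= c, c <= y & f y - f x = f' c * (y - x)].
Proof.
move=> xy df; have [|c] := @MVT_segment R f f' x y (ltW xy) (fun z _ => df z).
  apply: continuous_subspaceT => z; apply: differentiable_continuous; apply/derivable1_diffP.
  by case: (df z).
by rewrite in_itv/= => /andP[xc cy] e; exists c.
Qed.

Lemma Phi_lt x y : x < y -> Phi x < Phi y.
Proof.
move=> xy; have [c [_ _ e]] := MVT_real xy is_derive_Phi.
by rewrite -subr_gt0 e mulr_gt0 ?phi_gt0// subr_gt0.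
Qed.

Lemma Phibar_lt x y : x < y -> Phibar y < Phibar x.
Proof. by move=> xy; rewrite /Phibar ltrD2l ltrN2 Phi_lt. Qed.

Lemma Phibar_le x y : (Phibar x <= Phibar y) = (y <= x).
Proof.
have [h|h] := leP y x; last by apply/negbTE; rewrite -ltNge Phibar_lt.
by move: h; rewrite le_eqVlt => /predU1P[->|/Phibar_lt/ltW//]; rewrite lexx.
Qed.

Lemma continuous_Phibar : continuous (@Phibar R).
Proof.
by move=> x; apply: (@continuousB R R R (fun=> 1)); [exact: cvg_cst|exact: continuous_Phi].
Qed.

Lemma Phi_small e : 0 < e -> exists x, Phi x < e.
Proof.
move=> e0; have e20 : 0 < e / 2 by rewrite divr_gt0.
have [L hL] := @tail_small R _ _ (normal_prob (0:R) 1) (id : measurableTypeR R -> R) _ (@measurable_id _ _ _) e20.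
exists (- `|L| - 1); apply: (@le_lt_trans _ _ (e / 2)); last by rewrite ltr_pdivrMr// ltr_pMr// ltr1n.
apply: le_trans hL; apply: le_Pr => //.
  by apply: (@measurable_lt R _ (measurableTypeR R) (fun w => `|w|)); exact: measurableT_comp.
move=> x /=; rewrite in_itv/= => hx; have hL := ler_norm L.
apply: (@lt_le_trans _ _ (- x)); last by rewrite -normrN ler_norm.
lra.
Qed.

Lemma Phibar_small e : 0 < e -> exists x, Phibar x < e.
Proof.
move=> e0; have e20 : 0 < e / 2 by rewrite divr_gt0.
have [L hL] := @tail_small R _ _ (normal_prob (0:R) 1) (id : measurableTypeR R -> R) _ (@measurable_id _ _ _) e20.
exists L; apply: (@le_lt_trans _ _ (e / 2)); last by rewrite ltr_pdivrMr// ltr_pMr// ltr1n.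
apply: le_trans hL.
rewrite /Phibar -[1 - _](@Pr_setC _ (measurableTypeR R) R (normal_prob 0 1))//.
apply: le_Pr => //; first exact: measurableC.
  by apply: (@measurable_lt R _ (measurableTypeR R) (fun w => `|w|)); exact: measurableT_comp.
by move=> x /=; rewrite in_itv/= => /negP; rewrite -ltNge => /lt_le_trans; apply; exact: ler_norm.
Qed.

Lemma Phi_gt0 x : 0 < Phi x.
Proof.
rewrite (@le_lt_trans _ _ (Phi (x - 1)))//; first exact: Pr_ge0.
by rewrite Phi_lt// ltrBlDr ltrDl.
Qed.

Lemma Phibar_lt1 x : Phibar x < 1.
Proof. by rewrite /Phibar ltrBlDr ltrDl Phi_gt0. Qed.

Lemma Phibar_gt0 x : 0 < Phibar x.
Proof.
apply: (@le_lt_trans _ _ (Phibar (x + 1))); last by rewrite Phibar_lt// ltrDl.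
by rewrite /Phibar subr_ge0; apply: Pr_le1.
Qed.

Lemma Phibar_surj t : 0 < t < 1 -> exists c, Phibar c = t.
Proof.
move=> /andP[t0 t1]; have [a ha] := Phibar_small t0.
have [b hb] : exists b, Phi b < 1 - t by apply: Phi_small; rewrite subr_gt0.
have tb : t < Phibar b by rewrite /Phibar ltrBrDr addrC -ltrBrDr.
have ba : b <= a by rewrite -Phibar_le (ltW (lt_trans ha tb)).
have [c _ hc] := @IVT R (@Phibar R) b a t ba (continuous_subspaceT continuous_Phibar)
  ltac:(by rewrite ge_min le_max (ltW ha) (ltW tb) orbT).
by exists c.
Qed.

Lemma Phibar_invK c : Phibar_inv (Phibar c) = c%:E.
Proof.
rewrite /Phibar_inv; apply/eqP; rewrite eq_le; apply/andP; split.
  apply: ub_ereal_sup => _ [x /= + <-]; rewrite Phibar_le => h.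
  by rewrite lee_fin.
by apply: ereal_sup_ubound; exists c => /=.
Qed.

Definition quant t : R := fine (Phibar_inv t).

Lemma quantK c : quant (Phibar c) = c.
Proof. by rewrite /quant Phibar_invK. Qed.

Lemma Phibar_quant t : 0 < t < 1 -> Phibar (quant t) = t.
Proof. by move=> /Phibar_surj[c <-]; rewrite quantK. Qed.

Lemma Phibar_le_quant t x : 0 < t < 1 -> (Phibar x <= t) = (quant t <= x).
Proof. by move=> /Phibar_surj[c <-]; rewrite quantK Phibar_le. Qed.

(** * Monotone likelihood ratio and the geometry of the crossing *)

Section shift.
Variable mu : R.
Hypothesis mu0 : 0 < mu.

(* The likelihood ratio phi (x - mu) / phi x. *)
Definition lratio x := expR (mu * x - mu ^+ 2 / 2).

Lemma lratioE x : phi (x - mu) = lratio x * phi x.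
Proof.
rewrite !normal_pdfE ?oner_neq0// !normal_fun0E /lratio (mulrCA (expR _)); congr (_ * _).
by rewrite -expRD; congr expR; field.
Qed.

Lemma lratio_le x y : x <= y -> lratio x <= lratio y.
Proof. by move=> xy; rewrite ler_expR lerD2r ler_pM2l. Qed.

Let is_derive_comb k x : is_derive x 1 (fun y => Phi (y - mu) - k * Phi y) ((lratio x - k) * phi x).
Proof.
have h1 := @is_derive1_comp R (@Phi R) _ x _ _ (is_derive_Phi _) (is_derive_affine 1 (- mu) x).
have h2 := @is_deriveB _ _ _ _ _ x 1 _ _ h1 (@is_deriveZ _ _ _ _ k x 1 _ (is_derive_Phi x)).
have e : (fun y => Phi (y - mu) - k * Phi y) = (@Phi R \o (fun y : R => 1 * y + - mu)) - (k \*: @Phi R).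
  by apply/funext => y; rewrite /= !fctE /= mul1r.
by rewrite e; apply: (is_derive_eq h2); rewrite mul1r mulr1 lratioE mulrBl.
Qed.

(** On [x, y] the derivative of Phi (z - mu) - lratio x Phi z is nonnegative, as the likelihood
    ratio increases. Together with [shift_upper] this is the concavity of t -> Phibar (quant t -
    mu), in terms of chord slopes. *)
Lemma shift_lower x y : x < y ->
  lratio x * (Phibar x - Phibar y) <= Phibar (x - mu) - Phibar (y - mu).
Proof.
move=> xy; have [c [xc cy e]] := MVT_real xy (is_derive_comb (lratio x)).
have : 0 <= (lratio c - lratio x) * phi c * (y - x).
  by rewrite !mulr_ge0 ?subr_ge0 ?lratio_le ?(ltW xy)// ltW ?phi_gt0.
rewrite -e /Phibar; lra.
Qed.

Lemma shift_upper x y : x < y ->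
  Phibar (x - mu) - Phibar (y - mu) <= lratio y * (Phibar x - Phibar y).
Proof.
move=> xy; have [c [xc cy e]] := MVT_real xy (is_derive_comb (lratio y)).
have : 0 <= (lratio y - lratio c) * phi c * (y - x).
  by rewrite !mulr_ge0 ?subr_ge0 ?lratio_le ?(ltW xy)// ltW ?phi_gt0.
have -> : (lratio y - lratio c) * phi c * (y - x) = - ((lratio c - lratio y) * phi c * (y - x)) by ring.
rewrite -e /Phibar; lra.
Qed.

Variables q pi1 : R.
Hypothesis q01 : 0 < q < 1.
Hypothesis pi01 : 0 < pi1 < 1.

Definition rej_prob t := (1 - pi1) * t + pi1 * Phibar (quant t - mu).

(** [D] is the excess rej_prob t - t / q read in the coordinate c with t = Phibar c; its zeros are
    the crossings. *)
Let A := q^-1 - (1 - pi1).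
Let D c := pi1 * Phibar (c - mu) - A * Phibar c.

Let DE c : rej_prob (Phibar c) - Phibar c / q = D c.
Proof. by rewrite /rej_prob quantK /D /A; field; case/andP: q01 => /lt0r_neq0. Qed.

Let pi1A : pi1 < A.
Proof.
case/andP: q01 => q0 q1; rewrite /A.
have : 1 < q^-1 by rewrite invf_gt1.
lra.
Qed.

Let pi1_gt0 : 0 < pi1. Proof. by case/andP: pi01. Qed.

Let A0 : 0 < A. Proof. exact: lt_trans pi1A. Qed.

(** Far in the tail the likelihood ratio exceeds 2 A / pi1, so the shifted tail outweighs the linear
    term. *)
Let D_pos M : exists x, M < x /\ 0 < D x.
Proof.
pose x := Num.max (M + 1) ((2 * A / pi1 + mu ^+ 2 / 2) / mu).
exists x; split; first by rewrite lt_max ltrDl ltr01.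
have hL : 2 * A / pi1 < lratio x.
  apply: (@lt_le_trans _ _ (1 + (mu * x - mu ^+ 2 / 2))); last exact: expR_ge1Dx.
  have : (2 * A / pi1 + mu ^+ 2 / 2) <= mu * x.
    by rewrite [leRHS]mulrC -ler_pdivrMr// /x le_max lexx orbT.
  lra.
(* Beyond [y] lies less than half of the tail mass at [x]; the factor 2 in 2 A / pi1 pays for
   restricting to [x, y]. *)
have [y hy] := @Phibar_small (Phibar x / 2) ltac:(by rewrite divr_gt0// Phibar_gt0).
have hx := Phibar_gt0 x.
have xy : x < y.
  by rewrite ltNge -Phibar_le -ltNge (lt_trans hy)// ltr_pdivrMr// ltr_pMr// ltr1n.
have h := shift_lower xy; have h' := Phibar_gt0 (y - mu).
have h2 : A * Phibar x < pi1 * (lratio x * (Phibar x / 2)).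
  have -> : A * Phibar x = pi1 * (2 * A / pi1 * (Phibar x / 2)) by field; rewrite gt_eqF.
  by rewrite ltr_pM2l// ltr_pM2r// divr_gt0.
have h3 : lratio x * (Phibar x / 2) <= lratio x * (Phibar x - Phibar y).
  by rewrite ler_wpM2l ?expR_ge0//; lra.
have h4 : lratio x * (Phibar x / 2) <= Phibar (x - mu) by lra.
have h5 : pi1 * (lratio x * (Phibar x / 2)) <= pi1 * Phibar (x - mu) by rewrite ler_pM2l.
by rewrite /D subr_gt0 (lt_le_trans h2).
Qed.

(** With t = Phibar x, D x < pi1 - A t, which is negative for t close to 1 because pi1 < A. *)
Let D_neg : exists x, D x < 0.
Proof.
have [x hx] := @Phi_small (1 - pi1 / A) ltac:(by rewrite subr_gt0 ltr_pdivrMr ?mul1r).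
exists x; have h : pi1 < A * Phibar x.
  by rewrite mulrC -ltr_pdivrMr// /Phibar; lra.
have h2 : pi1 * Phibar (x - mu) < pi1 by rewrite gtr_pMr// Phibar_lt1.
by rewrite /D subr_lt0 (lt_trans h2).
Qed.

(** As a function of t the excess is concave. Its chord from t = Phibar x0 to the zero at Phibar c0
    has slope - k: the graph lies above this chord between the two points and below its extension to
    the right of the zero. *)
Let D_gap c0 x0 : D c0 = 0 -> c0 < x0 -> 0 < D x0 ->
  let k := D x0 / (Phibar c0 - Phibar x0) in
  [/\ 0 < k,
      forall c, c < c0 -> D c <= - k * (Phibar c - Phibar c0) &
      forall c, c0 < c -> c < x0 -> k * (Phibar c0 - Phibar c) <= D c].
Proof.
move=> Dc0 cx Dx0 k; have d0 : 0 < Phibar c0 - Phibar x0 by rewrite subr_gt0 Phibar_lt.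
have up x y : x < y -> D x - D y <= (pi1 * lratio y - A) * (Phibar x - Phibar y).
  move=> /shift_upper h; have : pi1 * (Phibar (x - mu) - Phibar (y - mu)) <= pi1 * (lratio y * (Phibar x - Phibar y)).
    by rewrite ler_pM2l.
  by rewrite /D; lra.
have lo x y : x < y -> (pi1 * lratio x - A) * (Phibar x - Phibar y) <= D x - D y.
  move=> /shift_lower h; have : pi1 * (lratio x * (Phibar x - Phibar y)) <= pi1 * (Phibar (x - mu) - Phibar (y - mu)).
    by rewrite ler_pM2l.
  by rewrite /D; lra.
have kE : k * (Phibar c0 - Phibar x0) = D x0 by rewrite /k divfK// gt_eqF.
split; first by rewrite divr_gt0.
- move=> c cc0; have h := up _ _ cc0; have := lo _ _ cx.
  rewrite Dc0 sub0r -kE -mulNr ler_pM2r// => h2.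
  rewrite Dc0 subr0 in h; apply: (le_trans h).
  by rewrite ler_wpM2r// subr_ge0 ltW// Phibar_lt.
- move=> c c0c cx0; have h1 := up _ _ c0c; have h2 := lo _ _ cx0.
  rewrite Dc0 sub0r in h1.
  have dt : 0 < Phibar c0 - Phibar c by rewrite subr_gt0 Phibar_lt.
  have dt' : 0 < Phibar c - Phibar x0 by rewrite subr_gt0 Phibar_lt.
  rewrite -(ler_pM2r d0) mulrAC kE.
  move: h1 h2; set s := (pi1 * _ - A) => h1 h2.
  (* The tangent slope [s] at [c] bounds the chord on either side of it; weighting each bound by the
     length of the other chord eliminates [s]. *)
  have h3 : D x0 * (Phibar c0 - Phibar c) <= (D c - s * (Phibar c - Phibar x0)) * (Phibar c0 - Phibar c).
    by rewrite ler_pM2r//; lra.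
  have h4 : - D c * (Phibar c - Phibar x0) <= s * (Phibar c0 - Phibar c) * (Phibar c - Phibar x0).
    by rewrite ler_pM2r//.
  lra.
Qed.

Lemma crossing_gap tau : BH_crossing q mu pi1 tau ->
  exists k t0, [/\ 0 < k, 0 < t0 < tau,
    forall t, tau <= t -> t < 1 -> rej_prob t - t / q <= - k * (t - tau) &
    forall t, t0 <= t -> t <= tau -> k * (tau - t) <= rej_prob t - t / q].
Proof.
move=> [tau01 E]; have [c0 hc0] := Phibar_surj tau01.
have Dc0 : D c0 = 0.
  by rewrite -DE hc0 E /rej_prob subrr.
have [x1 [cx1 Dx1]] := D_pos c0.
have [k0 g1 g2] := D_gap Dc0 cx1 Dx1; set k := D x1 / _ in k0 g1 g2.
(* The midpoint makes c < x1 strict on the whole closed range t0 <= t, as [D_gap] requires. *)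
pose x0 := (c0 + x1) / 2.
have cx0 : c0 < x0 by rewrite /x0; lra.
have x01 : x0 < x1 by rewrite /x0; lra.
exists k, (Phibar x0); split => //.
- by rewrite Phibar_gt0 -hc0 Phibar_lt.
- move=> t + t1; rewrite le_eqVlt => /predU1P[<-|tt].
    by rewrite subrr mulr0 -hc0 DE Dc0.
  have [|c hc] := @Phibar_surj t; first by rewrite t1 andbT (lt_trans _ tt)//; case/andP: tau01.
  rewrite -hc DE -hc0; apply: g1.
  by rewrite ltNge -Phibar_le -ltNge hc hc0.
- move=> t t0 +; rewrite le_eqVlt => /predU1P[->|tt].
    by rewrite subrr mulr0 -hc0 DE Dc0.
  have tp : 0 < t by apply: (lt_le_trans _ t0); exact: Phibar_gt0.
  have [|c hc] := @Phibar_surj t; first by rewrite tp (lt_trans tt)//; case/andP: tau01.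
  rewrite -hc DE -hc0; apply: g2.
    by rewrite ltNge -Phibar_le -ltNge hc hc0.
  by rewrite (le_lt_trans _ x01)// -Phibar_le hc.
Qed.

(** Existence is the intermediate value theorem for [D]. A second crossing is impossible: to the
    right of any crossing the excess is strictly negative by [crossing_gap]. *)
Lemma crossing_exists_unique : exists! t : R, BH_crossing q mu pi1 t.
Proof.
have cD : continuous D.
  move=> x; apply: (@continuousB R R R (fun x => pi1 * Phibar (x - mu)) (fun x => A * Phibar x)).
    apply: (@continuousM R R (fun=> pi1)); first exact: cvg_cst.
    apply: (@continuous_comp _ _ _ (fun x => x - mu) (@Phibar R)); last exact: continuous_Phibar.
    by apply: (@continuousB R R R id (fun=> mu)); [exact: cvg_id|exact: cvg_cst].
  by apply: (@continuousM R R (fun=> A)); [exact: cvg_cst|exact: continuous_Phibar].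
have [a Da] := D_neg; have [b [ab Db]] := D_pos a.
have [c _ Dc] := @IVT R D a b 0 (ltW ab) (continuous_subspaceT cD)
  ltac:(by rewrite ge_min le_max (ltW Da) (ltW Db) orbT).
have cr : BH_crossing q mu pi1 (Phibar c).
  split; first by rewrite Phibar_gt0 Phibar_lt1.
  by have := DE c; rewrite Dc => /eqP; rewrite subr_eq0 => /eqP <-.
have lt_absurd t t' : BH_crossing q mu pi1 t -> BH_crossing q mu pi1 t' -> t < t' -> False.
  move=> ct [t'01 E'] tt'; have [k [t0 [k0 _ g _]]] := crossing_gap ct.
  have := g t' (ltW tt'); case/andP: (t'01) => _ -> /(_ isT).
  rewrite E' -/(quant t') -/(rej_prob t') subrr mulNr oppr_ge0 leNgt.
  by rewrite mulr_gt0// subr_gt0.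
exists (Phibar c); split => // t ct; apply/eqP; rewrite eq_le !leNgt; apply/andP; split; apply/negP => h.
  exact: (lt_absurd _ _ ct cr).
exact: (lt_absurd _ _ cr ct).
Qed.

(** At a crossing tau / q is a rejection probability, hence below 1. With delta < 1 - q this keeps
    tau + delta below 1. *)
Lemma crossing_lt_q tau : BH_crossing q mu pi1 tau -> tau < q.
Proof.
move=> [tau01 E]; case/andP: q01 => q0 q1; case/andP: tau01 => t0 t1.
rewrite -(mul1r q) -ltr_pdivrMr// E.
have h : pi1 * Phibar (fine (Phibar_inv tau) - mu) < pi1 by rewrite gtr_pMr// Phibar_lt1.
have h2 : (1 - pi1) * tau < 1 - pi1 by rewrite gtr_pMr// subr_gt0; case/andP: pi01.
lra.
Qed.

End shift.
End standard_normal.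

(** * Benjamini-Hochberg threshold *)

Section bh_combinatorics.
Context {R : realType} (q : R) {m : nat} (p : 'I_m -> R) (h : 'I_m -> bool).
Hypothesis q0 : 0 <= q.

Definition num_below t : nat := (\sum_(i < m) (p i <= t)%R)%N.
Definition num_null_below t : nat := (\sum_(i < m) ((p i <= t)%R && ~~ h i))%N.

Lemma card_set_sum (b : pred 'I_m) : #|[set i | b i]%classic| = (\sum_(i < m) b i)%N.
Proof.
rewrite -sum1_card big_mkcond; apply: eq_bigr => i _.
rewrite (_ : (i \in _) = b i); first by case: (b i).
by apply/idP/idP => [/set_mem//|hi]; exact/mem_set.
Qed.

Lemma num_below_mono s t : s <= t -> (num_below s <= num_below t)%N.
Proof.
move=> st; apply: leq_sum => i _.
by have [h1|] := boolP (p i <= s); rewrite ?(le_trans h1 st).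
Qed.

Lemma num_below_max t : (num_below t <= m)%N.
Proof. rewrite -[leqRHS]card_ord -sum1_card; apply: leq_sum => i _; exact: leq_b1. Qed.

Lemma sorted_pvalue_le (j : nat) t : (0 < j)%N -> (j <= m)%N ->
  (sorted_pvalue p j <= t) = (j <= num_below t)%N.
Proof.
case: j => // j _ jm; rewrite /sorted_pvalue /=.
set s := sort _ _.
have ss : sorted <=%R s by apply: sort_sorted; exact: le_total.
have sz : size s = m by rewrite size_sort size_map size_enum_ord.
have -> : num_below t = count (fun x => x <= t) s.
  rewrite (permP (permEl (perm_sort _ _))) count_map -sumn_count /num_below.
  by rewrite -big_enum /= sumnE big_map.
apply/idP/idP => [h1|h1]; last exact: nth_count_le.
rewrite ltnNge; apply/negP => h2.
have := @nth_count_gt _ _ t 0 s j ss; rewrite h2 sz jm => /(_ isT).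
by rewrite ltNge h1.
Qed.

Let tj (j : nat) : R := j%:R * q / m%:R.

Lemma BH_le (j : nat) : (j <= m)%N -> (sorted_pvalue p j <= tj j) = (j <= num_below (tj j))%N.
Proof.
case: j => [_|j jm]; last by rewrite sorted_pvalue_le.
by rewrite /sorted_pvalue /tj/= !mul0r lexx.
Qed.

Notation rej := (BH_rejections q p).

Lemma BH_rejections_le : (rej <= m)%N.
Proof. by apply/bigmax_leqP => j _; rewrite -ltnS. Qed.

Lemma BH_rejections_sat : (rej <= num_below (tj rej))%N.
Proof.
have [j hj e] : exists2 j : 'I_m.+1, sorted_pvalue p j <= tj j & rej = j.
  have h0 : sorted_pvalue p (ord0 : 'I_m.+1) <= tj (ord0 : 'I_m.+1).
    by rewrite /sorted_pvalue /tj/= !mul0r.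
  have := @eq_bigmax_cond _ (fun j : 'I_m.+1 => (sorted_pvalue p j <= tj j)%R) (fun j : 'I_m.+1 => j : nat).
  move=> /(_ _)[|j hj e]; first by apply/card_gt0P; exists ord0.
  by exists j.
by rewrite e -BH_le// -ltnS.
Qed.

Lemma BH_rejections_max (j : nat) : (j <= m)%N -> (j <= num_below (tj j))%N -> (j <= rej)%N.
Proof.
move=> jm; rewrite -BH_le// => hj; rewrite -ltnS in jm.
exact: (@leq_bigmax_cond _ (fun j : 'I_m.+1 => sorted_pvalue p j <= tj j) (fun j : 'I_m.+1 => j : nat) (Ordinal jm)).
Qed.

Definition BH_cut : R := rej%:R * q / m%:R.

(** For j = N(T) >= R the boundary value j q / m is at least T, so N(j q / m) >= j: the index j
    passes the test and maximality gives j <= R. *)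
Lemma num_below_cut : num_below BH_cut = rej.
Proof.
apply/eqP; rewrite eqn_leq BH_rejections_sat andbT.
apply: BH_rejections_max; first exact: num_below_max.
apply: num_below_mono; rewrite /tj ler_wpM2r ?invr_ge0// ler_wpM2r// ler_nat.
exact: BH_rejections_sat.
Qed.

(** P_(R) <= R q / m and both thresholds have exactly R p-values below them, so no p-value lies
    strictly above the first and at most the second. *)
Lemma false_rejectionsE : false_rejections q p h = num_null_below BH_cut.
Proof.
(* For R = 0 both thresholds are 0 by convention. *)
have [r0|r0] := posnP rej.
  by rewrite /false_rejections card_set_sum /num_null_below /BH_threshold /BH_cut r0 /sorted_pvalue/= !mul0r.
have thr : BH_threshold q p <= BH_cut.
  by rewrite /BH_threshold sorted_pvalue_le ?num_below_cut//; exact: BH_rejections_le.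
have eqc : num_below (BH_threshold q p) = num_below BH_cut.
  apply/eqP; rewrite eqn_leq num_below_mono//= num_below_cut.
  by rewrite -sorted_pvalue_le//; exact: BH_rejections_le.
have E i : (p i <= BH_threshold q p) = (p i <= BH_cut).
  apply/idP/idP => [/le_trans|hi]; first exact.
  apply: contraT => ni; suff : (num_below (BH_threshold q p) < num_below BH_cut)%N by rewrite eqc ltnn.
  rewrite /num_below (bigD1 i)//= [ltnRHS](bigD1 i)//= hi (negbTE ni) add0n add1n ltnS.
  by apply: leq_sum => k _; have [h1|] := boolP (p k <= BH_threshold q p); rewrite ?(le_trans h1 thr).
rewrite /false_rejections card_set_sum /num_null_below.
by apply: eq_bigr => i _; rewrite E.
Qed.

Lemma FDP_cutE : FDP q p h = (num_null_below BH_cut)%:R / (maxn rej 1)%:R.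
Proof. by rewrite /FDP false_rejectionsE. Qed.

(** The index j = N(t) passes the test, since t <= j q / m; hence R >= N(t). No maximality of t is
    involved, so one favourable t bounds T from below. *)
Lemma le_BH_cut t : (0 < m)%N -> 0 < q -> m%:R * t / q <= (num_below t)%:R -> t <= BH_cut.
Proof.
move=> m0 q1 ht.
have m1 : 0 < m%:R :> R by rewrite ltr0n.
have tN : t <= tj (num_below t).
  by rewrite /tj ler_pdivlMr// mulrC -ler_pdivrMr.
have NR : (num_below t <= rej)%N.
  by apply: BH_rejections_max; [exact: num_below_max|exact: num_below_mono].
apply: (le_trans tN); rewrite /tj /BH_cut ler_wpM2r ?invr_ge0// ler_wpM2r//.
by rewrite ler_nat.
Qed.

Lemma num_below_cutR : (0 < m)%N -> 0 < q -> (num_below BH_cut)%:R = m%:R * BH_cut / q.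
Proof.
move=> m0 q1; rewrite num_below_cut /BH_cut.
by field; rewrite !gt_eqF ?ltr0n.
Qed.

Lemma BH_cut_le : (0 < m)%N -> BH_cut <= q.
Proof.
move=> m0; rewrite /BH_cut ler_pdivrMr ?ltr0n// mulrC ler_wpM2l// ler_nat.
exact: BH_rejections_le.
Qed.

Lemma FDP_cut_pos : (0 < m)%N -> 0 < q -> 0 < BH_cut ->
  FDP q p h = q * ((num_null_below BH_cut)%:R / m%:R) / BH_cut.
Proof.
move=> m0 q1 c0; rewrite FDP_cutE.
have r0 : (0 < rej)%N.
  by rewrite lt0n; apply/eqP => r0; move: c0; rewrite /BH_cut r0 !mul0r ltxx.
rewrite (maxn_idPl r0) /BH_cut; field.
by rewrite !gt_eqF ?ltr0n.
Qed.

End bh_combinatorics.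

(** * Measurability of the false discovery proportion *)

Section fdp_measurable.
Context {R : realType} {d} {T : measurableType d}.

(** The function is a finite sum over Boolean patterns of constants times products of indicators. *)
Lemma measurable_fun_ffun (J : finType) (b : J -> T -> bool) (G : {ffun J -> bool} -> R) :
  (forall j, measurable [set w | b j w]) ->
  measurable_fun setT (fun w => G [ffun j => b j w]).
Proof.
move=> mb.
have -> : (fun w => G [ffun j => b j w]) =
    (fun w => \sum_(f : {ffun J -> bool}) G f * \prod_(j : J) (if f j then (b j w)%:R else 1 - (b j w)%:R)).
  apply/funext => w; rewrite (bigD1 [ffun j => b j w])//= big1 ?mulr1 ?big1 ?mulr1 ?addr0//.
    move=> f ne; have [j nj] : exists j, f j != b j w.
      apply/existsP; apply: contraR ne => /existsPn ne; apply/eqP/ffunP => j.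
      by rewrite ffunE; apply/eqP; have := ne j; rewrite negbK.
    rewrite (bigD1 j)//=; move: nj; case: (f j); case: (b j w) => //= _.
      by rewrite mul0r mulr0.
    by rewrite subrr mul0r mulr0.
  by move=> j _; rewrite ffunE; case: (b j w) => //=; rewrite subr0.
apply: measurable_sum => f; apply: measurable_funM => //.
apply: measurable_prod => j _; have [mj _] := @bm_bool R _ _ _ (mb j).
by case: (f j) => //; apply: measurable_funB.
Qed.

Lemma measurable_FDP (q : R) (m : nat) (p : 'I_m -> T -> R) (h : 'I_m -> T -> bool) :
  0 <= q -> (forall i, measurable_fun setT (p i)) -> (forall i, measurable [set w | h i w]) ->
  measurable_fun setT (fun w => FDP q (fun i => p i w) (fun i => h i w)).
Proof.
move=> q0 mp mh.
(* [FDP] is determined by the finitely many comparisons p_i <= j q / m together with the h_i; [J]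
   indexes these bits. *)
pose J := (('I_m * 'I_m.+1) + 'I_m)%type.
pose b (j : J) w := match j with
  | inl ij => p ij.1 w <= (ij.2 : nat)%:R * q / m%:R
  | inr i => h i w end.
pose N (f : {ffun J -> bool}) (j : 'I_m.+1) := (\sum_(i < m) f (inl (i, j)))%N.
pose rj (f : {ffun J -> bool}) := (\max_(j < m.+1 | (j <= N f j)%N) j)%N.
pose V (f : {ffun J -> bool}) := (\sum_(i < m) (f (inl (i, inord (rj f))) && ~~ f (inr i)))%N.
pose G f := (V f)%:R / (maxn (rj f) 1)%:R : R.
have E w : FDP q (fun i => p i w) (fun i => h i w) = G [ffun j => b j w].
  rewrite FDP_cutE// /G; set f := [ffun j => b j w].
  have rE : BH_rejections q (fun i => p i w) = rj f.
    rewrite /BH_rejections /rj; apply: eq_bigl => j; have jm : (j <= m)%N by rewrite -ltnS.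
    rewrite BH_le//; congr (_ <= _)%N.
    by apply: eq_bigr => i _; rewrite ffunE.
  congr (_%:R / _); last by rewrite rE.
  apply: eq_bigr => i _; rewrite !ffunE /= inordK -?rE//.
  by rewrite ltnS BH_rejections_le.
under eq_fun do rewrite E.
apply: measurable_fun_ffun => -[[i j]|i] /=; last exact: mh.
exact: measurable_le.
Qed.

End fdp_measurable.

(** * Gaussian vectors with block structure *)

Section product_law.
Context {R : realType} {d1 d2} {T1 : measurableType d1} {T2 : measurableType d2}.
Context (P1 : probability T1 R) (P2 : probability T2 R).

Lemma bm_fst (u : T1 -> R) : bounded_measurable u -> bounded_measurable (fun z : T1 * T2 => u z.1).
Proof.
move=> [mu [M uM]]; split; last by exists M => z.
exact: (measurableT_comp mu (@measurable_fst _ _ _ _)).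
Qed.

Lemma bm_snd (u : T2 -> R) : bounded_measurable u -> bounded_measurable (fun z : T1 * T2 => u z.2).
Proof.
move=> [mu [M uM]]; split; last by exists M => z.
exact: (measurableT_comp mu (@measurable_snd _ _ _ _)).
Qed.

Lemma Ex_prod (u : T1 -> R) (v : T2 -> R) : bounded_measurable u -> bounded_measurable v ->
  Ex (P1 \x P2)%E (fun z => u z.1 * v z.2) = Ex P1 u * Ex P2 v.
Proof.
move=> bu bv; have iu := bm_integrable P1 bu; have iv := bm_integrable P2 bv.
have iuv := bm_integrable (P1 \x P2)%E (bmM (bm_fst bu) (bm_snd bv)).
rewrite /Ex /Rintegral -fineM; [|exact: integrable_fin_num|exact: integrable_fin_num].
congr fine; rewrite -(@integral12_prod_meas1 _ _ _ _ _ P1 P2 _ iuv) /=.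
rewrite /fubini_F/=.
under eq_integral do under eq_integral do rewrite EFinM.
under eq_integral do rewrite integralZl//.
have -> : (\int[P2]_x (v x)%:E)%E = (Ex P2 v)%:E.
  by rewrite /Ex /Rintegral fineK//; exact: integrable_fin_num.
by rewrite integralZr.
Qed.

End product_law.

Section gaussian_law.
Context {R : realType}.

(** Only the coefficient 1 is recorded; a factor [a] is absorbed into [X] and [v]. *)
Definition gauss_cf {d} {T : measurableType d} (P : probability T R) (X : T -> R) (v : R) :=
  measurable_fun setT X /\ forall b, Ex P (fun w => cos (X w + b)) = expR (- (v / 2)) * cos b.

(** The cosine of the sum expands into products, a sine being a cosine shifted by pi / 2. The sine
    term vanishes because X1 has a symmetric law. *)
Lemma gauss_cf_prod {d1 d2} {T1 : measurableType d1} {T2 : measurableType d2}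
   (P1 : probability T1 R) (P2 : probability T2 R) X1 X2 v1 v2 :
  gauss_cf P1 X1 v1 -> gauss_cf P2 X2 v2 ->
  gauss_cf (P1 \x P2)%E (fun z => X1 z.1 + X2 z.2) (v1 + v2).
Proof.
move=> [m1 h1] [m2 h2].
have m1' := measurableT_comp m1 (@measurable_fst _ _ T1 T2).
have m2' := measurableT_comp m2 (@measurable_snd _ _ T1 T2).
split; first exact: measurable_funD.
move=> b.
have E z : cos (X1 z.1 + X2 z.2 + b) = cos (X1 z.1) * cos (X2 z.2 + b) - cos (X1 z.1 - pi / 2) * cos (X2 z.2 + b - pi / 2).
  by rewrite -(addrA (X1 _)) [LHS]cosD (cosBpihalf (X1 _)) cosBpihalf.
rewrite (_ : (fun z => _) = (fun z : T1 * T2 => cos (X1 z.1) * cos (X2 z.2 + b) - cos (X1 z.1 - pi / 2) * cos (X2 z.2 + b - pi / 2))); last first.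
  by apply/funext => z; rewrite E.
have bm1 c : bounded_measurable (fun w => cos (X1 w + c)) by apply: bm_cos; exact: measurable_funD.
have bm2 c : bounded_measurable (fun w => cos (X2 w + c)) by apply: bm_cos; exact: measurable_funD.
have bm10 : bounded_measurable (fun w => cos (X1 w)) by exact: bm_cos.
rewrite ExB; last 2 first.
- by apply: bmM; [exact: (bm_fst bm10)|exact: (bm_snd (bm2 b))].
- apply: bmM; first exact: (bm_fst (bm1 _)).
  by under eq_fun do rewrite -addrA; exact: (bm_snd (bm2 _)).
rewrite (Ex_prod P1 P2 bm10 (bm2 b)) (Ex_prod P1 P2 (u := fun w => cos (X1 w - pi / 2)) (v := fun w => cos (X2 w + b - pi / 2))); last 2 first.
- exact: bm1.
- by under eq_fun do rewrite -addrA; exact: bm2.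
rewrite h1 h2 cosN cos_pihalf mulr0 mul0r subr0.
have := h1 0; under [X in Ex _ X]eq_fun do rewrite addr0.
move=> ->; rewrite cos0 mulr1 mulrA -expRD; congr (expR _ * _); by field.
Qed.

Lemma Ex_law {d} {T : measurableType d} (P : probability T R) (Q : probability (measurableTypeR R) R)
  (X : T -> R) (f : R -> R) : measurable_fun setT X ->
  (forall A, measurable A -> P (X @^-1` A) = Q A) ->
  bounded_measurable (f : measurableTypeR R -> R) -> Ex P (fun w => f (X w)) = Ex Q f.
Proof.
move=> mX PQ bf; rewrite /Ex /Rintegral; congr fine.
have bfX : bounded_measurable (fun w => f (X w)).
  by have [mf [M fM]] := bf; split; [exact: (measurableT_comp mf mX)|exists M].
have mX' : measurable_fun setT (X : T -> measurableTypeR R) by exact: mX.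
rewrite -(@eq_measure_integral _ _ _ _ Q (pushforward P (X : T -> measurableTypeR R)))//; last first.
  by move=> A mA _; exact: PQ.
rewrite (@integral_pushforward _ _ _ _ _ _ mX' P setT (EFin \o f))//.
- by have [mf _] := bf; exact/measurable_EFinP.
- by have := bm_integrable P bfX.
Qed.

End gaussian_law.

Section model.
Context {R : realType} {d} {T : measurableType d} (P : probability T R).
Context {m : nat} (pi1 : R) (G : 'M[R]_m).
Context (H : 'I_m -> {RV P >-> bool}) (eps : 'I_m -> {RV P >-> R}).
Hypothesis pi01 : 0 < pi1 < 1.
Hypothesis model : two_group_model pi1 G H eps.

Definition cov_form (a : 'I_m -> R) : R := \sum_i \sum_j a i * G i j * a j.

Let meps i : measurable_fun setT (eps i). Proof. exact: measurable_funP. Qed.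

Let formE (a : 'I_m -> R) : ((\row_i a i) *m G *m (\row_i a i)^T) 0 0 = cov_form a.
Proof.
rewrite /cov_form exchange_big /= !mxE; apply: eq_bigr => j _.
rewrite !mxE mulr_suml; apply: eq_bigr => i _.
by rewrite !mxE.
Qed.

Lemma cov_form_ge0 a : 0 <= cov_form a.
Proof. by have [_ _ [_ _ h] _ _] := model; rewrite -formE. Qed.

Lemma gauss_cf_eps (a : 'I_m -> R) : gauss_cf P (fun w => \sum_i a i * eps i w) (cov_form a).
Proof.
have mZ : measurable_fun setT (fun w => \sum_i a i * eps i w).
  by have := measurable_lin a 0 meps; under eq_fun do rewrite addr0.
split => // b.
have [_ _ _ gv _] := model.
have [Q [Qv cosQ]] := centered_normal_prob (cov_form_ge0 a).
have law A : measurable A -> P ((fun w => \sum_i a i * eps i w) @^-1` A) = Q A.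
  move=> mA; rewrite -Qv// -formE -(gv (\row_i a i))//.
  congr (P _); apply/funext => w /=; congr (A _).
  by apply: eq_bigr => i _; rewrite mxE.
rewrite (@Ex_law R _ _ P Q (fun w => \sum_i a i * eps i w) (fun x => cos (x + b)))//.
  have := cosQ 1 b; under eq_fun do rewrite mul1r.
  by rewrite expr1n mul1r.
by apply: bm_cos; exact: measurable_funD.
Qed.

Lemma normal_ge_prob (c : R) : Pr (normal_prob (0 : R) 1) `[c, +oo[%classic = Phibar c.
Proof.
have -> : `[c, +oo[%classic = ~` `]-oo, c[%classic :> set R.
  by apply/seteqP; split => x /=; rewrite !in_itv/= andbT => h; [apply/negP; rewrite -leNgt|rewrite leNgt; apply/negP].
rewrite (@Pr_setC _ (measurableTypeR R) R (normal_prob 0 1))//; congr (1 - _).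
apply: (@Rintegral_itv_bndo_bndc R -oo%O c (normal_pdf 0 1)).
by apply: (integrableS measurableT) => //; exact: integrable_normal_pdf.
Qed.

Lemma eps_ge_prob i c : Pr P [set w | c <= eps i w] = Phibar c.
Proof.
have [_ _ [_ G1 _] gv _] := model.
have := gv (\row_j (j == i)%:R) `[c, +oo[%classic (measurable_itv _).
rewrite formE (_ : cov_form _ = 1); last first.
  rewrite /cov_form (bigD1 i)//= [X in _ + X]big1 ?addr0; last first.
    by move=> j /negbTE ->; rewrite big1// => k _; rewrite !mul0r.
  rewrite (bigD1 i)//= [X in _ + X]big1 ?addr0; last first.
    by move=> j /negbTE ->; rewrite mulr0.
  by rewrite eqxx mul1r mulr1 G1.
rewrite /centered_normal oner_eq0 sqrtr1 => e.
rewrite -normal_ge_prob /Pr; transitivity (fine (P [set w | `[c, +oo[%classic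
    (\sum_j (\row_j (j == i)%:R : 'rV[R]_m) 0 j * eps j w)])); last by congr fine.
congr (fine (P _)); apply/funext => w /=.
rewrite in_itv/= andbT (bigD1 i)//= mxE eqxx mul1r big1 ?addr0//.
by move=> j /negbTE; rewrite mxE => ->; rewrite mul0r.
Qed.

(** Stands for a union of blocks: no correlation links [A] to its complement. *)
Definition block_closed (A : {set 'I_m}) := forall i j, i \in A -> j \notin A -> G i j = 0.

Lemma cov_form_split (A : {set 'I_m}) (a : 'I_m -> R) : block_closed A ->
  cov_form a = cov_form (fun i => if i \in A then a i else 0) + cov_form (fun i => if i \in A then 0 else a i).
Proof.
move=> cA; have [_ _ [Gt _ _] _ _] := model.
rewrite /cov_form -big_split/=; apply: eq_bigr => i _; rewrite -big_split/=; apply: eq_bigr => j _.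
have [iA|iA] := boolP (i \in A); have [jA|jA] := boolP (j \in A); rewrite ?(mul0r, mulr0, addr0, add0r)//.
  by rewrite cA// mulr0 mul0r.
by rewrite -Gt mxE cA// mulr0 mul0r.
Qed.

Lemma bm_eps_ge i c : bounded_measurable (fun w => (c <= eps i w)%R%:R : R).
Proof. by apply: bm_bool; exact: measurable_ge. Qed.

(** On T x T take the coordinates in [A] from the first copy and the others from the second. The
    covariance form splits along [A], so every linear combination has the same law as for [eps]; by
    [cramer_wold] the orthant probabilities agree, and on the product space they factor. *)
Lemma eps_ge_indep (A : {set 'I_m}) (J : pred 'I_m) (c : 'I_m -> R) : block_closed A ->
  Ex P (fun w => \prod_(i | J i) (c i <= eps i w)%R%:R) =
  Ex P (fun w => \prod_(i | J i && (i \in A)) (c i <= eps i w)%R%:R) *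
  Ex P (fun w => \prod_(i | J i && (i \notin A)) (c i <= eps i w)%R%:R).
Proof.
move=> cA.
pose Y i (z : T * T) := if i \in A then eps i z.1 else eps i z.2.
have mY i : measurable_fun setT (Y i).
  rewrite /Y; case: (i \in A).
    exact: (measurableT_comp (meps i) (@measurable_fst _ _ _ _)).
  exact: (measurableT_comp (meps i) (@measurable_snd _ _ _ _)).
rewrite -Ex_prod; [|by apply: bm_prod => i; exact: bm_eps_ge|by apply: bm_prod => i; exact: bm_eps_ge].
transitivity (Ex (P \x P)%E (fun z => \prod_(i | J i) (c i <= Y i z)%R%:R)).
  apply: cramer_wold => // a b.
  have [_ ->] := gauss_cf_eps a.
  rewrite (cov_form_split a cA); have [_ <-] := gauss_cf_prod (gauss_cf_eps (fun i => if i \in A then a i else 0))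
     (gauss_cf_eps (fun i => if i \in A then 0 else a i)).
  congr Ex; apply/funext => z /=; congr (cos (_ + _)).
  rewrite -big_split/=; apply: eq_bigr => i _; rewrite /Y.
  by case: (i \in A); rewrite mul0r ?addr0 ?add0r.
congr Ex; apply/funext => z; rewrite (bigID (fun i => i \in A))/=; congr (_ * _).
  by apply: eq_bigr => i /andP[_ iA]; rewrite /Y iA.
by apply: eq_bigr => i /andP[_ /negbTE iA]; rewrite /Y iA.
Qed.

(** The pair is compared with (x, rho x + sqrt (1 - rho^2) y) through a^2 + 2 a b rho + b^2 = (a + b
    rho)^2 + b^2 (1 - rho^2). *)
Lemma eps_pair_prob i j (rho c : R) : -1 <= rho <= 1 -> i != j -> G i j = rho ->
  Ex P (fun w => (c <= eps i w)%R%:R * (c <= eps j w)%R%:R) =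
  fine (bivariate_normal rho [set z | c <= z.1 /\ c <= z.2]).
Proof.
move=> rho1 ij Gij; have [_ _ [Gt G1 _] _ _] := model.
set N := normal_prob (0 : R) 1.
pose Y (b : bool) (z : measurableTypeR R * measurableTypeR R) : R :=
  if b then z.1 else rho * z.1 + Num.sqrt (1 - rho ^+ 2) * z.2.
pose X (b : bool) w := if b then eps i w else eps j w.
have mX b : measurable_fun setT (X b) by case: b; exact: meps.
have m1 : measurable_fun setT (fun z : measurableTypeR R * measurableTypeR R => z.1 : R) by exact: measurable_fst.
have m2 : measurable_fun setT (fun z : measurableTypeR R * measurableTypeR R => z.2 : R) by exact: measurable_snd.
have mY b : measurable_fun setT (Y b).
  by case: b => //; apply: measurable_funD; apply: measurable_funM.
have N1 (a : R) : gauss_cf N (fun x => a * x) (a ^+ 2).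
  split; first by apply: measurable_funM.
  by move=> b; rewrite normal_cos ?oner_neq0// expr1n mulr1.
have XY (a : bool -> R) (b : R) :
    Ex P (fun w => cos (\sum_i a i * X i w + b)) = Ex (N \x N)%E (fun w => cos (\sum_i a i * Y i w + b)).
  pose a' k := if k == i then a true else if k == j then a false else 0.
  have ji : j != i by rewrite eq_sym.
  have sum2 (f : 'I_m -> R) : (forall k, k != i -> k != j -> f k = 0) -> \sum_k f k = f i + f j.
    move=> hf; rewrite (bigD1 i)//= (bigD1 j)//= big1 ?addr0// => k /andP[]; exact: hf.
  have e1 w : \sum_k a k * X k w = \sum_k a' k * eps k w.
    rewrite big_bool sum2 /a' /X/= ?eqxx ?(negbTE ji)// => k /negbTE -> /negbTE ->.
    by rewrite mul0r.
  under [in LHS]eq_fun do rewrite e1.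
  have [_ ->] := gauss_cf_eps a'.
  have sq : Num.sqrt (1 - rho ^+ 2) ^+ 2 = 1 - rho ^+ 2.
    by rewrite sqr_sqrtr// subr_ge0 -real_normK ?num_real// exprn_ile1// ler_norml.
  have e2 : cov_form a' = (a true + a false * rho) ^+ 2 + (a false * Num.sqrt (1 - rho ^+ 2)) ^+ 2.
    rewrite exprMn sq /cov_form sum2; last first.
      by move=> k /negbTE ki /negbTE kj; rewrite big1// => l _; rewrite /a' ki kj !mul0r.
    rewrite !sum2; first last.
    - by move=> k /negbTE ki /negbTE kj; rewrite /a' ki kj mulr0.
    - by move=> k /negbTE ki /negbTE kj; rewrite /a' ki kj mulr0.
    rewrite /a' eqxx (negbTE ji) eqxx !G1 Gij -Gt mxE Gij; ring.
  have [_ h] := gauss_cf_prod (N1 (a true + a false * rho)) (N1 (a false * Num.sqrt (1 - rho ^+ 2))).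
  rewrite e2 -h; congr Ex; apply/funext => z; congr (cos (_ + _)).
  by rewrite big_bool /Y/=; ring.
have := cramer_wold mX mY XY xpredT (fun=> c).
rewrite (_ : (fun w : T => \prod_(i | _) _) = (fun w => (c <= eps i w)%R%:R * (c <= eps j w)%R%:R)); last first.
  by apply/funext => w; rewrite big_bool.
move=> ->.
rewrite (_ : (fun w => \prod_(i | _) _) = (fun z => ((c <= Y true z) && (c <= Y false z))%:R)); last first.
  by apply/funext => z; rewrite big_bool/=; case: (_ <= _); case: (_ <= _); rewrite ?mulr1 ?mulr0 ?mul0r.
have mYc b := measurable_ge c (mY b).
rewrite Ex_bool /Pr /bivariate_normal /pushforward.
  by congr (fine (_ _)); apply/funext => z /=; apply/propext; rewrite /Y; split => [/andP//|[-> ->]].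
have -> : [set w | (c <= Y true w) && (c <= Y false w)] = [set w | c <= Y true w] `&` [set w | c <= Y false w].
  by apply/funext => z /=; apply/propext; split => [/andP//|[-> ->]].
exact: measurableI.
Qed.

End model.

(** * Functions of the observations of a block *)

Section bspan.
Context {R : realType} {d} {T : measurableType d} (P : probability T R).
Context {m : nat} (pi1 : R) (G : 'M[R]_m).
Context (H : 'I_m -> {RV P >-> bool}) (eps : 'I_m -> {RV P >-> R}).
Hypothesis pi01 : 0 < pi1 < 1.
Hypothesis model : two_group_model pi1 G H eps.

Let meps i : measurable_fun setT (eps i). Proof. exact: measurable_funP. Qed.
Lemma measurable_H i (h : bool) : measurable [set w | H i w == h].
Proof.
have -> : [set w | H i w == h] = H i @^-1` [set h] by apply/seteqP; split => w /= /eqP.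
by rewrite -[X in measurable X]setTI; exact: measurable_funP.
Qed.

Definition hprob (h : bool) : R := if h then pi1 else 1 - pi1.

Lemma H_prob i h : P (H i @^-1` [set h]) = (hprob h)%:E.
Proof.
have [dH _ _ _ _] := model.
transitivity (bernoulli_prob pi1 [set h]); first by rewrite -(dH i).
rewrite bernoulli_probE; last by case/andP: pi01 => /ltW -> /ltW ->.
have E (x y : bool) : (x \in [set y]%classic) = (x == y).
  by apply/idP/idP => [/set_mem ->//|/eqP ->]; exact/mem_set.
by rewrite !diracE !E; case: h; rewrite /= ?mule1 ?mule0 ?adde0 ?add0e.
Qed.

Lemma g_sigma_preimage_bigcap {d'} {T' : measurableType d'} n (X : 'I_n -> {RV P >-> T'})
   (J : {set 'I_n}) (A : 'I_n -> set T') : (forall i, measurable (A i)) ->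
  g_sigma_preimage (fun i => X i : T -> T') (\bigcap_(i in [set` J]) (X i @^-1` A i)).
Proof.
move=> mA.
apply: (@fin_bigcap_measurable _ (g_sigma_algebraType (\big[setU/set0]_(i < n) preimage_set_system setT (X i : T -> T') measurable))).
  exact: finite_finset.
move=> i _; apply: sub_sigma_algebra.
by rewrite -bigcup_seq; exists i; rewrite /= ?mem_index_enum//; exists (A i) => //; rewrite setTI.
Qed.

Lemma prod_bool_nat (J : {set 'I_m}) (b : 'I_m -> bool) :
  \prod_(i in J) (b i)%:R = ([forall i in J, b i])%:R :> R.
Proof.
have [/forall_inP h|/forall_inPn[i iJ /negbTE h]] := boolP [forall i in J, b i].
  by rewrite big1// => i /h ->.
by rewrite (bigD1 i)//= h mul0r.
Qed.

(** Once H_i is known, P_i <= t with 0 < t < 1 is a lower bound on eps_i, so the counts are sums of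
    such indicators. *)
Definition atom (h : 'I_m -> bool) (c : 'I_m -> R) i w : R := (H i w == h i)%:R * (c i <= eps i w)%R%:R.

Definition mono (J : {set 'I_m}) h c w : R := \prod_(i in J) atom h c i w.

Lemma bm_atom h c i : bounded_measurable (atom h c i).
Proof. by apply: bmM; apply: bm_bool; [exact: measurable_H|exact: measurable_ge]. Qed.

Lemma bm_mono J h c : bounded_measurable (mono J h c).
Proof. by apply: bm_prod => i; exact: bm_atom. Qed.

(** Here the independence of the H_i among themselves and from [eps] is used; what remains is an
    orthant probability of [eps]. *)
Lemma Ex_mono J h c : Ex P (mono J h c) =
  (\prod_(i in J) hprob (h i)) * Ex P (fun w => \prod_(i in J) (c i <= eps i w)%R%:R).
Proof.
pose A := \bigcap_(i in [set` J]) (H i @^-1` [set h i]).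
pose B := \bigcap_(i in [set` J]) (eps i @^-1` `[c i, +oo[%classic).
have mc i : measurable `[c i, +oo[%classic by exact: measurable_itv.
have mA : measurable A.
  apply: fin_bigcap_measurable => [|i _]; first exact: finite_finset.
  by rewrite -[X in measurable X]setTI; exact: measurable_funP.
have mB : measurable B.
  apply: fin_bigcap_measurable => [|i _]; first exact: finite_finset.
  by rewrite -[X in measurable X]setTI; exact: measurable_funP.
have PAB : Pr P (A `&` B) = Pr P A * Pr P B.
  have [_ _ _ _ ind] := model.
  rewrite {1}/Pr ind ?fineM//.
  - by rewrite fin_num_measure.
  - by rewrite fin_num_measure.
  - exact: g_sigma_preimage_bigcap.
  - exact: g_sigma_preimage_bigcap.
have PA : Pr P A = \prod_(i in J) hprob (h i).
  have [_ mi _ _ _] := model.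
  rewrite /Pr (mi J (fun i => [set h i]))//.
  rewrite (eq_bigr (fun i => (hprob (h i))%:E)); last by move=> i _; exact: H_prob.
  by rewrite prodEFin.
have PB : Ex P (fun w => \prod_(i in J) (c i <= eps i w)%R%:R) = Pr P B.
  rewrite -Ex_indic//; congr Ex; apply/funext => w; rewrite prod_bool_nat indicE; congr ((nat_of_bool _)%:R).
  apply/forall_inP/idP => [hw|/set_mem hw i iJ].
    by apply/mem_set => i /= iJ; rewrite in_itv/= andbT hw.
  by have := hw i iJ; rewrite /= in_itv/= andbT.
rewrite PB -PA -PAB -Ex_indic; last exact: measurableI.
congr Ex; apply/funext => w; rewrite /mono /atom.
under eq_bigr do rewrite -natrM mulnb.
rewrite prod_bool_nat indicE; congr ((nat_of_bool _)%:R).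
apply/forall_inP/idP => [hw|/set_mem[hA hB] i iJ].
  apply/mem_set; split => i /= /hw /andP[/eqP]//.
  by rewrite in_itv/= andbT.
by have /= -> := hA i iJ; have := hB i iJ; rewrite /= in_itv/= andbT eqxx => ->.
Qed.

Lemma Ex_mono_indep (A J K : {set 'I_m}) h c h' c' : block_closed G A ->
  J \subset A -> K \subset ~: A ->
  Ex P (fun w => mono J h c w * mono K h' c' w) = Ex P (mono J h c) * Ex P (mono K h' c').
Proof.
move=> cA /fintype.subsetP JA /fintype.subsetP KA.
have KA' i : i \in K -> i \notin A by move=> /KA; rewrite inE.
have JK i : i \in J -> i \notin K by move=> /JA iA; apply: contraL iA => /KA'.
have prodU (F : 'I_m -> R) : \prod_(i in J :|: K) F i = (\prod_(i in J) F i) * \prod_(i in K) F i.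
  rewrite (bigID (fun i => i \in A))/=; congr (_ * _); apply: eq_bigl => i; rewrite !inE.
    have [iJ|iJ] := boolP (i \in J); first by rewrite JA.
    by have [/KA'/negbTE ->|] := boolP (i \in K).
  have [iJ|iJ] := boolP (i \in J); first by rewrite JA// (negbTE (JK _ iJ)).
  by have [/KA' ->|] := boolP (i \in K).
(* Splicing the parameters along [A] turns the product into a single monomial over J :|: K, to which
   [Ex_mono] applies. *)
pose h2 i := if i \in A then h i else h' i.
pose c2 i := if i \in A then c i else c' i.
have E w : mono J h c w * mono K h' c' w = mono (J :|: K) h2 c2 w.
  rewrite /mono prodU; congr (_ * _); apply: eq_bigr => i iJ; rewrite /atom /h2 /c2.
    by rewrite JA.
  by rewrite (negbTE (KA' _ iJ)).
under [in LHS]eq_fun do rewrite E.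
rewrite !Ex_mono (eps_ge_indep model _ _ cA).
rewrite (prodU (fun i => hprob (h2 i))) [RHS]mulrACA; congr (_ * _); [congr (_ * _)|congr (_ * _); congr (Ex _)].
- by apply: eq_bigr => i iJ; rewrite /h2 JA.
- by apply: eq_bigr => i iK; rewrite /h2 (negbTE (KA' _ iK)).
- apply/funext => w; apply: eq_big => i; rewrite inE.
    have [iJ|iJ] := boolP (i \in J); first by rewrite JA.
    by have [/KA'/negbTE ->|] := boolP (i \in K).
  by move=> /andP[_ iA]; rewrite /c2 iA.
- apply/funext => w; apply: eq_big => i; rewrite inE.
    have [iJ|iJ] := boolP (i \in J); first by rewrite JA// andbF (negbTE (JK _ iJ)).
    by have [/KA' ->|] := boolP (i \in K).
  by move=> /andP[_ /negbTE iA]; rewrite /c2 iA.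
Qed.

(** The functions of the observations in [A] that the proof needs. The product rule extends
    bilinearly from monomials, which replaces independence of sigma-algebras. *)
Inductive bspan (A : {set 'I_m}) : (T -> R) -> Prop :=
| bspan_mono (J : {set 'I_m}) h c : J \subset A -> bspan A (mono J h c)
| bspan_add u v : bspan A u -> bspan A v -> bspan A (fun w => u w + v w)
| bspan_scale (k : R) u : bspan A u -> bspan A (fun w => k * u w).

Lemma bm_bspan A u : bspan A u -> bounded_measurable u.
Proof.
elim=> [J h c _|v1 v2 _ h1 _ h2|k v _ h]; [exact: bm_mono|exact: bmD|exact: bmZ].
Qed.

Lemma bspan_cst A (k : R) : bspan A (fun=> k).
Proof.
have := bspan_scale k (@bspan_mono A finset.set0 (fun=> false) (fun=> 0) (finset.sub0set _)).
by under eq_fun do rewrite /mono big_set0 mulr1.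
Qed.

Lemma bspan_sub (A B : {set 'I_m}) u : A \subset B -> bspan A u -> bspan B u.
Proof.
move=> AB; elim=> [J h c JA|v1 v2 _ h1 _ h2|k v _ h].
- by apply: bspan_mono; exact: fintype.subset_trans AB.
- exact: bspan_add.
- exact: bspan_scale.
Qed.

Lemma Ex_bspan_indep (A B : {set 'I_m}) u v : block_closed G A -> B \subset ~: A ->
  bspan A u -> bspan B v -> Ex P (fun w => u w * v w) = Ex P u * Ex P v.
Proof.
move=> cA BA su sv.
have bv := bm_bspan sv.
elim: su => [J h c JA|v1 v2 s1 h1 s2 h2|k u1 s1 h1].
- elim: sv {bv} => [K h' c' KB|v1 v2 s1 h1 s2 h2|k v1 s1 h1].
  + by apply: (Ex_mono_indep _ _ _ _ cA) => //; exact: fintype.subset_trans BA.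
  + have b1 := bm_bspan s1; have b2 := bm_bspan s2; have b0 := bm_mono J h c.
    under [in LHS]eq_fun do rewrite mulrDr.
    by rewrite !ExD ?h1 ?h2 ?mulrDr//; exact: bmM.
  + have b1 := bm_bspan s1; have b0 := bm_mono J h c.
    under [in LHS]eq_fun do rewrite mulrCA.
    by rewrite !ExZ ?h1 1?mulrCA//; exact: bmM.
- have b1 := bm_bspan s1; have b2 := bm_bspan s2.
  under [in LHS]eq_fun do rewrite mulrDl.
  by rewrite !ExD ?h1 ?h2 ?mulrDl//; exact: bmM.
- have b1 := bm_bspan s1.
  under [in LHS]eq_fun do rewrite -mulrA.
  by rewrite !ExZ ?h1 ?mulrA//; exact: bmM.
Qed.

Lemma bspan_atom_mul (A : {set 'I_m}) i h c u : i \notin A -> bspan A u ->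
  bspan (i |: A) (fun w => atom h c i w * u w).
Proof.
move=> iA; elim=> [J h' c' JA|v1 v2 _ h1 _ h2|k v _ h1].
- pose h2 j := if j == i then h j else h' j.
  pose c2 j := if j == i then c j else c' j.
  have iJ : i \notin J by apply: contra iA; exact: (fintype.subsetP JA).
  have -> : (fun w => atom h c i w * mono J h' c' w) = mono (i |: J) h2 c2.
    apply/funext => w; rewrite /mono big_setU1//=; congr (_ * _).
      by rewrite /atom /h2 /c2 eqxx.
    apply: eq_bigr => j jJ; rewrite /atom /h2 /c2.
    by have [ji|//] := eqVneq j i; move: iJ; rewrite -ji jJ.
  by apply: bspan_mono; exact: finset.setUS.
- by under eq_fun do rewrite mulrDr; exact: bspan_add.
- by under eq_fun do rewrite mulrCA; exact: bspan_scale.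
Qed.

Lemma bspan_atom i h c : bspan [set i]%SET (atom h c i).
Proof.
have := @bspan_mono [set i]%SET [set i]%SET h c (fintype.subxx _).
by rewrite /mono; under eq_fun do rewrite big_set1.
Qed.

(* cos (a X + b) is affine in a 0-1 variable X. *)
Lemma bspan_cos (A : {set 'I_m}) h c (a b : R) :
  bspan A (fun w => cos (a * (\sum_(i in A) atom h c i w) + b)).
Proof.
have atom01 i w : atom h c i w = 0 \/ atom h c i w = 1.
  by rewrite /atom; case: (_ == _); case: (_ <= _); rewrite ?mulr0 ?mul0r ?mulr1; [right|left|left|left].
have : forall n (A : {set 'I_m}), #|A| = n -> forall b, bspan A (fun w => cos (a * (\sum_(i in A) atom h c i w) + b)).
  elim=> [|n ih] {}A cA {}b.
    have -> : A = finset.set0 by apply/eqP; rewrite -cards_eq0 cA.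
    by under eq_fun do rewrite big_set0; exact: bspan_cst.
  have [i iA] : exists i, i \in A by apply/finset.set0Pn; rewrite -card_gt0 cA.
  have iA' : i \notin A :\ i by rewrite !inE eqxx.
  have cA' : #|A :\ i| = n by have := cardsD1 i A; rewrite cA iA add1n => -[].
  have IH := ih _ cA'.
  have E w : cos (a * (\sum_(i in A) atom h c i w) + b) =
     cos (a * (\sum_(j in A :\ i) atom h c j w) + b) +
     (atom h c i w * (cos (a * (\sum_(j in A :\ i) atom h c j w) + (a + b)) + (-1) * cos (a * (\sum_(j in A :\ i) atom h c j w) + b))).
    rewrite (big_setD1 i)//=.
    have [->|->] := atom01 i w; first by rewrite mul0r add0r addr0.
    set u := \sum_(_ in _) _; have -> : a * (1 + u) + b = a * u + (a + b) by ring.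
    ring.
  under eq_fun do rewrite E.
  apply: bspan_add; first by apply: bspan_sub (IH b); exact: finset.subD1set.
  rewrite -{1}(finset.setD1K iA); apply: bspan_atom_mul => //.
  by apply: bspan_add => //; apply: bspan_scale.
by move=> /(_ _ A erefl b).
Qed.

End bspan.

Section pvalue.
Context {R : realType} {d} {T : measurableType d} (P : probability T R).
Context (m : nat) (H : 'I_m -> {RV P >-> bool}) (eps : 'I_m -> {RV P >-> R}).

Lemma measurable_pvalue mu i : measurable_fun setT (fun w => pvalue mu (H i w) (eps i w)).
Proof.
have mPhi : measurable_fun setT (@Phibar R).
  by apply: continuous_measurable_fun; exact: continuous_Phibar.
apply: (measurableT_comp mPhi); apply: measurable_funD => //; apply: measurable_funM => //.
have [mh _] := @bm_bool R _ _ (fun w => H i w == true) (measurable_H H i true).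
by under eq_fun do rewrite -[H i _]eqb_id.
Qed.

End pvalue.

(** * Taylor estimates *)

Section taylor.
Context {R : realType}.
Implicit Types x y a b : R.

(** The bounds below are obtained by integrating in turn: sin y <= y, then the lower bound on cos,
    the lower bound on sin and the upper bound on cos, with coarse constants. *)
Lemma ge0_of_derive (f f' : R -> R) y : (forall z : R, is_derive z 1 f (f' z)) ->
  f 0 = 0 -> (forall z, 0 <= z -> 0 <= f' z) -> 0 <= y -> 0 <= f y.
Proof.
move=> df f0 f'0; rewrite le_eqVlt => /predU1P[<-|y0]; first by rewrite f0.
have [c [c0 _ e]] := MVT_real y0 df.
by move: e; rewrite f0 !subr0 => ->; rewrite mulr_ge0 ?f'0// ltW.
Qed.

Lemma sin_le_id y : 0 <= y -> sin y <= y.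
Proof.
move=> y0; rewrite -subr_ge0; apply: (@ge0_of_derive (fun y => y - sin y) (fun y => 1 - cos y)) => //.
by rewrite sin0 subr0.
Qed.

Lemma is_derive_sqr_half y : is_derive y 1 (fun y : R => y ^+ 2 / 2) y.
Proof.
have := @is_deriveM R R id id y 1 1 1 (is_derive_id _ _) (is_derive_id _ _).
move=> /(@is_deriveZ _ _ _ _ 2^-1) h.
have -> : (fun y : R => y ^+ 2 / 2) = 2^-1 \*: (id * id : R -> R).
  by apply/funext => z; rewrite /= mulrC expr2.
by apply: (is_derive_eq h); rewrite /GRing.scale/=; field.
Qed.

Lemma cos_ge_quad y : 0 <= y -> 1 - y ^+ 2 / 2 <= cos y.
Proof.
move=> y0; rewrite -subr_ge0.
apply: (@ge0_of_derive (fun y => cos y - (1 - y ^+ 2 / 2)) (fun y => y - sin y)) => //.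
- move=> z; have h1 := @is_deriveB _ _ _ _ _ z 1 _ _ (is_derive_cst (1 : R) z 1) (is_derive_sqr_half z).
  have h2 := @is_deriveB _ _ _ _ _ z 1 _ _ (is_derive_cos z) h1.
  by apply: (is_derive_eq h2); ring.
- by rewrite cos0 expr0n/= mul0r subr0 subrr.
- by move=> z z0; rewrite subr_ge0 sin_le_id.
Qed.

Lemma sin_ge_cubic y : 0 <= y -> y - y ^+ 3 <= sin y.
Proof.
move=> y0; rewrite -subr_ge0.
apply: (@ge0_of_derive (fun y => sin y - (y - y ^+ 3)) (fun y => cos y - (1 - 3 * y ^+ 2))) => //.
- move=> z.
  have h0 : is_derive z 1 (fun y : R => y ^+ 3) (3 * z ^+ 2).
    have := @is_deriveM R R id (id * id) z 1 _ _ (is_derive_id _ _) (@is_deriveM R R id id z 1 1 1 (is_derive_id _ _) (is_derive_id _ _)).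
    have -> : (id * (id * id) : R -> R) = (fun y => y ^+ 3) by apply/funext => x; rewrite !exprS expr0 mulr1.
    by move=> h; apply: (is_derive_eq h); rewrite /GRing.scale/= !fctE /=; ring.
  have h1 := @is_deriveB _ _ _ _ _ z 1 _ _ (is_derive_id z 1) h0.
  exact: (@is_deriveB _ _ _ _ _ z 1 _ _ (is_derive_sin z) h1).
- by rewrite sin0 expr0n/= !subr0.
- move=> z z0; rewrite subr_ge0; apply: le_trans (cos_ge_quad z0).
  by have := sqr_ge0 z; lra.
Qed.

Lemma cos_le_quad y : 0 <= y -> cos y <= 1 - y ^+ 2 / 2 + y ^+ 4.
Proof.
move=> y0; rewrite -subr_ge0.
apply: (@ge0_of_derive (fun y => (1 - y ^+ 2 / 2 + y ^+ 4) - cos y) (fun y => (- y + 4 * y ^+ 3) + sin y)) => //.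
- move=> z.
  have h0 : is_derive z 1 (fun y : R => y ^+ 4) (4 * z ^+ 3).
    have h := @is_deriveM R R id id z 1 1 1 (is_derive_id _ _) (is_derive_id _ _).
    have := @is_deriveM R R (id * id) (id * id) z 1 _ _ h h.
    have -> : ((id * id) * (id * id) : R -> R) = (fun y => y ^+ 4) by apply/funext => x; rewrite !exprS expr0 mulr1 /= !mulrA.
    by move=> h'; apply: (is_derive_eq h'); rewrite /GRing.scale/= !fctE /=; ring.
  have h1 := @is_deriveB _ _ _ _ _ z 1 _ _ (is_derive_cst (1 : R) z 1) (is_derive_sqr_half z).
  have h2 := @is_deriveD _ _ _ _ _ z 1 _ _ h1 h0.
  have h3 := @is_deriveB _ _ _ _ _ z 1 _ _ h2 (is_derive_cos z).
  by apply: (is_derive_eq h3); ring.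
- by rewrite cos0 !expr0n/= mul0r subr0 addr0 subrr.
- move=> z z0; have := sin_ge_cubic z0; have : 0 <= z ^+ 3 by rewrite exprn_ge0.
  lra.
Qed.

Lemma cos_taylor y b : `|y| <= 1 ->
  `|cos (y + b) - (cos b - y * sin b - y ^+ 2 / 2 * cos b)| <= 2 * `|y| ^+ 3.
Proof.
move=> y1.
have h1 : `|cos y - (1 - y ^+ 2 / 2)| <= `|y| ^+ 3.
  rewrite -cos_norm -[y ^+ 2]real_normK ?num_real//.
  have := cos_ge_quad (normr_ge0 y); have := cos_le_quad (normr_ge0 y).
  move: `|y| (normr_ge0 y) y1 => z z0 z1 l u.
  rewrite ger0_norm ?subr_ge0//.
  have : z ^+ 4 <= z ^+ 3 by rewrite exprS ler_piMl// exprn_ge0.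
  lra.
have h2 : `|sin y - y| <= `|y| ^+ 3.
  have h3 (z : R) : 0 <= z -> `|sin z - z| <= z ^+ 3.
    move=> z0; have := sin_le_id z0; have := sin_ge_cubic z0 => l u.
    by rewrite ler0_norm ?subr_le0//; lra.
  have [y0|y0] := leP 0 y; first by rewrite (ger0_norm y0) h3.
  have := h3 (- y); rewrite oppr_ge0 sinN -opprD normrN => /(_ (ltW y0)).
  by rewrite (ltr0_norm y0).
have -> : cos (y + b) - (cos b - y * sin b - y ^+ 2 / 2 * cos b) =
   (cos y - (1 - y ^+ 2 / 2)) * cos b - (sin y - y) * sin b.
  by rewrite cosD; ring.
have -> : 2 * `|y| ^+ 3 = `|y| ^+ 3 + `|y| ^+ 3 by ring.
rewrite (le_trans (ler_normB _ _))// lerD// normrM.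
  by rewrite (le_trans _ h1)// ler_piMr// ler_norml cos_geN1 cos_le1.
by rewrite (le_trans _ h2)// ler_piMr// ler_norml sin_geN1 sin_le1.
Qed.

Lemma expRN_taylor x : 0 <= x -> `|expR (- x) - (1 - x)| <= x ^+ 2.
Proof.
move=> x0; have l := expR_ge1Dx (- x).
have u : expR (- x) <= (1 + x)^-1.
  by rewrite expRN lef_pV2 ?posrE ?expR_gt0 ?expR_ge1Dx// ltr_wpDr.
have h : (1 + x)^-1 <= 1 - x + x ^+ 2.
  rewrite -[leLHS]mul1r ler_pdivrMr ?ltr_wpDr//.
  have : 0 <= x ^+ 3 by rewrite exprn_ge0.
  have -> : (1 - x + x ^+ 2) * (1 + x) = 1 + x ^+ 3 by ring.
  lra.
by rewrite ger0_norm ?subr_ge0//; lra.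
Qed.

Context {d} {T : measurableType d} (P : probability T R).

(** Second order expansion of a bounded centred variable. Of the constant 3, the cosine remainder
    takes 2 and the replacement of 1 - x by exp (- x) takes 1, as x^2 <= (|a| s)^4 <= (|a| s)^3. *)
Lemma cf_estimate (Y : T -> R) (s v : R) : bounded_measurable Y -> (forall w, `|Y w| <= s) ->
  Ex P Y = 0 -> Ex P (fun w => Y w ^+ 2) = v -> forall a b, `|a| * s <= 1 ->
  `|Ex P (fun w => cos (a * Y w + b)) - expR (- (a ^+ 2 * v / 2)) * cos b| <= 3 * (`|a| * s) ^+ 3.
Proof.
move=> bY Ys EY EY2 a b as1.
have [w0] : inhabited T by exact: (inhabits point).
have s0 : 0 <= s by exact: le_trans (Ys w0).
have bY2 : bounded_measurable (fun w => Y w ^+ 2) by exact: bmX.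
have aY w : `|a * Y w| <= `|a| * s by rewrite normrM ler_wpM2l.
have v0 : 0 <= v by rewrite -EY2; apply: Ex_ge0 => w; exact: sqr_ge0.
have vs : v <= s ^+ 2.
  rewrite -EY2 -[leRHS](Ex_cst P); apply: le_Ex => //; first exact: bm_cst.
  by move=> w; rewrite -real_normK ?num_real// lerXn2r ?nnegrE.
set x := a ^+ 2 * v / 2.
have x0 : 0 <= x by rewrite divr_ge0// mulr_ge0// sqr_ge0.
have bq : bounded_measurable (fun w => cos b - a * Y w * sin b - (a * Y w) ^+ 2 / 2 * cos b).
  apply: bmB; first apply: bmB; first exact: bm_cst.
    by apply: bmM; [exact: bmZ|exact: bm_cst].
  by apply: bmM; [apply: bmM; [apply: bmX; exact: bmZ|exact: bm_cst]|exact: bm_cst].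
have bc : bounded_measurable (fun w => cos (a * Y w + b)).
  by apply: bm_cos; apply: measurable_funD => //; apply: measurable_funM => //; case: bY.
have E1 : Ex P (fun w => cos b - a * Y w * sin b - (a * Y w) ^+ 2 / 2 * cos b) = (1 - x) * cos b.
  rewrite (_ : (fun w => _) = (fun w => cos b - ((a * sin b) * Y w + (a ^+ 2 / 2 * cos b) * Y w ^+ 2))); last first.
    by apply/funext => w; ring.
  have b1 := bmZ (a * sin b) bY; have b2 := bmZ (a ^+ 2 / 2 * cos b) bY2.
  rewrite ExB ?Ex_cst; [|exact: bm_cst|exact: bmD].
  by rewrite ExD// !ExZ// EY EY2 /x; ring.
have h1 : `|Ex P (fun w => cos (a * Y w + b)) - (1 - x) * cos b| <= 2 * (`|a| * s) ^+ 3.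
  rewrite -E1 -ExB//; apply: normr_Ex_le; first exact: bmB.
  move=> w; apply: (le_trans (cos_taylor b (le_trans (aY w) as1))).
  by rewrite ler_pM2l// lerXn2r ?nnegrE ?mulr_ge0.
have h2 : `|(1 - x) * cos b - expR (- x) * cos b| <= (`|a| * s) ^+ 3.
  rewrite -mulrBl normrM (@le_trans _ _ `|1 - x - expR (- x)|)//.
    by rewrite ler_piMr// ler_norml cos_geN1 cos_le1.
  rewrite distrC (le_trans (expRN_taylor x0))//.
  have xs : x <= (`|a| * s) ^+ 2.
    rewrite /x exprMn real_normK ?num_real//.
    rewrite (@le_trans _ _ (a ^+ 2 * v))//; last by rewrite ler_wpM2l ?sqr_ge0.
    have : 0 <= a ^+ 2 * v by rewrite mulr_ge0// sqr_ge0.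
    lra.
  have as0 : 0 <= `|a| * s by rewrite mulr_ge0.
  apply: (@le_trans _ _ ((`|a| * s) ^+ 4)).
    by rewrite (_ : 4%N = (2 * 2)%N)// exprM lerXn2r ?nnegrE ?exprn_ge0.
  by rewrite [leLHS]exprS ler_piMl// exprn_ge0.
rewrite -(subrK ((1 - x) * cos b) (Ex P _)) -addrA.
apply: (le_trans (ler_normD _ _)).
have -> : 3 * (`|a| * s) ^+ 3 = 2 * (`|a| * s) ^+ 3 + (`|a| * s) ^+ 3 by ring.
exact: lerD.
Qed.

End taylor.

(** * Central limit theorem for the null counts *)

Lemma sum_blocks (sB n : nat) (F : nat -> nat) :
  (\sum_(0 <= j < n * sB) F j = \sum_(0 <= b < n) \sum_(0 <= r < sB) F (b * sB + r))%N.
Proof.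
elim: n => [|n ih]; first by rewrite !big_geq.
rewrite big_nat_recr//= -ih (@big_cat_nat _ _ _ (n * sB)%N)//=; last by rewrite leq_mul2r leqnSn orbT.
congr (_ + _)%N; rewrite -{1}[(n * sB)%N]add0n big_addn mulSn addnK.
by apply: eq_big_nat => r _; rewrite addnC.
Qed.

Lemma card_block (sB n k : nat) : (0 < sB)%N ->
  (\sum_(j < n * sB) (j %/ sB == k) = if k < n then sB else 0)%N.
Proof.
move=> s0; rewrite -(big_mkord xpredT (fun j : nat => ((j %/ sB == k)%N : nat))) sum_blocks.
rewrite (eq_big_nat _ _ (F2 := fun b : nat => if b == k then sB else 0%N)); last first.
  move=> b _; rewrite (eq_big_nat _ _ (F2 := fun=> (b == k : nat))).
    by rewrite sum_nat_const_nat subn0; case: (b == k); rewrite ?muln1 ?muln0.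
  by move=> r /andP[_ rs]; rewrite divnMDl// divn_small// addn0.
rewrite big_mkord; have [kn|kn] := ltnP k n.
  rewrite (bigD1 (Ordinal kn))//= eqxx big1 ?addn0// => i /eqP ik.
  by case: eqP => // e; case: ik; apply: val_inj.
by rewrite big1// => i _; case: eqP => // e; move: kn; rewrite -e leqNgt ltn_ord.
Qed.

Section second_moment.
Context {R : realType} {d} {T : measurableType d} (P : probability T R).
Context {n sB : nat} (s0 : (0 < sB)%N).
Local Notation m := (n * sB)%N.

(** Each index has nonzero cross moments with at most the sB indices of its block, and 2 Z_i Z_j <=
    Z_i^2 + Z_j^2. *)
Lemma sum_sqr_le (Z : 'I_m -> T -> R) (v : R) : 0 <= v ->
  (forall i, bounded_measurable (Z i)) ->
  (forall i j : 'I_m, (i %/ sB != j %/ sB)%N -> Ex P (fun w => Z i w * Z j w) = 0) ->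
  (forall i, Ex P (fun w => Z i w ^+ 2) <= v) ->
  Ex P (fun w => (\sum_i Z i w) ^+ 2) <= m%:R * sB%:R * v.
Proof.
move=> v0 bZ Z0 Zv.
under eq_fun do rewrite expr2 mulr_suml.
under [X in Ex _ X]eq_fun do under eq_bigr do rewrite mulr_sumr.
have bZZ i j : bounded_measurable (fun w => Z i w * Z j w) by exact: bmM.
rewrite Ex_sum; last by move=> i; apply: bm_sum => j; exact: bZZ.
have h i : Ex P (fun w => \sum_j Z i w * Z j w) <= sB%:R * v.
  rewrite Ex_sum; last by move=> j; exact: bZZ.
  apply: (@le_trans _ _ (\sum_(j < m) ((j %/ sB == i %/ sB)%N)%:R * v)).
    apply: ler_sum => j _; have [ij|ij] := eqVneq (j %/ sB)%N (i %/ sB)%N; last first.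
      by rewrite Z0 1?eq_sym// mul0r.
    rewrite mul1r (@le_trans _ _ (Ex P (fun w => 2^-1 * (Z i w ^+ 2 + Z j w ^+ 2))))//.
      apply: le_Ex; [exact: bZZ|by apply: bmZ; apply: bmD; exact: bmX|move=> w].
      by have := sqr_ge0 (Z i w - Z j w); nra.
    rewrite ExZ; last by apply: bmD; exact: bmX.
    rewrite ExD; [|exact: bmX|exact: bmX].
    by have := Zv i; have := Zv j; lra.
  rewrite -mulr_suml ler_wpM2r// -natr_sum ler_nat card_block//.
  by case: ifP.
apply: (@le_trans _ _ (\sum_(i < m) sB%:R * v)); first by apply: ler_sum => i _; exact: h.
by rewrite sumr_const card_ord -[X in X <= _]mulr_natl mulrA lexx.
Qed.

End second_moment.

Section block_model.
Context {R : realType} {d} {T : measurableType d} (P : probability T R).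
Context {n sB : nat} (s0 : (0 < sB)%N).
Local Notation m := (n * sB)%N.
Context (mu pi1 rho : R) (H : 'I_m -> {RV P >-> bool}) (eps : 'I_m -> {RV P >-> R}).
Hypothesis pi01 : 0 < pi1 < 1.
Hypothesis rho1 : -1 <= rho <= 1.
Hypothesis model : two_group_model pi1 (block_correlation m sB rho) H eps.

Let G : 'M[R]_m := block_correlation m sB rho.

Lemma block_closedP (Q : pred nat) : block_closed G [set i : 'I_m | Q (i %/ sB)%N]%SET.
Proof.
move=> i j; rewrite !inE => Qi Qj; rewrite mxE.
have [ij|_] := eqVneq i j; first by rewrite -ij Qi in Qj.
by case: eqP => // e; rewrite -e Qi in Qj.
Qed.

Lemma Ex_atom h c i : Ex P (atom H eps h c i) = hprob pi1 (h i) * Phibar (c i).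
Proof.
have -> : atom H eps h c i = mono H eps [set i]%SET h c.
  by apply/funext => w; rewrite /mono big_set1.
rewrite (Ex_mono pi01 model) big_set1; congr (_ * _).
under eq_fun do rewrite big_set1.
by rewrite Ex_bool ?(eps_ge_prob model)//; exact: measurable_ge.
Qed.

Definition pval i w := pvalue mu (H i w) (eps i w).

Definition null_ind t i w : R := ((pval i w <= t) && ~~ H i w)%:R.
Definition below_ind t i w : R := (pval i w <= t)%R%:R.

Lemma null_indE t i w : 0 < t < 1 -> null_ind t i w = atom H eps (fun=> false) (fun=> quant t) i w.
Proof.
move=> t01; rewrite /null_ind /atom /pval /pvalue; case: (H i w) => /=; first by rewrite andbF mul0r.
by rewrite andbT mulr0 add0r Phibar_le_quant// mul1r.
Qed.

Lemma below_indE t i w : 0 < t < 1 -> below_ind t i w =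
  atom H eps (fun=> false) (fun=> quant t) i w + atom H eps (fun=> true) (fun=> quant t - mu) i w.
Proof.
move=> t01; rewrite /below_ind /atom /pval /pvalue Phibar_le_quant//; case: (H i w) => /=.
  by rewrite mul0r add0r mul1r mulr1 lerBlDl.
by rewrite mul0r addr0 mul1r mulr0 add0r.
Qed.

Lemma bspan_null_ind t i : 0 < t < 1 -> bspan H eps [set i]%SET (null_ind t i).
Proof. move=> t01; rewrite (_ : null_ind t i = atom H eps (fun=> false) (fun=> quant t) i).
  exact: bspan_atom.
by apply/funext => w; exact: null_indE. Qed.

Lemma bspan_below_ind t i : 0 < t < 1 -> bspan H eps [set i]%SET (below_ind t i).
Proof.
move=> t01; rewrite (_ : below_ind t i = (fun w => atom H eps (fun=> false) (fun=> quant t) i w +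
    atom H eps (fun=> true) (fun=> quant t - mu) i w)); last by apply/funext => w; exact: below_indE.
by apply: bspan_add; exact: bspan_atom.
Qed.

Lemma Ex_null_ind t i : 0 < t < 1 -> Ex P (null_ind t i) = (1 - pi1) * t.
Proof.
move=> t01; rewrite (_ : null_ind t i = atom H eps (fun=> false) (fun=> quant t) i); last by apply/funext => w; exact: null_indE.
by rewrite Ex_atom/= Phibar_quant.
Qed.

Lemma Ex_below_ind t i : 0 < t < 1 -> Ex P (below_ind t i) = rej_prob mu pi1 t.
Proof.
move=> t01; rewrite (_ : below_ind t i = (fun w => atom H eps (fun=> false) (fun=> quant t) i w +
    atom H eps (fun=> true) (fun=> quant t - mu) i w)); last by apply/funext => w; exact: below_indE.
rewrite ExD; [|exact: bm_atom|exact: bm_atom].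
by rewrite !Ex_atom/= Phibar_quant.
Qed.

Lemma bspan_uncorr (i j : 'I_m) u v : (i %/ sB != j %/ sB)%N -> bspan H eps [set i]%SET u -> bspan H eps [set j]%SET v ->
  Ex P (fun w => u w * v w) = Ex P u * Ex P v.
Proof.
move=> ij su sv; apply: (Ex_bspan_indep pi01 model (@block_closedP (fun k => k == i %/ sB)%N) _ _ sv).
  by rewrite finset.sub1set !inE eq_sym.
by apply: bspan_sub su; rewrite finset.sub1set !inE.
Qed.

Lemma centered_sum_sqr (u : 'I_m -> T -> R) (e v : R) : 0 <= v ->
  (forall i, bspan H eps [set i]%SET (u i)) -> (forall i, Ex P (u i) = e) ->
  (forall i, Ex P (fun w => u i w ^+ 2) <= v) ->
  Ex P (fun w => (\sum_i (u i w - e)) ^+ 2) <= m%:R * sB%:R * v.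
Proof.
move=> v0 su Eu uv; have bu i := bm_bspan (su i).
apply: sum_sqr_le => //.
- by move=> i; apply: bmB => //; exact: bm_cst.
- move=> i j ij.
  have c k : bspan H eps [set k]%SET (fun w => u k w - e).
    by apply: bspan_add => //; exact: bspan_cst.
  rewrite (bspan_uncorr ij (c i) (c j)) ExB ?Eu ?Ex_cst ?subrr ?mul0r//; exact: bm_cst.
- move=> i; rewrite (le_trans _ (uv i))//.
  have E w : (u i w - e) ^+ 2 = u i w ^+ 2 - (2 * e * u i w - e ^+ 2) by ring.
  under eq_fun do rewrite E.
  have b1 := bmX 2 (bu i); have b2 := bmZ (2 * e) (bu i); have b3 := bm_cst (e ^+ 2) : bounded_measurable (fun _ : T => e ^+ 2).
  rewrite ExB//; last exact: bmB.
  rewrite ExB// ExZ// Ex_cst Eu; have := sqr_ge0 e; lra.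
Qed.

Lemma below_sum_sqr t : 0 < t < 1 ->
  Ex P (fun w => (\sum_i (below_ind t i w - rej_prob mu pi1 t)) ^+ 2) <= m%:R * sB%:R.
Proof.
move=> t01; rewrite -[leRHS]mulr1; apply: centered_sum_sqr => //.
- by move=> i; exact: bspan_below_ind.
- by move=> i; exact: Ex_below_ind.
- move=> i; rewrite -[leRHS](Ex_cst P); apply: le_Ex.
  + by apply: bmX; exact: (bm_bspan (bspan_below_ind i t01)).
  + exact: bm_cst.
  + by move=> w; rewrite /below_ind; case: (pval i w <= t); rewrite /= ?expr1n ?expr0n ?ler01 ?lexx.
Qed.

Lemma null_sum_sqr t : 0 < t < 1 ->
  Ex P (fun w => (\sum_i (null_ind t i w - (1 - pi1) * t)) ^+ 2) <= m%:R * sB%:R.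
Proof.
move=> t01; rewrite -[leRHS]mulr1; apply: centered_sum_sqr => //.
- by move=> i; exact: bspan_null_ind.
- by move=> i; exact: Ex_null_ind.
- move=> i; rewrite -[leRHS](Ex_cst P); apply: le_Ex.
  + by apply: bmX; exact: (bm_bspan (bspan_null_ind i t01)).
  + exact: bm_cst.
  + by move=> w; rewrite /null_ind; case: (_ && _); rewrite /= ?expr1n ?expr0n ?ler01 ?lexx.
Qed.

(** The increment is a 0-1 variable, so its second moment is its mean, of order t - s. This factor
    compensates for the number of fine grid points. *)
Lemma null_incr_sqr s t : 0 < s < 1 -> 0 < t < 1 -> s <= t ->
  Ex P (fun w => (\sum_i (null_ind t i w - null_ind s i w - (1 - pi1) * (t - s))) ^+ 2) <= m%:R * sB%:R * (t - s).
Proof.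
move=> s01 t01 st; have bB u i (u01 : 0 < u < 1) := bm_bspan (bspan_null_ind i u01).
have E i : Ex P (fun w => null_ind t i w - null_ind s i w) = (1 - pi1) * (t - s).
  by rewrite ExB ?Ex_null_ind// ?mulrBr//; exact: bB.
apply: centered_sum_sqr => //; first by rewrite subr_ge0.
- move=> i; apply: bspan_add; first exact: bspan_null_ind.
  by under eq_fun do rewrite -mulN1r; apply: bspan_scale; exact: bspan_null_ind.
- move=> i; apply: (@le_trans _ _ ((1 - pi1) * (t - s))); last first.
    by rewrite ler_piMl ?subr_ge0// gerBl; case/andP: pi01 => /ltW.
  rewrite -(E i); apply: le_Ex.
  + by apply: bmX; apply: bmB; exact: bB.
  + by apply: bmB; exact: bB.
  + move=> w; rewrite /null_ind; case: (~~ _); rewrite ?andbF ?andbT; last by rewrite subrr expr0n.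
    have [h|h] := boolP (pval i w <= s); first by rewrite (le_trans h st) subrr expr0n.
    by case: (pval i w <= t); rewrite subr0 ?expr1n ?expr0n.
Qed.

Section clt.
Variable tau : R.
Hypothesis tau01 : 0 < tau < 1.
Let p := (1 - pi1) * tau.
Let Z i w := null_ind tau i w - p.
(** The variance of a block sum divided by [sB]: the own variance of an index plus its covariances
    with the sB - 1 others in its block. *)
Definition block_var : R := p - p ^+ 2 + (sB%:R - 1) * ((1 - pi1) ^+ 2 * rho_tilde tau tau rho).

Let bB i : bounded_measurable (null_ind tau i). Proof. exact: (bm_bspan (bspan_null_ind i tau01)). Qed.
Let bZ i : bounded_measurable (Z i). Proof. by apply: bmB => //; exact: bm_cst. Qed.
Let EZ i : Ex P (Z i) = 0.
Proof. by rewrite ExB ?Ex_cst ?Ex_null_ind ?subrr//; exact: bm_cst. Qed.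

Let Ex_ZZ i j : Ex P (fun w => Z i w * Z j w) = Ex P (fun w => null_ind tau i w * null_ind tau j w) - p ^+ 2.
Proof.
have E w : Z i w * Z j w = null_ind tau i w * null_ind tau j w - (p * null_ind tau i w + p * null_ind tau j w - p ^+ 2) by rewrite /Z; ring.
under eq_fun do rewrite E.
have b1 := bmM (bB i) (bB j); have b2 := bmZ p (bB i); have b3 := bmZ p (bB j).
have b4 : bounded_measurable (fun _ : T => p ^+ 2) by exact: bm_cst.
have b5 := bmD b2 b3.
have b6 := bmM (bB i) (bB j).
rewrite (ExB P b6 (bmB b5 b4)) (ExB P b5 b4) (ExD P b2 b3) (ExZ P p (bB i)) (ExZ P p (bB j)).
rewrite Ex_cst !Ex_null_ind// -/p; ring.
Qed.

Let Ex_ZZ_same i : Ex P (fun w => Z i w * Z i w) = p - p ^+ 2.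
Proof.
rewrite Ex_ZZ; congr (_ - _); transitivity (Ex P (null_ind tau i)); last exact: Ex_null_ind.
congr Ex; apply/funext => w.
by rewrite /null_ind; case: (_ && _); rewrite /= ?mulr1 ?mulr0.
Qed.

Let Ex_ZZ_block (i j : 'I_m) : i != j -> (i %/ sB = j %/ sB)%N ->
  Ex P (fun w => Z i w * Z j w) = (1 - pi1) ^+ 2 * rho_tilde tau tau rho.
Proof.
move=> ij blk; rewrite Ex_ZZ.
have E w : null_ind tau i w * null_ind tau j w = mono H eps [set i; j]%SET (fun=> false) (fun=> quant tau) w.
  by rewrite /mono big_setU1/= ?inE// big_set1 !null_indE.
under eq_fun do rewrite E.
rewrite (Ex_mono pi01 model) !big_setU1/= ?inE// !big_set1.
under [X in Ex _ X]eq_fun do rewrite big_setU1/= ?inE// big_set1.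
have Gij : G i j = rho by rewrite mxE (negbTE ij) blk eqxx.
rewrite (eps_pair_prob model _ rho1 ij Gij) /hprob /rho_tilde.
have [c hc] := Phibar_surj tau01.
have -> : [set z | (Phibar_inv tau <= z.1%:E)%E /\ (Phibar_inv tau <= z.2%:E)%E] = [set z : R * R | quant tau <= z.1 /\ quant tau <= z.2].
  by rewrite -hc quantK; apply/funext => z /=; rewrite Phibar_invK !lee_fin.
rewrite /p; ring.
Qed.

Definition block_sum k w : R := \sum_(i < m | (i %/ sB == k)%N) Z i w.
Definition block_psum k w : R := \sum_(i < m | (i %/ sB < k)%N) Z i w.

Let bm_block k : bounded_measurable (block_sum k).
Proof. by apply: bm_sum => i; exact: bZ. Qed.

Let card_blk k : (k < n)%N -> \sum_(i < m | (i %/ sB == k)%N) (1 : R) = sB%:R.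
Proof.
move=> kn; have h := @card_block sB n k s0; rewrite kn in h; rewrite -[in RHS]h.
rewrite natr_sum big_mkcond; apply: eq_bigr => i _.
by case: (_ == _).
Qed.

Let Ex_block k : Ex P (block_sum k) = 0.
Proof. by rewrite Ex_sum// big1// => i _; exact: EZ. Qed.

Let block_le k w : (k < n)%N -> `|block_sum k w| <= sB%:R.
Proof.
move=> kn; rewrite (le_trans (ler_norm_sum _ _ _))// -(card_blk kn); apply: ler_sum => i _.
have p0 : 0 <= p <= 1.
  case/andP: tau01 => t0 t1; case/andP: pi01 => q0 q1.
  by rewrite /p mulr_ge0 ?(ltW t0) ?subr_ge0 ?(ltW q1)//= mulr_ile1 ?(ltW t0) ?(ltW t1) ?subr_ge0 ?(ltW q1)// gerBl ltW.
rewrite /Z /null_ind; case: (_ && _) => /=; first by rewrite ger0_norm; lra.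
by rewrite sub0r normrN ger0_norm; lra.
Qed.

Let Ex_block_sqr k : (k < n)%N -> Ex P (fun w => block_sum k w ^+ 2) = sB%:R * block_var.
Proof.
move=> kn; under eq_fun do rewrite expr2 mulr_suml.
under [X in Ex _ X]eq_fun do under eq_bigr do rewrite mulr_sumr.
have bZZ i j : bounded_measurable (fun w => Z i w * Z j w) by exact: bmM.
rewrite Ex_sum; last by move=> i; apply: bm_sum => j; exact: bZZ.
rewrite (eq_bigr (fun=> block_var)); last first.
  move=> i /eqP ik; rewrite Ex_sum; last by move=> j; exact: bZZ.
  rewrite (bigD1 i)/= ?ik// Ex_ZZ_same /block_var; congr (_ + _).
  rewrite (eq_bigr (fun=> (1 - pi1) ^+ 2 * rho_tilde tau tau rho)); last first.
    by move=> j /andP[/eqP jk ji]; rewrite Ex_ZZ_block 1?eq_sym// ik jk.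
  have := card_blk kn; rewrite (bigD1 i)/= ?ik// => h.
  rewrite (eq_bigr (fun=> 1 * ((1 - pi1) ^+ 2 * rho_tilde tau tau rho))); last by move=> j _; rewrite mul1r.
  by rewrite -mulr_suml; congr (_ * _); rewrite -h; ring.
rewrite (eq_bigr (fun=> 1 * block_var)); last by move=> j _; rewrite mul1r.
by rewrite -mulr_suml card_blk.
Qed.

Lemma block_var_ge0 : (0 < n)%N -> 0 <= block_var.
Proof.
move=> n0; have h := Ex_block_sqr n0.
have : 0 <= sB%:R * block_var by rewrite -h; apply: Ex_ge0 => w; exact: sqr_ge0.
by rewrite pmulr_rge0// ltr0n.
Qed.

Let sumZE (Q : pred 'I_m) a b w : a * (\sum_(i < m | Q i) Z i w) + b =
  a * (\sum_(i in [set i | Q i]%SET) atom H eps (fun=> false) (fun=> quant tau) i w) +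
  (b - a * (\sum_(i < m | Q i) p)).
Proof.
rewrite /Z sumrB mulrBr (eq_bigr (fun i => atom H eps (fun=> false) (fun=> quant tau) i w)); last first.
  by move=> i _; exact: null_indE.
rewrite [in RHS](eq_bigl (fun i => Q i)); last by move=> i; rewrite inE.
ring.
Qed.

Let psumS k w : block_psum k.+1 w = block_psum k w + block_sum k w.
Proof.
rewrite /block_psum /block_sum (bigID (fun i : 'I_m => (i %/ sB < k)%N))/=; congr (_ + _);
  apply: eq_bigl => i; rewrite ltnS.
  by case: (ltnP _ k) => h; rewrite ?andbF// (ltnW h).
by rewrite -leqNgt andbC -eqn_leq eq_sym.
Qed.

(** Blocks are added one at a time, each multiplying the characteristic function by the normal
    factor [e]. The cosine and the sine of the new block cost 3 (|a| sB)^3 each, and as the other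
    factors are at most 1 in absolute value the errors add. *)
Lemma clt_estimate a : `|a| * sB%:R <= 1 -> forall k, (k <= n)%N -> forall b,
  `|Ex P (fun w => cos (a * block_psum k w + b)) - expR (- (a ^+ 2 * (sB%:R * block_var) / 2)) ^+ k * cos b|
   <= k%:R * (6 * (`|a| * sB%:R) ^+ 3).
Proof.
move=> as1; set e := expR _; set eta := 6 * _.
have bcos (Q : pred 'I_m) b : bspan H eps [set i | Q i]%SET (fun w => cos (a * (\sum_(i < m | Q i) Z i w) + b)).
  rewrite (_ : (fun w => cos _) = (fun w => cos (a *
    (\sum_(i in [set i | Q i]%SET) atom H eps (fun=> false) (fun=> quant tau) i w) +
    (b - a * (\sum_(i < m | Q i) p))))); first exact: bspan_cos.
  by apply/funext => w; rewrite sumZE.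
elim=> [_ b|k ih kn b].
  rewrite mul0r expr0 mul1r.
  under eq_fun do rewrite /block_psum big_pred0 ?mulr0 ?add0r//.
  by rewrite Ex_cst subrr normr0.
have kn' : (k < n)%N by [].
have E w : cos (a * block_psum k.+1 w + b) =
   cos (a * block_psum k w + b) * cos (a * block_sum k w + 0) -
   cos (a * block_psum k w + (b - pi / 2)) * cos (a * block_sum k w + (- (pi / 2))).
  rewrite psumS addr0 addrA !cosBpihalf -cosD; congr cos; ring.
have s1 b' := bcos (fun i : 'I_m => (i %/ sB < k)%N) b'.
have s2 b' := bcos (fun i : 'I_m => (i %/ sB == k)%N) b'.
have ind b' b'' : Ex P (fun w => cos (a * block_psum k w + b') * cos (a * block_sum k w + b'')) =
    Ex P (fun w => cos (a * block_psum k w + b')) * Ex P (fun w => cos (a * block_sum k w + b'')).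
  apply: (Ex_bspan_indep pi01 model (@block_closedP (fun j => j < k)%N) _ (s1 b') (s2 b'')).
  by apply/fintype.subsetP => i; rewrite !inE => /eqP ->; rewrite ltnn.
rewrite (_ : Ex P _ = Ex P (fun w => cos (a * block_psum k w + b)) * Ex P (fun w => cos (a * block_sum k w + 0))
   - Ex P (fun w => cos (a * block_psum k w + (b - pi / 2))) * Ex P (fun w => cos (a * block_sum k w + (- (pi / 2))))); last first.
  rewrite -!ind -ExB.
  - by congr Ex; apply/funext => w; exact: E.
  - by apply: bmM; [exact: (bm_bspan (s1 _))|exact: (bm_bspan (s2 _))].
  - by apply: bmM; [exact: (bm_bspan (s1 _))|exact: (bm_bspan (s2 _))].
have cf := cf_estimate (bm_block k) (fun w => block_le w kn') (Ex_block k) (Ex_block_sqr kn').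
have f1 := cf a 0 as1; have f2 := cf a (- (pi / 2)) as1.
rewrite -/e cos0 mulr1 in f1; rewrite -/e cosN cos_pihalf mulr0 subr0 in f2.
have IH := ih (ltnW kn) b.
have c1 b' : `|Ex P (fun w => cos (a * block_psum k w + b'))| <= 1.
  apply: normr_Ex_le; first exact: (bm_bspan (s1 _)).
  by move=> w; rewrite ler_norml cos_geN1 cos_le1.
have e01 : 0 <= e <= 1.
  have bv := block_var_ge0 (leq_ltn_trans (leq0n _) kn').
  rewrite expR_ge0 /= -[leRHS]expR0 ler_expR oppr_le0 divr_ge0//.
  by apply: mulr_ge0; [exact: sqr_ge0|apply: mulr_ge0].
move: f1 f2 IH (c1 b) (c1 (b - pi / 2)).
set C1 := Ex P _; set C2 := Ex P _; set C3 := Ex P _; set C4 := Ex P _ => f1 f2 IH h1 h2.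
have -> : C3 * C1 - C4 * C2 - e ^+ k.+1 * cos b = C3 * (C1 - e) - C4 * C2 + e * (C3 - e ^+ k * cos b).
  by rewrite exprS; ring.
rewrite (le_trans (ler_normD _ _))//.
have -> : k.+1%:R * eta = (3 * (`|a| * sB%:R) ^+ 3 + 3 * (`|a| * sB%:R) ^+ 3) + k%:R * eta.
  by rewrite -natr1 /eta; ring.
apply: lerD; last first.
  rewrite normrM (le_trans _ IH)// ler_piMl// ger0_norm; by case/andP: e01.
rewrite (le_trans (ler_normB _ _))// lerD// normrM.
  by rewrite (le_trans _ f1)// ler_piMl.
by rewrite (le_trans _ f2)// ler_piMl.
Qed.

Lemma block_psum_all w : block_psum n w = \sum_i Z i w.
Proof.
rewrite /block_psum; apply: eq_bigl => i; apply/esym.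
by rewrite ltn_divLR// ltn_ord.
Qed.

Lemma clt_cos a b : `|a| * sB%:R <= Num.sqrt m%:R -> (0 < n)%N ->
  `|Ex P (fun w => cos (a * (\sum_i (null_ind tau i w - (1 - pi1) * tau) / Num.sqrt m%:R) + b))
     - expR (- (a ^+ 2 * block_var / 2)) * cos b|
   <= 6 * (`|a| * sB%:R) ^+ 3 / Num.sqrt m%:R.
Proof.
move=> am n0; have m0 : 0 < m%:R :> R by rewrite ltr0n muln_gt0 n0.
have r0 : 0 < Num.sqrt m%:R :> R by rewrite sqrtr_gt0.
set r := Num.sqrt _ in am r0 *.
have r2 : r ^+ 2 = m%:R by rewrite sqr_sqrtr// ltW.
have a1 : `|a / r| * sB%:R <= 1.
  by rewrite normf_div (gtr0_norm r0) mulrAC ler_pdivrMr// mul1r.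
have := clt_estimate a1 (leqnn n) b.
rewrite -expRM_natl.
have -> : n%:R * - ((a / r) ^+ 2 * (sB%:R * block_var) / 2) = - (a ^+ 2 * block_var / 2).
  have -> : (a / r) ^+ 2 = a ^+ 2 / m%:R by rewrite expr_div_n r2.
  rewrite natrM; field; rewrite !gt_eqF ?ltr0n//.
have E w : a / r * block_psum n w + b = a * (\sum_i (null_ind tau i w - (1 - pi1) * tau) / r) + b.
  by rewrite block_psum_all -mulr_suml /Z /p; ring.
under [X in `|Ex P X - _|]eq_fun do rewrite E.
move=> h; apply: (le_trans h).
rewrite normf_div (gtr0_norm r0).
have -> : n%:R * (6 * (`|a| / r * sB%:R) ^+ 3) = 6 * (`|a| * sB%:R) ^+ 3 / r * (n%:R / m%:R).
  by rewrite -r2; field; rewrite gt_eqF.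
rewrite ler_piMr// ?divr_ge0 ?mulr_ge0 ?exprn_ge0 ?mulr_ge0 ?(ltW r0)//.
by rewrite ler_pdivrMr// mul1r ler_nat leq_pmulr.
Qed.

End clt.

End block_model.

(** * Localization of the threshold *)

Section deterministic.
Context {R : realType}.
Implicit Types x h q t T tau : R.

Lemma grid_cell x0 h x K : (0 < K)%N -> x0 <= x -> x <= x0 + K%:R * h ->
  exists2 k, (k < K)%N & x0 + k%:R * h <= x /\ x <= x0 + k.+1%:R * h.
Proof.
elim: K => // K ih _ x0x xK.
have [K0|K0] := posnP K.
  by exists 0%N => //; move: xK; rewrite K0 mul0r addr0.
have [xl|xl] := leP x (x0 + K%:R * h).
  by have [k kK hk] := ih K0 x0x xl; exists k => //; exact: ltnW.
by exists K => //; split => //; exact: ltW.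
Qed.

(** Used with A = W(T) and B = W(tau). The difference splits into q / T (A - B) and the change of q
    / T times B, and T >= tau / 2 bounds the coefficients. *)
Lemma ratio_dev q T tau (A B a L delta : R) : 0 < q <= 1 -> 0 < tau -> delta <= tau / 2 ->
  `|T - tau| <= delta -> `|A - B| <= a -> `|B| <= L ->
  `|q / T * A - q / tau * B| <= 2 / tau * a + 2 / tau ^+ 2 * (delta * L).
Proof.
move=> /andP[q0 q1] tau0 dt Td AB BL.
have T0 : tau / 2 <= T by move: Td; rewrite ler_norml => /andP[h _]; lra.
have T1 : 0 < T by apply: lt_le_trans T0; rewrite divr_gt0.
have -> : q / T * A - q / tau * B = q / T * (A - B) + q / (T * tau) * ((tau - T) * B).
  by field; rewrite !gt_eqF.
have iT : T^-1 <= 2 / tau by rewrite -[2 / tau]invf_div lef_pV2// posrE divr_gt0.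
have qT : q / T <= 2 / tau.
  by rewrite (le_trans _ iT)// -[leRHS]mul1r ler_wpM2r// invr_ge0 ltW.
rewrite (le_trans (ler_normD _ _))// lerD// normrM.
  rewrite (@ger0_norm _ (q / T)) ?divr_ge0 ?(ltW q0) ?(ltW T1)//.
  by apply: ler_pM => //; rewrite divr_ge0 ?(ltW q0) ?(ltW T1).
rewrite ger0_norm; last by rewrite divr_ge0 ?mulr_ge0 ?ltW.
have -> : 2 / tau ^+ 2 = 2 / tau / tau by field; rewrite gt_eqF.
rewrite normrM invfM [q * (_ / _)]mulrA; apply: ler_pM.
- by apply: divr_ge0; [apply: divr_ge0|]; apply: ltW.
- by rewrite mulr_ge0.
- by rewrite ler_wpM2r// invr_ge0 ltW.
- by apply: ler_pM => //; rewrite distrC.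
Qed.

End deterministic.

Section localization.
Context {R : realType} {d} {T : measurableType d} (P : probability T R).
Context {n sB : nat} (s0 : (0 < sB)%N) (n0 : (0 < n)%N).
Local Notation m := (n * sB)%N.
Context (mu pi1 rho : R) (H : 'I_m -> {RV P >-> bool}) (eps : 'I_m -> {RV P >-> R}).
Hypothesis pi01 : 0 < pi1 < 1.
Hypothesis rho1 : -1 <= rho <= 1.
Hypothesis model : two_group_model pi1 (block_correlation m sB rho) H eps.
Context (q : R).
Hypothesis q01 : 0 < q < 1.
Let q0 : 0 < q. Proof. by case/andP: q01. Qed.
Let q0' : 0 <= q. Proof. exact: ltW. Qed.

Let m0 : (0 < m)%N. Proof. by rewrite muln_gt0 n0. Qed.
Let mR : 0 < m%:R :> R. Proof. by rewrite ltr0n. Qed.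
Let r : R := Num.sqrt m%:R.
Let r_gt0 : 0 < r. Proof. by rewrite sqrtr_gt0. Qed.
Let r2 : r ^+ 2 = m%:R. Proof. by rewrite sqr_sqrtr// ltW. Qed.

Let pi0 := 1 - pi1.
Let B := null_ind mu H eps.
Let D := below_ind mu H eps.
Let F := rej_prob mu pi1.
Definition cut (w : T) := BH_cut q (fun i => pval mu H eps i w).
Definition dev_below t (w : T) : R := \sum_i (D t i w - F t).
Definition dev_null t (w : T) : R := \sum_i (B t i w - pi0 * t).

Let bmB_ t i : 0 < t < 1 -> bounded_measurable (B t i).
Proof. by move=> t01; exact: (bm_bspan (bspan_null_ind _ _ _ i t01)). Qed.
Let bmD_ t i : 0 < t < 1 -> bounded_measurable (D t i).
Proof. by move=> t01; exact: (bm_bspan (bspan_below_ind _ _ _ i t01)). Qed.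

Let bm_dev_null t : 0 < t < 1 -> bounded_measurable (dev_null t).
Proof. by move=> t01; apply: bm_sum => i; apply: bmB; [exact: bmB_|exact: bm_cst]. Qed.
Let bm_dev_below t : 0 < t < 1 -> bounded_measurable (dev_below t).
Proof. by move=> t01; apply: bm_sum => i; apply: bmB; [exact: bmD_|exact: bm_cst]. Qed.

Lemma measurable_dev_ge (u : T -> R) (e : R) : bounded_measurable u -> measurable [set w | e <= `|u w|].
Proof. by move=> bu; apply: (@measurable_ge _ _ _ (fun w => `|u w|)); have [] := bm_norm bu. Qed.

Lemma Pr_dev_below t g : 0 < t < 1 -> 0 < g ->
  Pr P [set w | m%:R * g <= `|dev_below t w|] <= sB%:R / (m%:R * g ^+ 2).
Proof.
move=> t01 g0; apply: le_trans (Pr_sqr P (bm_dev_below t01) (mulr_gt0 mR g0)) _.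
have -> : sB%:R / (m%:R * g ^+ 2) = m%:R * sB%:R / (m%:R * g) ^+ 2 :> R.
  by rewrite natrM; field; rewrite !gt_eqF// ltr0n.
by rewrite ler_wpM2r ?invr_ge0 ?sqr_ge0//; exact: (below_sum_sqr s0 mu pi01 model t01).
Qed.

Lemma Pr_dev_null t e : 0 < t < 1 -> 0 < e ->
  Pr P [set w | e * r <= `|dev_null t w|] <= sB%:R / e ^+ 2.
Proof.
move=> t01 g0; apply: le_trans (Pr_sqr P (bm_dev_null t01) (mulr_gt0 g0 r_gt0)) _.
have -> : sB%:R / e ^+ 2 = m%:R * sB%:R / (e * r) ^+ 2 :> R.
  by rewrite exprMn r2 natrM; field; rewrite !gt_eqF// ltr0n.
by rewrite ler_wpM2r ?invr_ge0 ?sqr_ge0//; exact: (null_sum_sqr s0 mu pi01 model t01).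
Qed.

Lemma dev_null_incr s t (w : T) : dev_null t w - dev_null s w = \sum_i (B t i w - B s i w - pi0 * (t - s)).
Proof. by rewrite /dev_null -sumrB; apply: eq_bigr => i _; ring. Qed.

Let bm_incr s t : 0 < s < 1 -> 0 < t < 1 -> bounded_measurable (fun w => dev_null t w - dev_null s w).
Proof. by move=> s01 t01; apply: bmB; exact: bm_dev_null. Qed.

Lemma Pr_incr s t e delta : 0 < s < 1 -> 0 < t < 1 -> 0 < e -> `|s - t| <= delta ->
  Pr P [set w | e * r <= `|dev_null t w - dev_null s w|] <= sB%:R * delta / e ^+ 2.
Proof.
wlog st : s t / s <= t => [wl|] s01 t01 e0 std.
  have [st|/ltW st] := leP s t; first exact: wl.
  have := wl _ _ st t01 s01 e0; rewrite distrC => /(_ std).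
  congr (Pr P _ <= _); apply/seteqP; split => w /=; by rewrite distrC.
apply: le_trans (Pr_sqr P (bm_incr s01 t01) (mulr_gt0 e0 r_gt0)) _.
have -> : sB%:R * delta / e ^+ 2 = m%:R * sB%:R * delta / (e * r) ^+ 2 :> R.
  by rewrite exprMn r2 natrM; field; rewrite !gt_eqF// ltr0n.
rewrite ler_wpM2r ?invr_ge0 ?sqr_ge0//.
rewrite (_ : (fun w => _) = fun w => (\sum_i (B t i w - B s i w - pi0 * (t - s))) ^+ 2); last first.
  by apply/funext => w; rewrite dev_null_incr.
apply: le_trans (null_incr_sqr s0 mu pi01 model s01 t01 st) _.
by rewrite ler_wpM2l ?mulr_ge0// (le_trans _ std)// ler0_norm ?opprB// subr_le0.
Qed.

Lemma num_belowE t (w : T) : (num_below (fun i => pval mu H eps i w) t)%:R = \sum_i D t i w :> R.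
Proof. by rewrite /num_below natr_sum. Qed.

Lemma num_null_belowE t (w : T) :
  (num_null_below (fun i => pval mu H eps i w) (fun i => H i w) t)%:R = \sum_i B t i w :> R.
Proof. by rewrite /num_null_below natr_sum. Qed.

Lemma dev_belowE t (w : T) : dev_below t w = \sum_i D t i w - m%:R * F t.
Proof. by rewrite /dev_below sumrB sumr_const card_ord mulr_natl. Qed.

Lemma dev_nullE t (w : T) : dev_null t w = \sum_i B t i w - m%:R * (pi0 * t).
Proof. by rewrite /dev_null sumrB sumr_const card_ord mulr_natl. Qed.

Lemma null_sum_mono s t (w : T) : s <= t -> \sum_i B s i w <= \sum_i B t i w.
Proof.
move=> st; apply: ler_sum => i _; rewrite /B /null_ind ler_nat.
by have [h|] := boolP (pval mu H eps i w <= s); rewrite ?(le_trans h st).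
Qed.

Lemma cut_ge t g (w : T) : g <= F t - t / q -> `|dev_below t w| < m%:R * g -> t <= cut w.
Proof.
move=> gF; rewrite dev_belowE ltr_norml => /andP[h _].
apply: le_BH_cut => //.
rewrite num_belowE; have : m%:R * g <= m%:R * (F t - t / q) by rewrite ler_wpM2l.
by move: h; rewrite mulrBr mulrA; set a := \sum_i _; lra.
Qed.

(** If T were in [s, t], then N(T) = m T / q >= m s / q, whereas N(T) <= N(t) < m (F t + g) <= m s /
    q. A deviation bound at the right endpoint thus excludes the whole cell. *)
Lemma cut_cell s t g (w : T) : g <= s / q - F t -> `|dev_below t w| < m%:R * g ->
  s <= cut w -> cut w <= t -> False.
Proof.
move=> gF; rewrite dev_belowE ltr_norml => /andP[_ h] sc ct.
have N : m%:R * cut w / q <= \sum_i D t i w.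
  rewrite -num_belowE -num_below_cutR// ler_nat; exact: num_below_mono.
have : m%:R * s / q <= m%:R * cut w / q by rewrite ler_wpM2r ?invr_ge0 ?(ltW q0)// ler_wpM2l.
have : m%:R * g <= m%:R * (s / q - F t) by rewrite ler_wpM2l.
by move: h N; rewrite mulrBr mulrA; set a := \sum_i _; lra.
Qed.

(** The count is monotone, so between grid points the deviation exceeds its endpoint values by at
    most the drift m (t - s). *)
Lemma dev_null_cell s t u tau (w : T) (e : R) : s <= u -> u <= t ->
  `|dev_null s w - dev_null tau w| <= e -> `|dev_null t w - dev_null tau w| <= e ->
  `|dev_null u w - dev_null tau w| <= e + m%:R * (t - s).
Proof.
move=> su ut; have := null_sum_mono w su; have := null_sum_mono w ut.
rewrite !dev_nullE !ler_norml; set a := \sum_i _; set b := \sum_i _; set c := \sum_i _.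
move=> h1 h2 /andP[h3 h4] /andP[h5 h6].
have p0 : 0 <= pi0 <= 1 by rewrite /pi0; case/andP: pi01 => *; lra.
have k1 : m%:R * (pi0 * (u - s)) <= m%:R * (t - s).
  by rewrite ler_wpM2l//; nra.
have k2 : m%:R * (pi0 * (t - u)) <= m%:R * (t - s).
  by rewrite ler_wpM2l//; nra.
have E1 : m%:R * (pi0 * (u - s)) = m%:R * (pi0 * u) - m%:R * (pi0 * s) by ring.
have E2 : m%:R * (pi0 * (t - u)) = m%:R * (pi0 * t) - m%:R * (pi0 * u) by ring.
apply/andP; split; lra.
Qed.

Lemma FDP_dev (w : T) : 0 < cut w ->
  r * (FDP q (fun i => pval mu H eps i w) (fun i => H i w) - pi0 * q) = q / cut w * (dev_null (cut w) w / r).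
Proof.
move=> c0; rewrite FDP_cut_pos//.
rewrite -/(cut w) num_null_belowE dev_nullE -r2; set a := \sum_i _.
by field; rewrite !gt_eqF.
Qed.


Lemma bigsetU_at (I : finType) (A : I -> set T) j : A j `<=` \big[setU/set0]_i A i.
Proof. by move=> w Aw; rewrite (bigD1 j)//=; left. Qed.

Lemma Pr_bigsetU_le (I : finType) (A : I -> set T) (c : R) :
  (forall i, measurable (A i)) -> (forall i, Pr P (A i) <= c) ->
  Pr P (\big[setU/set0]_i A i) <= #|I|%:R * c.
Proof.
move=> mA Ac; apply: (le_trans (Pr_bigcup P _ mA)).
by rewrite mulr_natl -sumr_const; apply: ler_sum => i _.
Qed.

Section deviation.
(** [delta] is the localization radius. The coarse grid [tU] has mesh [h], with h / q half of the
    gap k delta, so that moving from the right to the left end of a cell still leaves k delta / 2.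
    The fine grid [tF], of mesh [h'], covers [tau - delta, tau + delta]. [theta] and [L] bound the
    fluctuation of W at its points and |W(tau)|. *)
Variables (tau k t0 delta h h' theta L : R) (K N : nat).
Hypothesis tau_q : 0 < tau < q.
Hypothesis k0 : 0 < k.
Hypothesis gapU : forall t, tau <= t -> t < 1 -> F t - t / q <= - k * (t - tau).
Hypothesis gapL : forall t, t0 <= t -> t <= tau -> k * (tau - t) <= F t - t / q.
Hypothesis delta0 : 0 < delta.
Hypothesis delta_t0 : delta <= tau - t0.
Hypothesis delta_tau : delta <= tau / 2.
Hypothesis delta_q : delta < 1 - q.
Hypothesis hE : h = k * q * delta / 2.
Hypothesis hq : h < 1 - q.
Hypothesis Kh : 1 <= K%:R * h.
Hypothesis N0 : (0 < N)%N.
Hypothesis h'E : N%:R * h' = 2 * delta.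
Hypothesis theta0 : 0 < theta.
Hypothesis L0 : 0 < L.

Let tU (j : nat) := tau + delta + j%:R * h.
Let tF (j : nat) := tau - delta + j%:R * h'.

(** One point below tau is enough, by [cut_ge]; above tau every cell has to be excluded. *)
Definition bad1 := [set w | m%:R * (k * delta) <= `|dev_below (tau - delta) w|].
(** Cells are tested at their right endpoint. The cell containing T ends below 1, because T <= q and
    h < 1 - q. *)
Definition bad2 (j : 'I_K) := if tU j.+1 < 1 then
  [set w | m%:R * (k * delta / 2) <= `|dev_below (tU j.+1) w|] else set0.
Definition bad3 (j : 'I_N.+1) := [set w | theta * r <= `|dev_null (tF j) w - dev_null tau w|].
Definition bad4 := [set w | L * r <= `|dev_null tau w|].
Definition bad : set T := bad1 `|` (\big[setU/set0]_j bad2 j `|` (\big[setU/set0]_j bad3 j `|` bad4)).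

Let tau0 : 0 < tau. Proof. by case/andP: tau_q. Qed.
Let tauq : tau < q. Proof. by case/andP: tau_q. Qed.
Let q1 : q < 1. Proof. by case/andP: q01. Qed.
Let h0 : 0 < h. Proof. by rewrite hE divr_gt0// !mulr_gt0. Qed.
Let N0R : 0 < N%:R :> R. Proof. by rewrite ltr0n. Qed.
Let h'0 : 0 < h'.
Proof. by rewrite -(pmulr_rgt0 _ N0R) h'E mulr_gt0. Qed.
Let tau01 : 0 < tau < 1. Proof. by rewrite tau0 (lt_trans tauq). Qed.
Let tau_d : 0 < tau - delta < 1.
Proof. by move: tau0 tauq q1 delta_tau delta0 => *; apply/andP; split; lra. Qed.

Let tU01 j : tU j < 1 -> 0 < tU j < 1.
Proof.
move=> ->; rewrite andbT /tU.
have : 0 <= j%:R * h by rewrite mulr_ge0// ltW.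
by move: tau0 delta0 => *; lra.
Qed.

Let tF_dist (j : 'I_N.+1) : `|tF j - tau| <= delta.
Proof.
have jN : j%:R * h' <= N%:R * h' by rewrite ler_wpM2r ?(ltW h'0)// ler_nat -ltnS.
have j0 : 0 <= j%:R * h' by rewrite mulr_ge0// ltW.
rewrite h'E in jN; rewrite ler_norml /tF; apply/andP; split; lra.
Qed.

Let tF01 (j : 'I_N.+1) : 0 < tF j < 1.
Proof.
have := tF_dist j; rewrite ler_norml => /andP[h1 h2].
by move: tau0 tauq q1 delta_tau delta_q => *; apply/andP; split; lra.
Qed.

Let mbad1 : measurable bad1.
Proof. by apply: measurable_dev_ge; exact: bm_dev_below. Qed.
Let mbad2 j : measurable (bad2 j).
Proof.
rewrite /bad2; case: (boolP (tU j.+1 < 1)) => h1; last exact: measurable0.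
by apply: measurable_dev_ge; apply: bm_dev_below; exact: tU01.
Qed.
Let mbad3 j : measurable (bad3 j).
Proof. by apply: measurable_dev_ge; exact: bm_incr. Qed.
Let mbad4 : measurable bad4.
Proof. by apply: measurable_dev_ge; exact: bm_dev_null. Qed.
Let mbad2U : measurable (\big[setU/set0]_j bad2 j).
Proof. by apply: bigsetU_measurable => j _; exact: mbad2. Qed.
Let mbad3U : measurable (\big[setU/set0]_j bad3 j).
Proof. by apply: bigsetU_measurable => j _; exact: mbad3. Qed.
Let mbad34 := measurableU _ _ mbad3U mbad4.
Let mbad234 := measurableU _ _ mbad2U mbad34.

Lemma measurable_bad : measurable bad.
Proof. exact: measurableU. Qed.

Lemma Pr_bad : Pr P bad <= sB%:R / (m%:R * (k * delta) ^+ 2) +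
  (K%:R * (sB%:R / (m%:R * (k * delta / 2) ^+ 2)) +
  (N.+1%:R * (sB%:R * delta / theta ^+ 2) + sB%:R / L ^+ 2)).
Proof.
have kd : 0 < k * delta by rewrite mulr_gt0.
apply: (le_trans (PrU P mbad1 mbad234)); apply: lerD; first exact: Pr_dev_below.
apply: (le_trans (PrU P mbad2U mbad34)); apply: lerD.
  rewrite -[X in X%:R * _]card_ord; apply: Pr_bigsetU_le; [by []|move=> j].
  rewrite /bad2; case: (boolP (tU j.+1 < 1)) => h1.
    by apply: Pr_dev_below; [exact: tU01|rewrite divr_gt0].
  by rewrite /Pr measure0 divr_ge0// mulr_ge0 ?sqr_ge0// ltW.
apply: (le_trans (PrU P mbad3U mbad4)); apply: lerD; last exact: Pr_dev_null.
rewrite -[X in X%:R * _]card_ord; apply: Pr_bigsetU_le; [by []|move=> j].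
by apply: Pr_incr => //; rewrite distrC.
Qed.

Lemma dev_good w : ~ bad w ->
  `|r * (FDP q (fun i => pval mu H eps i w) (fun i => H i w) - pi0 * q) - q / tau * (dev_null tau w / r)|
  <= 2 / tau * (theta + r * h') + 2 / tau ^+ 2 * (delta * L).
Proof.
move=> nb; have n1 : ~ bad1 w by move=> b; apply: nb; left.
have n2 j : ~ bad2 j w by move=> b; apply: nb; right; left; exact: (@bigsetU_at _ bad2 j).
have n3 j : ~ bad3 j w by move=> b; apply: nb; right; right; left; exact: (@bigsetU_at _ bad3 j).
have n4 : ~ bad4 w by move=> b; apply: nb; right; right; right.
have c1 : tau - delta <= cut w.
  apply: (@cut_ge _ (k * delta)).
    have h1 : t0 <= tau - delta by move: delta_t0 => *; lra.
    have h2 : tau - delta <= tau by move: delta0 => *; lra.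
    by have := gapL h1 h2; rewrite opprB addrC subrK.
  by rewrite ltNge; apply/negP.
have cq : cut w <= q by exact: BH_cut_le.
(* Otherwise T, being at most q, lies in some cell of the coarse grid, where [cut_cell] gives a
   contradiction. *)
have c2 : cut w <= tau + delta.
  rewrite leNgt; apply/negP => c2.
  have K0 : (0 < K)%N.
    by rewrite lt0n; apply/eqP => K0; move: Kh; rewrite K0 mul0r ler10.
  have cK : cut w <= tau + delta + K%:R * h.
    by move: cq q1 Kh tau0 delta0 => *; lra.
  have [j jK [hj1 hj2]] := grid_cell K0 (ltW c2) cK.
  have jh : 0 <= j%:R * h by rewrite mulr_ge0// ltW.
  have jS : j.+1%:R * h = j%:R * h + h by rewrite -natr1 mulrDl mul1r.
  have t1 : tU j.+1 < 1 by rewrite /tU jS; move: hj1 cq hq => *; lra.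
  have := n2 (Ordinal jK); rewrite /bad2 /= t1 /= => /negP; rewrite -ltNge => bd.
  apply: (cut_cell _ bd hj1 hj2).
  have tt : tau <= tU j.+1 by rewrite /tU jS; move: delta0 h0 => *; lra.
  have := gapU tt t1.
  have -> : tU j.+1 = tau + delta + j%:R * h + h by rewrite /tU jS addrA.
  have -> : (tau + delta + j%:R * h + h) / q = (tau + delta + j%:R * h) / q + k * delta / 2.
    by rewrite mulrDl; congr (_ + _); rewrite hE; field; rewrite gt_eqF.
  have : 0 <= k * (j%:R * h + h) by rewrite mulr_ge0 ?addr_ge0 ?(ltW k0)// ltW.
  have -> : - k * (tau + delta + j%:R * h + h - tau) = - (k * delta) - k * (j%:R * h + h) by ring.
  set a := k * delta; set b := k * _; set c := _ / q; set f := F _; lra.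
have cp : 0 < cut w by apply: lt_le_trans c1; case/andP: tau_d.
rewrite FDP_dev//.
apply: ratio_dev => //.
- by rewrite q0 ltW.
- by rewrite ler_norml; apply/andP; split; lra.
- have cN : cut w <= tau - delta + N%:R * h' by rewrite h'E; lra.
  have [j jN [hj1 hj2]] := grid_cell N0 c1 cN.
  have b1 := n3 (Ordinal (ltnW jN : (j < N.+1)%N)); have b2 := n3 (Ordinal (jN : (j.+1 < N.+1)%N)).
  move/negP: b1; rewrite -ltNge => /ltW b1; move/negP: b2; rewrite -ltNge => /ltW b2.
  have := dev_null_cell hj1 hj2 b1 b2.
  have -> : tau - delta + j.+1%:R * h' - (tau - delta + j%:R * h') = h' by rewrite -natr1; ring.
  move=> hh; rewrite -mulrBl normrM [ `|r^-1|]gtr0_norm ?invr_gt0// ler_pdivrMr//.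
  by rewrite mulrDl mulrAC -expr2 r2.
- move/negP: n4; rewrite -ltNge => /ltW n4.
  by rewrite normrM [ `|r^-1|]gtr0_norm ?invr_gt0// ler_pdivrMr.
Qed.

End deviation.

End localization.

(** * Choice of the grids *)

Section parameters.
Context {R : realType}.

Lemma small_exists (s : seq R) : all (fun x => 0 < x) s -> exists2 x, 0 < x & all (fun y => x <= y) s.
Proof.
elim: s => [_|a s ih /= /andP[a0 /ih[x x0 xs]]]; first by exists 1.
exists (Num.min a x); first by rewrite lt_min a0.
rewrite ge_min lexx /=; apply/allP => y ys; rewrite ge_min; apply/orP; right; exact: (allP xs).
Qed.

Lemma cube_small (C e : R) : 0 < C -> 0 < e ->
  exists M : nat, forall m : nat, (M <= m)%N -> (0 < m)%N /\
    exists2 x : R, 0 < x <= e & m%:R * x ^+ 3 = C.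
Proof.
move=> C0 e0; exists (Num.truncn (C / e ^+ 3)).+1 => m Mm; split; first exact: leq_trans Mm.
have m0 : 0 < m%:R :> R by rewrite ltr0n (leq_trans _ Mm).
have Cm : C / m%:R <= e ^+ 3.
  rewrite ler_pdivrMr// mulrC -ler_pdivrMr ?exprn_gt0// ltW// (lt_le_trans (truncnS_gt _))//.
  by rewrite ler_nat.
have cm0 : 0 < C / m%:R by rewrite divr_gt0.
have x3 : ((C / m%:R) `^ 3^-1) ^+ 3 = C / m%:R.
  by rewrite -powR_mulrn ?powR_ge0// -powRrM mulVf ?powRr1 ?ltW.
exists ((C / m%:R) `^ 3^-1); last by rewrite x3 mulrCA divff ?mulr1 ?gt_eqF.
rewrite powR_gt0//= -(@ler_pXn2r _ 3)// ?x3// nnegrE ?powR_ge0 ?ltW//.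
Qed.

(* With m delta^3 = C the grid above tau has O(1/delta) cells, each contributing
   O(1/(m delta^2)); the fine grid has O(1/delta) cells of width O(delta^2), and
   sqrt(m) delta^2 = sqrt(C delta) tends to 0. *)
Lemma exists_grids (k q tau S d0 eta e : R) : 0 < k -> 0 < q < 1 -> 0 < tau -> 0 < S -> 0 < d0 ->
  0 < eta -> 0 < e ->
  exists M : nat, forall m : nat, (M <= m)%N -> (0 < m)%N /\
    exists (delta h h' theta L : R) (K N : nat),
    [/\ [/\ 0 < delta, delta <= d0, h = k * q * delta / 2, h < 1 - q & 1 <= K%:R * h],
        [/\ (0 < N)%N, N%:R * h' = 2 * delta, 0 < theta & 0 < L],
        2 / tau * (theta + Num.sqrt m%:R * h') + 2 / tau ^+ 2 * (delta * L) <= eta &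
        S / (m%:R * (k * delta) ^+ 2) + (K%:R * (S / (m%:R * (k * delta / 2) ^+ 2)) +
         (N.+1%:R * (S * delta / theta ^+ 2) + S / L ^+ 2)) <= e].
Proof.
move=> k0 /andP[q0 q1] tau0 S0 d00 eta0 e0.
(* [theta] makes 2 / tau times 2 theta equal to eta / 2, and [L] gives S / L^2 <= e / 4. Next, [c]
   and [C] are solved from the bounds for the fine and the coarse grid, each set equal to e / 4. *)
pose theta := eta * tau / 8; pose L := 1 + 4 * S / e.
pose c := e * theta ^+ 2 / (4 * S); pose C := 64 * S / (k ^+ 3 * q * e).
have theta0 : 0 < theta by rewrite divr_gt0 ?mulr_gt0.
have Se : 0 < 4 * S / e by rewrite divr_gt0 ?mulr_gt0.
have L1 : 1 < L by rewrite ltrDl.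
have L0 : 0 < L by apply: lt_trans L1.
have c0 : 0 < c by rewrite divr_gt0 ?mulr_gt0 ?exprn_gt0.
have C0 : 0 < C by rewrite divr_gt0 ?mulr_gt0 ?exprn_gt0.
have q'0 : 0 < 1 - q by rewrite subr_gt0.
(* The upper bounds on delta, in order: the prescribed [d0]; h < 1 - q; the error term in delta L; c
   / delta >= 4, so that the fine grid is nonempty; sqrt(m) h' <= theta; and the failure probability
   at tau - delta. *)
have sp : all (fun x => 0 < x) [:: d0; (1 - q) / (k * q); eta * tau ^+ 2 / (4 * L); c / 4;
    (theta * c / 4) ^+ 2 / C; e * k ^+ 2 * C / (4 * S)].
  have k2 : 0 < k ^+ 2 by rewrite exprn_gt0.
  have t2 : 0 < tau ^+ 2 by rewrite exprn_gt0.
  have tc : 0 < (theta * c / 4) ^+ 2 by rewrite exprn_gt0// divr_gt0// mulr_gt0.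
  rewrite /= d00 andbT /=; apply/and5P.
  split; apply: divr_gt0 => //; do ?[apply: mulr_gt0 => //].
have [d dpos] := small_exists sp.
rewrite /= andbT => /andP[dd0 /and5P[dq dL dc dC dS]].
have [M HM] := cube_small C0 dpos; exists M => m /HM[m0 [delta /andP[de0 ded] mC]]; split => //.
have mR : 0 < m%:R :> R by rewrite ltr0n.
have le x : d <= x -> delta <= x by exact: le_trans.
have {}dd0 := le _ dd0; have {}dq := le _ dq; have {}dL := le _ dL; have {}dc := le _ dc.
have {}dC := le _ dC; have {}dS := le _ dS.
pose h := k * q * delta / 2.
have kq0 : 0 < k * q by rewrite mulr_gt0.
have h0 : 0 < h by rewrite divr_gt0// mulr_gt0.
have hq : h < 1 - q.
  move: dq; rewrite ler_pdivlMr// => dq; apply: (@lt_le_trans _ _ (delta * (k * q))) => //.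
  have : 0 < delta * (k * q) by rewrite mulr_gt0.
  by rewrite /h; set x := delta * _; rewrite [k * q * delta]mulrC -/x; lra.
pose K := (Num.truncn (h^-1)).+1.
have Kl : h^-1 < K%:R by exact: truncnS_gt.
have Ku : K%:R <= 2 / h.
  rewrite /K -natr1 (_ : 2 / h = h^-1 + h^-1); last by field; rewrite gt_eqF.
  apply: lerD; first by rewrite truncn_le invr_ge0 ltW.
  by rewrite invf_ge1// ltW// (lt_trans hq)// gtrBl.
have cd : 4 <= c / delta by rewrite ler_pdivlMr//; move: dc; rewrite ler_pdivlMr//; lra.
(* The predecessor makes N + 1, the number of grid points, at most c / delta, while c / delta >= 4
   still gives N >= c / (2 delta). *)
pose N := (Num.truncn (c / delta)).-1.
have cd0 : 0 <= c / delta by rewrite divr_ge0 ?ltW.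
have tN : (4 <= Num.truncn (c / delta))%N.
  by rewrite -ltnS -(ltr_nat R) (le_lt_trans cd)//; exact: truncnS_gt.
have N0 : (0 < N)%N by rewrite /N -ltnS prednK (leq_trans _ tN).
have NS : N.+1 = Num.truncn (c / delta) by rewrite /N prednK// (leq_trans _ tN).
have Nl : c / delta < N%:R + 2.
  have := truncnS_gt (c / delta); rewrite -NS -natr1 -natr1 => x; lra.
have Nu : N.+1%:R <= c / delta by rewrite NS truncn_le.
have N0R : 0 < N%:R :> R by rewrite ltr0n.
have Nl2 : c / (2 * delta) <= N%:R.
  have -> : c / (2 * delta) = c / delta / 2 by field; rewrite gt_eqF.
  lra.
exists delta, h, (2 * delta / N%:R), theta, L, K, N; split.
- split => //; by rewrite -ler_pdivrMr// mul1r ltW.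
- by split => //; field; rewrite gt_eqF.
- set r := Num.sqrt _; have r0 : 0 < r by rewrite sqrtr_gt0.
  have r2 : r ^+ 2 = m%:R by rewrite sqr_sqrtr// ltW.
  have rd : r * delta ^+ 2 <= theta * c / 4.
    rewrite -(@ler_pXn2r _ 2)// ?nnegrE; last 2 first.
    - by rewrite mulr_ge0 ?sqr_ge0// ltW.
    - by rewrite divr_ge0// mulr_ge0 ?ltW.
    rewrite exprMn r2; move: dC; rewrite ler_pdivlMr// => dC; apply: le_trans dC.
    by rewrite -mC le_eqVlt; apply/orP; left; apply/eqP; ring.
  have rh : r * (2 * delta / N%:R) <= theta.
    rewrite mulrA ler_pdivrMr//; apply: (@le_trans _ _ (theta * (c / (2 * delta)))); last first.
      by rewrite ler_wpM2l// ltW.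
    have -> : theta * (c / (2 * delta)) = (theta * c / 4) * (2 / delta) by field; rewrite gt_eqF.
    have -> : r * (2 * delta) = r * delta ^+ 2 * (2 / delta) by field; rewrite gt_eqF.
    by rewrite ler_wpM2r// divr_ge0// ltW.
  have h1 : 2 / tau * (theta + r * (2 * delta / N%:R)) <= 2 / tau * (2 * theta).
    rewrite ler_wpM2l ?divr_ge0 ?(ltW tau0)//; lra.
  have h2 : 2 / tau ^+ 2 * (delta * L) <= eta / 2.
    move: dL; rewrite ler_pdivlMr ?mulr_gt0// => dL.
    rewrite mulrAC ler_pdivrMr ?exprn_gt0//; lra.
  have h3 : 2 / tau * (2 * theta) = eta / 2 by rewrite /theta; field; rewrite gt_eqF.
  lra.
- have a1 : S / (m%:R * (k * delta) ^+ 2) <= e / 4.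
    have -> : S / (m%:R * (k * delta) ^+ 2) = S * delta / (k ^+ 2 * C).
      by rewrite -mC; field; rewrite !gt_eqF.
    have kC : 0 < k ^+ 2 * C := mulr_gt0 (exprn_gt0 2 k0) C0.
    rewrite ler_pdivrMr//; move: dS; rewrite ler_pdivlMr; last by rewrite mulr_gt0.
    by set x := k ^+ 2 * C; rewrite -mulrA -/x => dS; rewrite mulrAC; lra.
  have a2 : K%:R * (S / (m%:R * (k * delta / 2) ^+ 2)) <= e / 4.
    apply: (@le_trans _ _ (2 / h * (S / (m%:R * (k * delta / 2) ^+ 2)))).
      rewrite ler_wpM2r// divr_ge0 ?(ltW S0)// mulr_ge0 ?sqr_ge0// ltW//.
    have -> : 2 / h * (S / (m%:R * (k * delta / 2) ^+ 2)) = 16 * S / (k ^+ 3 * q * C).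
      by rewrite -mC /h; field; rewrite !gt_eqF.
    by rewrite /C le_eqVlt; apply/orP; left; apply/eqP; field; rewrite !gt_eqF.
  have a3 : N.+1%:R * (S * delta / theta ^+ 2) <= e / 4.
    apply: (@le_trans _ _ (c / delta * (S * delta / theta ^+ 2))).
      by rewrite ler_wpM2r// divr_ge0 ?sqr_ge0// mulr_ge0 ?ltW.
    by rewrite /c le_eqVlt; apply/orP; left; apply/eqP; field; rewrite !gt_eqF.
  have a4 : S / L ^+ 2 <= e / 4.
    rewrite ler_pdivrMr ?exprn_gt0//.
    have L2 : L <= L ^+ 2 by rewrite expr2 ler_peMr// ltW.
    have : e / 4 * L <= e / 4 * L ^+ 2 by rewrite ler_wpM2l// divr_ge0// ltW.
    have -> : e / 4 * L = e / 4 + S by rewrite /L; field; rewrite gt_eqF.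
    move: e0; lra.
  lra.
Qed.

End parameters.

(** * Linearization of the false discovery proportion *)

Section transfer.
Context {R : realType} {d} {T : measurableType d} (P : probability T R).

Lemma cos_dist (x y : R) : `|cos x - cos y| <= `|x - y|.
Proof.
wlog xy : x y / x < y => [wl|].
  have [xy|yx|->] := ltgtP x y; [exact: wl| |by rewrite !subrr].
  by rewrite distrC [leRHS]distrC wl.
have [c [_ _ E]] := @MVT_real _ cos (fun z => - sin z) x y xy (fun z => is_derive_cos z).
rewrite distrC E normrM normrN [leRHS]distrC ler_piMl//.
by rewrite ler_norml sin_geN1 sin_le1.
Qed.

(** Slutsky's argument for cosines: the Lipschitz bound where X and Y are within [e], and the
    trivial bound 2 elsewhere. *)
Lemma Ex_cos_dist (X Y : T -> R) a b e : 0 <= e -> measurable_fun setT X -> measurable_fun setT Y ->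
  `|Ex P (fun w => cos (a * X w + b)) - Ex P (fun w => cos (a * Y w + b))| <=
  `|a| * e + 2 * Pr P [set w | e < `|X w - Y w|].
Proof.
move=> e0 mX mY.
have mS : measurable [set w | e < `|X w - Y w|].
  apply: (@measurable_lt _ _ _ (fun w => `|X w - Y w|)).
  by apply: measurableT_comp => //; exact: measurable_funB.
have bc (Z : T -> R) : measurable_fun setT Z -> bounded_measurable (fun w => cos (a * Z w + b)).
  move=> mZ; apply: bm_cos; apply: measurable_funD => //; exact: measurable_funM.
have bX := bc _ mX; have bY := bc _ mY.
have bb := @bm_bool R _ _ _ mS.
rewrite -ExB// (le_trans (normr_Ex P (bmB bX bY)))//.
rewrite -(Ex_bool P mS) -ExZ// -[`|a| * e](Ex_cst P) -ExD//; [|exact: bm_cst|exact: bmZ].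
apply: le_Ex; [exact: bm_norm (bmB bX bY)|apply: bmD; [exact: bm_cst|exact: bmZ]|move=> w].
case: ltP => [h|h] /=.
  have e2 : `|cos (a * X w + b) - cos (a * Y w + b)| <= 2.
    rewrite (le_trans (ler_normB _ _))// (_ : 2 = 1 + 1)//.
    by apply: lerD; rewrite ler_norml cos_geN1 cos_le1.
  by rewrite mulr1 (le_trans e2)// lerDr mulr_ge0.
rewrite mulr0 addr0 (le_trans (cos_dist _ _))//.
have -> : a * X w + b - (a * Y w + b) = a * (X w - Y w) by ring.
by rewrite normrM ler_wpM2l.
Qed.

End transfer.

Section model.
Context {R : realType} {d} {T : measurableType d} (P : probability T R).
Context (m : nat) (H : 'I_m -> {RV P >-> bool}) (eps : 'I_m -> {RV P >-> R}).

Definition scaled_FDP (q mu pi0 : R) (w : T) : R :=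
  Num.sqrt m%:R * (FDP q (fun i => pvalue mu (H i w) (eps i w)) (fun i => H i w) - pi0 * q).

Lemma measurable_scaled_FDP q mu pi0 : 0 <= q -> measurable_fun setT (scaled_FDP q mu pi0).
Proof.
move=> q0; apply: measurable_funM => //; apply: measurable_funB => //.
apply: measurable_FDP => // i; first exact: measurable_pvalue.
rewrite (_ : [set w | _] = [set w | H i w == true]); first exact: measurable_H.
by apply/seteqP; split => w /=; rewrite eqb_id.
Qed.

End model.

(** * Assembly of linearization, central limit theorem and tightness *)

Section limit.
Context {R : realType} (q mu pi1 rho tau : R) (sB : nat).
Hypothesis q01 : 0 < q < 1.
Hypothesis mu0 : 0 < mu.
Hypothesis pi01 : 0 < pi1 < 1.
Hypothesis rho1 : -1 <= rho <= 1.
Hypothesis s0 : (0 < sB)%N.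
Hypothesis crossing : BH_crossing q mu pi1 tau.

Let tau01 : 0 < tau < 1. Proof. by case: crossing. Qed.
Let v := (q / tau) ^+ 2 * @block_var R sB pi1 rho tau.

Definition linear_part {d} {T : measurableType d} {P : probability T R} n
    (H : 'I_(n * sB) -> {RV P >-> bool}) (eps : 'I_(n * sB) -> {RV P >-> R}) (w : T) : R :=
  q / tau * (dev_null mu pi1 H eps tau w / Num.sqrt (n * sB)%:R).

Lemma measurable_linear_part {d} {T : measurableType d} {P : probability T R} n
    (H : 'I_(n * sB) -> {RV P >-> bool}) (eps : 'I_(n * sB) -> {RV P >-> R}) :
  measurable_fun setT (linear_part H eps).
Proof.
apply: measurable_funM => //; apply: measurable_funM => //.
have b : bounded_measurable (dev_null mu pi1 H eps tau).
  by apply: bm_sum => i; apply: bmB; [exact: (bm_bspan (bspan_null_ind _ _ _ i tau01))|exact: bm_cst].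
by case: b.
Qed.

Lemma Pr_dev_small (eta e : R) : 0 < eta -> 0 < e ->
  exists M : nat, forall n, (M <= n * sB)%N -> (0 < n)%N /\
  forall d (T : measurableType d) (P : probability T R)
    (H : 'I_(n * sB) -> {RV P >-> bool}) (eps : 'I_(n * sB) -> {RV P >-> R}),
  two_group_model pi1 (block_correlation (n * sB) sB rho) H eps ->
  Pr P [set w | eta < `|scaled_FDP H eps q mu (1 - pi1) w - linear_part H eps w|] <= e.
Proof.
move=> eta0 e0; have [k [t0 [k0 /andP[t00 t0t] gU gL]]] := crossing_gap mu0 q01 pi01 crossing.
have tq := crossing_lt_q q01 pi01 crossing.
have [t_0 t_1] := andP tau01; have [q0 q1] := andP q01.
have sp : all (fun x => 0 < x) [:: tau - t0; tau / 2; (1 - q) / 2].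
  by rewrite /= subr_gt0 t0t !divr_gt0// subr_gt0.
have [d0 d00] := small_exists sp; rewrite /= andbT => /and3P[d1 d2 d3].
have sR : 0 < sB%:R :> R by rewrite ltr0n.
have [M HM] := exists_grids k0 q01 t_0 sR d00 eta0 e0.
exists M => n /HM[m0 [delta [h [h' [theta [L [K [N [[a1 a2 a3 a4 a5] [b1 b2 b3 b4] c1 c2]]]]]]]]].
have n0 : (0 < n)%N by move: m0; rewrite muln_gt0 => /andP[].
split => // d T P H eps model.
have x1 : delta <= tau - t0 by exact: le_trans d1.
have x2 : delta <= tau / 2 by exact: le_trans d2.
have x3 : delta < 1 - q by apply: le_lt_trans (le_trans a2 d3) _; lra.
have tq' : 0 < tau < q by rewrite t_0.
apply: le_trans c2.
apply: le_trans (Pr_bad s0 n0 mu pi01 model q01 K tq' k0 a1 x2 x3 a3 b1 b2 b3 b4).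
apply: le_Pr.
- apply: (@measurable_lt _ _ _ (fun w => `|scaled_FDP H eps q mu (1 - pi1) w - linear_part H eps w|)).
  apply: measurableT_comp => //; apply: measurable_funB; last exact: measurable_linear_part.
  exact: measurable_scaled_FDP (ltW q0).
- exact: (measurable_bad mu pi1 H eps q01 theta L K tq' k0 a1 x2 x3 a3 b1 b2).
- move=> w /=; rewrite ltNge; apply: contraNP => nb.
  apply: le_trans c1.
  exact: (dev_good s0 n0 pi01 q01 tq' k0 gU gL a1 x1 x2 a3 a4 a5 b1 b2 nb).
Qed.


Lemma sqrt_nat_large (x : R) : exists M : nat, forall m, (M <= m)%N -> x <= Num.sqrt m%:R.
Proof.
exists (Num.truncn (x ^+ 2)).+1 => m Mm; rewrite (le_trans (ler_norm x))// -sqrtr_sqr ler_sqrt//.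
by rewrite ltW// (lt_le_trans (truncnS_gt _))// ler_nat.
Qed.

Lemma scaled_FDP_cos a b e : 0 < e -> exists M : nat, forall n, (M <= n * sB)%N ->
  forall d (T : measurableType d) (P : probability T R)
    (H : 'I_(n * sB) -> {RV P >-> bool}) (eps : 'I_(n * sB) -> {RV P >-> R}),
  two_group_model pi1 (block_correlation (n * sB) sB rho) H eps ->
  `|Ex P (fun w => cos (a * scaled_FDP H eps q mu (1 - pi1) w + b)) - expR (- (a ^+ 2 * v / 2)) * cos b| <= e.
Proof.
(* Error budget: e / 2 for the central limit theorem, |a| eta <= e / 4 for the Lipschitz part, and
   twice e / 8 for the exceptional event. *)
move=> e0; pose eta := e / 4 / (`|a| + 1).
have a1 : 0 < `|a| + 1 by rewrite ltr_wpDl.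
have eta0 : 0 < eta by rewrite !divr_gt0.
have e8 : 0 < e / 8 by rewrite divr_gt0.
have [M1 H1] := Pr_dev_small eta0 e8.
pose a' := a * (q / tau).
have [M2 H2] := sqrt_nat_large (`|a'| * sB%:R).
have [M3 H3] := sqrt_nat_large (6 * (`|a'| * sB%:R) ^+ 3 / (e / 2)).
exists (maxn M1 (maxn M2 M3)) => n; rewrite !geq_max => /and3P[h1 h2 h3] d T P H eps model.
have [n0 /(_ _ _ _ _ _ model) PD] := H1 _ h1.
have q0 : 0 <= q by case/andP: q01 => /ltW.
have := Ex_cos_dist P a b (ltW eta0) (measurable_scaled_FDP H eps mu (1 - pi1) q0) (measurable_linear_part H eps).
have r0 : 0 < Num.sqrt (n * sB)%:R :> R by rewrite sqrtr_gt0 ltr0n muln_gt0 n0.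
have := clt_cos s0 mu pi01 rho1 model tau01 b (H2 _ h2) n0.
have -> : a' ^+ 2 * @block_var R sB pi1 rho tau / 2 = a ^+ 2 * v / 2 by rewrite /v /a'; ring.
have E w : a' * (\sum_i (null_ind mu H eps tau i w - (1 - pi1) * tau) / Num.sqrt (n * sB)%:R) + b =
    a * linear_part H eps w + b.
  by rewrite -mulr_suml /a' -[a * _ * _]mulrA.
under [X in `|Ex P X - _|]eq_fun do rewrite E.
have := H3 _ h3; rewrite ler_pdivrMr ?divr_gt0// => k3.
set A := Ex P _; set B := Ex P _; set C := _ * cos b => c1 c2.
have {}c1 : `|A - C| <= e / 2.
  by rewrite (le_trans c1)// ler_pdivrMr// [leRHS]mulrC.
have ae : `|a| * eta <= e / 4.
  rewrite /eta mulrCA ler_piMr ?divr_ge0 ?ltW// ltr_pdivrMr// mul1r; lra.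
have -> : B - C = (B - A) + (A - C) by ring.
rewrite (le_trans (ler_normD _ _))//; lra.
Qed.

(** Off two small events the scaled proportion is within 1 of its linear part, which is at most (q /
    tau) L by Chebyshev's inequality for W(tau). *)
Lemma scaled_FDP_tight e : 0 < e -> exists (L : R) (M : nat), forall n, (M <= n * sB)%N ->
  forall d (T : measurableType d) (P : probability T R)
    (H : 'I_(n * sB) -> {RV P >-> bool}) (eps : 'I_(n * sB) -> {RV P >-> R}),
  two_group_model pi1 (block_correlation (n * sB) sB rho) H eps ->
  Pr P [set w | L < `|scaled_FDP H eps q mu (1 - pi1) w|] <= e.
Proof.
move=> e0; have e2 : 0 < e / 2 by rewrite divr_gt0.
have [M HM] := Pr_dev_small ltr01 e2.
have sR : 0 < sB%:R :> R by rewrite ltr0n.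
pose L : R := 1 + 2 * sB%:R / e.
have L1 : 1 <= L by rewrite lerDl divr_ge0 ?mulr_ge0 ?ltW.
have L0 : 0 < L by apply: lt_le_trans L1.
have [t_0 _] := andP tau01; have [q0 _] := andP q01.
have qt : 0 < q / tau by rewrite divr_gt0.
exists (1 + q / tau * L), M => n /HM[n0 /(_ _ _ _ _ _ _) PD] d T P H eps model.
have {}PD := PD _ _ _ _ _ model.
have mX := measurable_scaled_FDP H eps mu (1 - pi1) (ltW q0).
have mY := measurable_linear_part H eps.
have bB : bounded_measurable (dev_null mu pi1 H eps tau).
  by apply: bm_sum => i; apply: bmB; [exact: (bm_bspan (bspan_null_ind _ _ _ i tau01))|exact: bm_cst].
have r0 : 0 < Num.sqrt (n * sB)%:R :> R by rewrite sqrtr_gt0 ltr0n muln_gt0 n0.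
have PB := Pr_dev_null s0 n0 mu pi01 model tau01 L0.
have m1 : measurable [set w | 1 < `|scaled_FDP H eps q mu (1 - pi1) w - linear_part H eps w|].
  apply: (@measurable_lt _ _ _ (fun w => `|scaled_FDP H eps q mu (1 - pi1) w - linear_part H eps w|)).
  by apply: measurableT_comp => //; exact: measurable_funB.
have m2 := measurable_dev_ge (L * Num.sqrt (n * sB)%:R) bB.
have m3 : measurable [set w | 1 + q / tau * L < `|scaled_FDP H eps q mu (1 - pi1) w|].
  apply: (@measurable_lt _ _ _ (fun w => `|scaled_FDP H eps q mu (1 - pi1) w|)).
  exact: measurableT_comp.
have sL : sB%:R / L ^+ 2 <= e / 2.
  rewrite ler_pdivrMr ?exprn_gt0//.
  have : e / 2 * L <= e / 2 * L ^+ 2 by rewrite ler_wpM2l ?(ltW e2)// expr2 ler_peMr// ltW.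
  have -> : e / 2 * L = e / 2 + sB%:R by rewrite /L; field; rewrite gt_eqF.
  lra.
apply: (@le_trans _ _ (e / 2 + e / 2)); last lra.
apply: (le_trans _ (lerD PD (le_trans PB sL))); apply: le_trans (PrU P m1 m2).
apply: le_Pr => //; first exact: measurableU.
move=> w /= h; apply: contrapT => /not_orP[/negP + /negP]; rewrite -leNgt -ltNge => h1 h2.
move: h; apply/negP; rewrite -leNgt.
rewrite -[scaled_FDP _ _ _ _ _ _](subrK (linear_part H eps w)) (le_trans (ler_normD _ _))// lerD//.
rewrite /linear_part normrM (gtr0_norm qt) ler_wpM2l ?(ltW qt)//.
by rewrite normrM normfV (gtr0_norm r0) ler_pdivrMr// ltW.
Qed.

End limit.

Theorem corollary4p2 (R : realType) (q mu pi1 rho : R) (sB : nat)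
    (d : nat -> measure_display) (T : forall m : nat, measurableType (d m))
    (P : forall m : nat, probability (T m) R)
    (H : forall m : nat, 'I_m -> {RV (P m) >-> bool})
    (eps : forall m : nat, 'I_m -> {RV (P m) >-> R})
    (hq : 0 < q < 1) (hmu : 0 < mu) (hpi1 : 0 < pi1 < 1)
    (hsB : (0 < sB)%N) (hrho : -1 <= rho <= 1)
    (hmodel : forall m : nat, (sB %| m)%N ->
       two_group_model pi1 (block_correlation m sB rho) (@H m) (@eps m)) :
  let pi0 := 1 - pi1 in
  (exists! t : R, BH_crossing q mu pi1 t) /\
  forall tau : R, BH_crossing q mu pi1 tau ->
    cvg_in_distribution (within [set m | (sB %| m)%N] \oo) P
      (fun m w =>
         Num.sqrt m%:R *
         (FDP q (fun i => pvalue mu (@H m i w) (@eps m i w))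
                (fun i => @H m i w) - pi0 * q))
      (centered_normal
         (pi0 ^+ 2 * q ^+ 2 / tau ^+ 2 *
          (tau / pi0 - tau ^+ 2 + (sB%:R - 1) * rho_tilde tau tau rho))).
Proof.
move=> pi0; have [q0 q1] := andP hq; split; first exact: crossing_exists_unique.
move=> tau cr; have [tau01 _] := cr; have [t0 _] := andP tau01; have [p0 p1] := andP hpi1.
have mX m := measurable_scaled_FDP (@H m) (@eps m) mu (1 - pi1) (ltW q0).
split; first exact: mX.
move=> x; set v := (v in centered_normal v).
have vE : v = (q / tau) ^+ 2 * @block_var R sB pi1 rho tau.
  rewrite /v /block_var /pi0; field.
  by rewrite !gt_eqF// subr_gt0.
apply: (levy_continuity mX); rewrite ?vE.
- apply: mulr_ge0; first exact: sqr_ge0.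
  (* Nonnegativity is read off the model with a single block, m = sB, where sB times the quantity is
     a variance. *)
  exact: (@block_var_ge0 _ _ _ _ 1 sB hsB mu _ _ _ _ hpi1 hrho (hmodel _ (dvdn_mull 1 (dvdnn sB))) _ tau01 isT).
- move=> a b; apply/cvgrPdist_le => e e0.
  have [M HM] := scaled_FDP_cos hq hmu hpi1 hrho hsB cr a b e0.
  exists M => // m /= Mm /dvdnP[n mE]; subst m; rewrite distrC.
  by apply: HM => //; apply: hmodel; exact: dvdn_mull.
- move=> e e0; have [L [M HM]] := scaled_FDP_tight rho hq hmu hpi1 hsB cr e0.
  exists L; exists M => // m /= Mm /dvdnP[n mE]; subst m.
  by apply: HM => //; apply: hmodel; exact: dvdn_mull.
Qed.
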